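(* Let $(P,\mathfrak{n},k)$ be a regular local ring of Krull dimension $d$ that contains its residue field $k$ as a subring. Let $f_1,\dots,f_c$ ($c\ge 1$) be a $P$-regular sequence contained in $\mathfrak{n}^2$, $I=(f_1,\dots,f_c)$ and $R:=P/I$. If $M$ is an $R$-module with $\operatorname{rank}_k M$ finite, then $\mathcal{V}_R(M)\subseteq k^c$ is defined by the vanishing of the ideal $I_r(C(M))$ of $k[s_1,\dots,s_c]$, where $r:=(\operatorname{rank}_kM)\,2^{d-1}$; that is, $$\mathcal{V}_R(M)=\{\boldsymbol a\in k^c\mid h(\boldsymbol a)=0\text{ for all }h\in I_r(C(M))\}.$$ Here $C(M)$ is the $k[s_1,\dots,s_c]$-linear endomorphism defined in the context.
   Context: Definition of $C(M)$. Let $P[\boldsymbol{s}]=P[s_1,\dots,s_c]$ be a polynomial ring, $\widetilde f:=\sum_i s_if_i$, and $\widetilde Q:=P[\boldsymbol{s}]/(\widetilde f)$. The $\widetilde Q$-module $\widetilde Q/\mathfrak{n}\widetilde Q\cong k[\boldsymbol{s}]$ has a free resolution $G$ such that $G_i= \widetilde Q^{\,2^{d-1}}$ for $i\ge d$ and that is $2$-periodic from degree $d$ on, i.e. $G_{\ge d}$ has the form $$\cdots\xrightarrow{\ B\ }G_{d+3}\xrightarrow{\ A\ }G_{d+2}\xrightarrow{\ B\ }G_{d+1}\xrightarrow{\ A\ }G_d$$ with $A,B$ square matrices of size $2^{d-1}$ over $\widetilde Q$; fix such a $G$. For an $R$-module $M$, $M[\boldsymbol{s}]:=P[\boldsymbol{s}]\otimes_PM$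 is a $\widetilde Q$-module, and $A$, $B$ define $\widetilde Q$-linear endomorphisms of $M[\boldsymbol{s}]^{2^{d-1}}$, hence an endomorphism $$C(M):=\begin{bmatrix}0&A\\ B&0\end{bmatrix}\colon M[\boldsymbol{s}]^{2^d}\longrightarrow M[\boldsymbol{s}]^{2^d}.$$ When $\operatorname{rank}_kM$ is finite, $M[\boldsymbol{s}]\cong k[\boldsymbol{s}]\otimes_kM$ and $C(M)$ is viewed as an endomorphism of a free $k[\boldsymbol{s}]$-module of rank $(\operatorname{rank}_kM)2^d$. For a homomorphism $\delta$ of finite free modules, $I_r(\delta)$ is the ideal generated by the $r\times r$ minors of a matrix representing $\delta$ (with $I_0(\delta)$ the unit ideal). Support set: $\mathcal V_R(M)$ is the homological support set of $M$ with respect to the canonical surjection $P\to R$, in coordinates given by $f_1,\dots,f_c$. A lifting of $\boldsymbol{a}\in k^c$ is $\boldsymbol{a}'\in P^c$ with $a'_i\equiv a_i\bmod\mathfrak{n}$ for all $i$ and $\sum_ia'_if_i$ not a zero divisor in $P$. Then $$\mathcal{V}_R(M)=\{\boldsymbol{a}\in k^c\mid \text{there exists a lifting }\boldsymbol{a}'\text{ of }\boldsymbol{a}\text{ with }\operatorname{proj\,dim}_{P/(f)}M=\infty\text{ for }f=\sum_ia'_if_i\}$$ (the zero module has finite projective dimension). *)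

(* Defs.v *)
From HB Require Import structures.
From mathcomp Require Import all_boot all_algebra.
From mathcomp Require Import boolp classical_sets.
From mathcomp Require Import freeg mpoly.

Set Implicit Arguments.
Unset Strict Implicit.
Unset Printing Implicit Defensive.

Import GRing.Theory Quotient.

Local Open Scope ring_scope.
Local Open Scope quotient_scope.
Local Open Scope classical_set_scope.

Section Span.
Variables (S : pzRingType) (F : lmodType S).

Definition span (X : set F) : {pred F} :=
  fun x => `[< exists p (a : 'I_p -> S) (g : 'I_p -> F),
                 (forall i, X (g i)) /\ x = \sum_i a i *: g i >].

Lemma spanP (X : set F) x :
  reflect (exists p (a : 'I_p -> S) (g : 'I_p -> F),
             (forall i, X (g i)) /\ x = \sum_i a i *: g i) (x \in span X).
Proof. exact: asboolP. Qed.

Lemma mem_span (X : set F) x : X x -> x \in span X.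
Proof.
move=> Xx; apply/spanP; exists 1, (fun=> 1), (fun=> x).
by rewrite big_ord1 scale1r.
Qed.

Lemma span_submod_closed (X : set F) : submod_closed (span X).
Proof.
split.
  apply/spanP; exists 0, (fun=> 0), (fun=> 0).
  by rewrite big_ord0; split=> // -[].
move=> b x y /spanP[p [a [g [Xg ->]]]] /spanP[q [a' [g' [Xg' ->]]]].
apply/spanP; exists (p + q)%N.
exists (fun i => match split i with inl j => b * a j | inr j => a' j end).
exists (fun i => match split i with inl j => g j | inr j => g' j end).
split=> [i|]; first by case: (split i).
rewrite big_split_ord /= scaler_sumr; congr (_ + _); apply: eq_bigr => i _.
  by rewrite (unsplitK (inl i)) scalerA.
by rewrite (unsplitK (inr i)).
Qed.

HB.instance Definition _ (X : set F) :=
  GRing.isSubmodClosed.Build S F (span X) (span_submod_closed X).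

End Span.

Section QuotientModule.
Variables (S : pzRingType) (F : lmodType S) (X : set F).

Definition quot_mod : Type := {quot (span X)}.

HB.instance Definition _ := GRing.Zmodule.on quot_mod.

Definition quot_proj : F -> quot_mod := \pi_{quot (span X)}.

Lemma quot_projK (x : quot_mod) : quot_proj (repr x) = x.
Proof. exact: reprK. Qed.

Lemma quot_proj_eq (x y : F) :
  reflect (quot_proj x = quot_proj y) (x - y \in span X).
Proof. by rewrite idealrBE; apply: eqP. Qed.

Lemma quot_proj_zmod_morphism : zmod_morphism quot_proj.
Proof. exact: (raddfB \pi_{quot (span X)}). Qed.

HB.instance Definition _ :=
  GRing.isZmodMorphism.Build F quot_mod quot_proj quot_proj_zmod_morphism.

Definition quot_scale (a : S) (x : quot_mod) : quot_mod :=
  quot_proj (a *: repr x).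

Lemma quot_projZ_subproof a x : quot_proj (a *: x) = quot_scale a (quot_proj x).
Proof.
apply/quot_proj_eq; rewrite -scalerBr rpredZ //.
by apply/quot_proj_eq; rewrite quot_projK.
Qed.

Fact quot_scaleA a b x : quot_scale a (quot_scale b x) = quot_scale (a * b) x.
Proof.
by rewrite -[x]quot_projK -!quot_projZ_subproof scalerA.
Qed.
Fact quot_scale1 : left_id 1 quot_scale.
Proof. by move=> x; rewrite -[x]quot_projK -quot_projZ_subproof scale1r. Qed.
Fact quot_scaleDr : right_distributive quot_scale +%R.
Proof.
move=> a x y; rewrite -[x]quot_projK -[y]quot_projK -raddfD.
by rewrite -!quot_projZ_subproof -raddfD scalerDr.
Qed.
Fact quot_scaleDl x : {morph quot_scale^~ x : a b / a + b}.
Proof.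
move=> a b; rewrite -[x]quot_projK -!quot_projZ_subproof -raddfD.
by rewrite scalerDl.
Qed.

HB.instance Definition _ := GRing.Zmodule_isLmodule.Build S quot_mod
  quot_scaleA quot_scale1 quot_scaleDr quot_scaleDl.

Fact quot_proj_scalable : scalable quot_proj.
Proof. exact: quot_projZ_subproof. Qed.

HB.instance Definition _ :=
  GRing.isScalable.Build S F quot_mod *:%R quot_proj quot_proj_scalable.

End QuotientModule.

Section QuotientRing.
Variable S : comPzRingType.

Definition ideal_gen (X : set S) : set S :=
  [set x | x \in span (X : set S^o)].

Variable X : set S.

(* S / (X) *)
Definition quot_ring : Type := @quot_mod S S^o X.

HB.instance Definition _ := GRing.Zmodule.on quot_ring.

Definition quot_map : S -> quot_ring := @quot_proj S S^o X.

Lemma quot_mapK (x : quot_ring) : quot_map (repr x) = x.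
Proof. exact: quot_projK. Qed.

Lemma quot_map_zmod_morphism : zmod_morphism quot_map.
Proof. exact: (@quot_proj_zmod_morphism S S^o X). Qed.

HB.instance Definition _ :=
  GRing.isZmodMorphism.Build S quot_ring quot_map quot_map_zmod_morphism.

Definition quot_one : quot_ring := quot_map 1.
Definition quot_mul (x y : quot_ring) : quot_ring := quot_map (repr x * repr y).

Lemma quot_mapM_subproof x y :
  quot_map (x * y) = quot_mul (quot_map x) (quot_map y).
Proof.
have cong a b b' : quot_map b = quot_map b' ->
    quot_map (a * b) = quot_map (a * b').
  move=> e; rewrite [LHS](@quot_projZ_subproof S S^o).
  by rewrite [RHS](@quot_projZ_subproof S S^o) -/(quot_map b) e.
rewrite /quot_mul (cong x y (repr (quot_map y))) ?quot_mapK //.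
by rewrite mulrC [RHS](congr1 quot_map (mulrC _ _)); apply: cong; rewrite quot_mapK.
Qed.

Fact quot_mulA : associative quot_mul.
Proof.
move=> x y z; rewrite -[x]quot_mapK -[y]quot_mapK -[z]quot_mapK.
by rewrite -!quot_mapM_subproof mulrA.
Qed.
Fact quot_mulC : commutative quot_mul.
Proof. by move=> x y; rewrite /quot_mul mulrC. Qed.
Fact quot_mul1 : left_id quot_one quot_mul.
Proof.
by move=> x; rewrite -[x]quot_mapK -quot_mapM_subproof mul1r.
Qed.
Fact quot_mulDl : left_distributive quot_mul +%R.
Proof.
move=> x y z; rewrite -[x]quot_mapK -[y]quot_mapK -[z]quot_mapK.
by rewrite -raddfD -!quot_mapM_subproof -raddfD mulrDl.
Qed.

HB.instance Definition _ := GRing.Zmodule_isComPzRing.Build quot_ring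
  quot_mulA quot_mulC quot_mul1 quot_mulDl.

Fact quot_map_monoid_morphism : monoid_morphism quot_map.
Proof. by split=> // x y; apply: quot_mapM_subproof. Qed.

HB.instance Definition _ :=
  GRing.isMonoidMorphism.Build S quot_ring quot_map quot_map_monoid_morphism.

Lemma quot_map_eq0 (x : S) : ideal_gen X x -> quot_map x = 0.
Proof.
move=> Xx; rewrite -(raddf0 quot_map).
by apply/(@quot_proj_eq S S^o); rewrite subr0.
Qed.

Lemma quot_map_eq (x y : S) : quot_map x = quot_map y -> ideal_gen X (x - y).
Proof. by move/(@quot_proj_eq S S^o). Qed.

End QuotientRing.

Section Restriction.
Variables (A B : pzRingType) (phi : {rmorphism A -> B}).

(* The vacuous binding records phi, which determines the module structure. *)
Definition restrict (N : lmodType B) : Type := let _ := phi in N.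

Section Instances.
Variable N : lmodType B.

HB.instance Definition _ := GRing.Zmodule.copy (restrict N) N.

Definition restrict_scale (a : A) (x : restrict N) : restrict N :=
  phi a *: (x : N).

Fact restrict_scaleA a b x :
  restrict_scale a (restrict_scale b x) = restrict_scale (a * b) x.
Proof. by rewrite /restrict_scale scalerA rmorphM. Qed.
Fact restrict_scale1 : left_id 1 restrict_scale.
Proof. by move=> x; rewrite /restrict_scale rmorph1 scale1r. Qed.
Fact restrict_scaleDr : right_distributive restrict_scale +%R.
Proof. by move=> a x y; rewrite /restrict_scale -scalerDr. Qed.
Fact restrict_scaleDl x : {morph restrict_scale^~ x : a b / a + b}.
Proof. by move=> a b; rewrite /restrict_scale rmorphD scalerDl. Qed.

HB.instance Definition _ := GRing.Zmodule_isLmodule.Build A (restrict N)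
  restrict_scaleA restrict_scale1 restrict_scaleDr restrict_scaleDl.

End Instances.

Definition restrict_map (N N' : lmodType B) (g : {linear N -> N'}) :
  restrict N -> restrict N' := g.

Fact restrict_map_zmod_morphism (N N' : lmodType B) (g : {linear N -> N'}) :
  zmod_morphism (restrict_map g).
Proof. exact: (raddfB g). Qed.

Fact restrict_map_scalable (N N' : lmodType B) (g : {linear N -> N'}) :
  scalable (restrict_map g).
Proof. by move=> a x; rewrite [LHS](linearZZ g). Qed.

HB.instance Definition _ (N N' : lmodType B) (g : {linear N -> N'}) :=
  GRing.isZmodMorphism.Build (restrict N) (restrict N') (restrict_map g)
    (restrict_map_zmod_morphism g).
HB.instance Definition _ (N N' : lmodType B) (g : {linear N -> N'}) :=
  GRing.isScalable.Build A (restrict N) (restrict N') *:%R (restrict_map g)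
    (@restrict_map_scalable N N' g).

End Restriction.

Definition killed_by (S : pzRingType) (X : set S) (N : lmodType S) : Prop :=
  forall x, X x -> forall v : N, x *: v = 0.

(* The S/(X)-module structure of an S-module killed by X; by descend_scaleE the
   choice of representatives is immaterial. *)
Section Descent.
Variables (S : comPzRingType) (X : set S) (N : lmodType S).
Hypothesis XN : killed_by X N.

Definition descend : Type := let _ := XN in N.

HB.instance Definition _ := GRing.Zmodule.copy descend N.

Definition descend_scale (q : quot_ring X) (v : descend) : descend :=
  (repr q : S) *: (v : N).

Lemma ideal_gen_scale0 (x : S) (v : N) : ideal_gen X x -> x *: v = 0.
Proof.
case/spanP=> p [a [g [Xg ->]]]; rewrite scaler_suml big1 // => i _.
by rewrite -[a i *: _]/(a i * g i) -scalerA (XN (Xg i)) scaler0.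
Qed.

Lemma descend_scaleE (x : S) (v : descend) :
  descend_scale (quot_map X x) v = x *: (v : N).
Proof.
apply/eqP; rewrite -subr_eq0 -scalerBl ideal_gen_scale0 //.
by apply: quot_map_eq; rewrite quot_mapK.
Qed.

Fact descend_scaleA a b x :
  descend_scale a (descend_scale b x) = descend_scale (a * b) x.
Proof.
rewrite -[a]quot_mapK -[b]quot_mapK -rmorphM !descend_scaleE.
exact: scalerA.
Qed.
Fact descend_scale1 : left_id 1 descend_scale.
Proof.
by move=> x; rewrite -(rmorph1 (quot_map X)) descend_scaleE; apply: scale1r.
Qed.
Fact descend_scaleDr : right_distributive descend_scale +%R.
Proof. by move=> a x y; apply: scalerDr. Qed.
Fact descend_scaleDl x : {morph descend_scale^~ x : a b / a + b}.
Proof.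
move=> a b; rewrite -[a]quot_mapK -[b]quot_mapK -rmorphD !descend_scaleE.
exact: scalerDl.
Qed.

HB.instance Definition _ := GRing.Zmodule_isLmodule.Build (quot_ring X) descend
  descend_scaleA descend_scale1 descend_scaleDr descend_scaleDl.

End Descent.

(* B (x)_A N, as the quotient of the free B-module on the set N by the
   relations [x + y] = [x] + [y] and [a x] = phi(a) [x]; the class of b [x] is
   the tensor b (x) x. *)
Section BaseChange.
Variables (A B : comNzRingType) (phi : {rmorphism A -> B}) (N : lmodType A).

Definition tensor_relations : set {freeg N / B} :=
  [set r | (exists x y : N, r = << x + y >> - << x >> - << y >>) \/
           (exists (a : A) (x : N), r = << a *: x >> - phi a *: << x >>)].

Definition base_change : Type := quot_mod tensor_relations.

HB.instance Definition _ := GRing.Lmodule.on base_change.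

Definition tensor (x : N) : base_change := quot_proj tensor_relations << x >>.

Lemma tensorZ (a : A) x : tensor (a *: x) = phi a *: tensor x.
Proof.
rewrite /tensor -linearZ; apply/quot_proj_eq.
by apply: mem_span; right; exists a, x.
Qed.

Lemma tensorD : {morph tensor : x y / x + y}.
Proof.
move=> x y; rewrite /tensor -raddfD; apply/quot_proj_eq.
by apply: mem_span; left; exists x, y; rewrite opprD addrA.
Qed.

Lemma tensor0 : tensor 0 = 0.
Proof. by apply: (@addrI _ (tensor 0)); rewrite -tensorD !addr0. Qed.

Lemma base_change_gen (v : base_change) :
  exists s : seq (B * N), v = \sum_(z <- s) z.1 *: tensor z.2.
Proof.
exists [seq (coeff x (repr v), x) | x <- dom (repr v)].
rewrite big_map -[LHS]quot_projK -{1}[repr v]freeg_sumE raddf_sum.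
apply: eq_bigr => x _ /=; rewrite /tensor -linearZ; congr quot_proj.
by apply/eqP/freeg_eqP => y; rewrite coeffZ !coeffU mul1r.
Qed.

End BaseChange.

Section Bases.
Variables (S : pzRingType) (F : lmodType S).

Definition is_basis (J : Type) (b : J -> F) : Prop :=
  (forall x, x \in span (range b)) /\
  (forall p (u : 'I_p -> J) (a : 'I_p -> S), injective u ->
     \sum_i a i *: b (u i) = 0 -> forall i, a i = 0).

Definition free_module : Prop := exists (J : Type) (b : J -> F), is_basis b.

Definition free_of_rank (m : nat) : Prop := exists b : 'I_m -> F, is_basis b.

End Bases.

(* Matrices act on columns: the j-th column of D holds the coordinates of the
   image of the j-th basis vector. *)
Definition represents (S : pzRingType) (F F' : lmodType S)
    (delta : {linear F -> F'}) p q (e : 'I_q -> F) (e' : 'I_p -> F')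
    (D : 'M[S]_(p, q)) : Prop :=
  forall j, delta (e j) = \sum_i D i j *: e' i.

Definition minors (S : comPzRingType) (r p q : nat) (D : 'M[S]_(p, q)) : set S :=
  [set x | exists (u : 'I_r -> 'I_p) (v : 'I_r -> 'I_q),
             injective u /\ injective v /\ x = \det (mxsub u v D)].

(* I_r(delta), computed from any bases of the source and of the target. *)
Definition det_ideal (S : comPzRingType) (F F' : lmodType S) (r : nat)
    (delta : {linear F -> F'}) : set S :=
  [set x | exists p q (e : 'I_q -> F) (e' : 'I_p -> F') (D : 'M[S]_(p, q)),
     [/\ is_basis e, is_basis e', represents delta e e' D
       & ideal_gen (minors r D) x]].

Section Resolutions.
Variable S : pzRingType.

Definition exact_at (U V W : lmodType S) (g : {linear U -> V})
    (h : {linear V -> W}) : Prop :=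
  range g = [set v | h v = 0].

Definition resolution (N : lmodType S) (F : nat -> lmodType S)
    (del : forall i, {linear F i.+1 -> F i}) (eps : {linear F 0%N -> N}) : Prop :=
  [/\ range eps = setT, exact_at (del 0%N) eps
    & forall i, exact_at (del i.+1) (del i)].

Definition projective (F : lmodType S) : Prop :=
  forall (U V : lmodType S) (g : {linear U -> V}) (h : {linear F -> V}),
    range g = setT -> exists h' : {linear F -> U}, forall x, g (h' x) = h x.

Definition proj_dim_le (N : lmodType S) (m : nat) : Prop :=
  exists (F : nat -> lmodType S) (del : forall i, {linear F i.+1 -> F i})
         (eps : {linear F 0%N -> N}),
    [/\ resolution del eps, forall i, projective (F i)
      & forall i, (m < i)%N -> forall x : F i, x = 0].

Definition proj_dim_infinite (N : lmodType S) : Prop :=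
  forall m, ~ proj_dim_le N m.

End Resolutions.

Section CommutativeAlgebra.
Variable P : comNzRingType.
Implicit Types (J p n : set P).

Definition is_ideal J : Prop :=
  [/\ J 0, forall x y, J x -> J y -> J (x + y) & forall a x, J x -> J (a * x)].

Definition noetherian : Prop :=
  forall J, is_ideal J -> exists m (g : 'I_m -> P), J = ideal_gen (range g).

Definition prime_ideal p : Prop :=
  [/\ is_ideal p, ~ p 1 & forall x y, p (x * y) -> p x \/ p y].

Definition maximal_ideal n : Prop :=
  [/\ is_ideal n, ~ n 1
    & forall J, is_ideal J -> ~ J 1 -> n `<=` J -> J = n].

Definition local_ring n : Prop :=
  maximal_ideal n /\ forall n', maximal_ideal n' -> n' = n.

Definition prime_chain (m : nat) : Prop :=
  exists p : 'I_m.+1 -> set P,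
    (forall i, prime_ideal (p i)) /\
    (forall i j : 'I_m.+1, (i < j)%N -> p i `<` p j).

Definition krull_dim (d : nat) : Prop :=
  prime_chain d /\ forall m, prime_chain m -> (m <= d)%N.

Definition generated_by n (m : nat) : Prop :=
  exists g : 'I_m -> P, n = ideal_gen (range g).

(* Regularity: the minimal number of generators of n is the Krull dimension. *)
Definition regular_local_ring n (d : nat) : Prop :=
  [/\ noetherian, local_ring n, krull_dim d
    & generated_by n d /\ forall m, generated_by n m -> (d <= m)%N].

(* k is a subring of P, through iota, mapped isomorphically onto P/n. *)
Definition contains_residue_field (k : fieldType) n
    (iota : {rmorphism k -> P}) : Prop :=
  bijective (fun x : k => quot_map n (iota x)).

Definition ideal_square n : set P :=
  ideal_gen [set z | exists x y, [/\ n x, n y & z = x * y]].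

Definition regular_sequence c (f : 'I_c -> P) : Prop :=
  (forall (i : 'I_c) x,
     ideal_gen (f @` [set j : 'I_c | (j < i)%N]) (x * f i) ->
     ideal_gen (f @` [set j : 'I_c | (j < i)%N]) x) /\
  ~ ideal_gen (range f) 1.

Definition non_zero_divisor (x : P) : Prop := forall y, x * y = 0 -> y = 0.

End CommutativeAlgebra.

Section Main.
Variables (P : comNzRingType) (c : nat) (f : 'I_c -> P).

(* R = P/I *)
Definition ci_ring : comPzRingType := quot_ring (range f).

Variable M : lmodType ci_ring.

Definition as_P_module : lmodType P := restrict (quot_map (range f)) M.

Lemma scale_f0 i (x : as_P_module) : f i *: x = 0.
Proof.
rewrite -[LHS]/(quot_map (range f) (f i) *: (x : M)) quot_map_eq0 ?scale0r //.
by apply: mem_span; exists i.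
Qed.

Lemma combination_kills (a : 'I_c -> P) :
  killed_by [set \sum_i a i * f i] as_P_module.
Proof.
move=> _ -> x; rewrite scaler_suml big1 // => i _.
by rewrite -scalerA scale_f0 scaler0.
Qed.

(* M as a module over P/(sum_i a_i f_i). *)
Definition hypersurface_module (a : 'I_c -> P) :
    lmodType (quot_ring [set \sum_i a i * f i]) :=
  descend (@combination_kills a).

(* k^c is represented by the functions 'I_c -> k. *)
Definition lifting (k : fieldType) (n : set P) (iota : {rmorphism k -> P})
    (a : 'I_c -> k) (a' : 'I_c -> P) : Prop :=
  (forall i, n (a' i - iota (a i))) /\ non_zero_divisor (\sum_i a' i * f i).

Definition support_set (k : fieldType) (n : set P) (iota : {rmorphism k -> P}) :
    set ('I_c -> k) :=
  [set a | exists a', lifting n iota a a' /\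
                      proj_dim_infinite (hypersurface_module a')].

Definition generic_f : {mpoly P[c]} := \sum_i 'X_i * (f i)%:MP.

(* Q~ = P[s]/(f~) *)
Definition generic_hypersurface : comPzRingType := quot_ring [set generic_f].

Local Notation Qt := generic_hypersurface.

Definition poly_module_P : lmodType {mpoly P[c]} :=
  base_change (@mpolyC c P) as_P_module.

Lemma generic_f_kills : killed_by [set generic_f] poly_module_P.
Proof.
move=> _ -> v; have [s ->] := base_change_gen v.
rewrite scaler_sumr big1 // => z _.
rewrite scalerA mulrC -scalerA scaler_suml big1 ?scaler0 // => i _.
by rewrite -scalerA -tensorZ scale_f0 tensor0 scaler0.
Qed.

(* M[s] = P[s] (x)_P M as a Q~-module. *)
Definition poly_module : lmodType Qt := descend generic_f_kills.

End Main.

Section MatrixAction.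
Variables (S : comPzRingType) (N : lmodType S) (p q : nat) (D : 'M[S]_(p, q)).

Definition matrix_action (x : {ffun 'I_q -> N}) : {ffun 'I_p -> N} :=
  [ffun i => \sum_j D i j *: x j].

Fact matrix_action_zmod_morphism : zmod_morphism matrix_action.
Proof.
move=> x y; apply/ffunP => i; rewrite !ffunE -sumrB.
by apply: eq_bigr => j _; rewrite !ffunE scalerBr.
Qed.

Fact matrix_action_scalable : scalable matrix_action.
Proof.
move=> a x; apply/ffunP => i; rewrite !ffunE scaler_sumr.
by apply: eq_bigr => j _; rewrite !ffunE !scalerA mulrC.
Qed.

HB.instance Definition _ := GRing.isZmodMorphism.Build
  {ffun 'I_q -> N} {ffun 'I_p -> N} matrix_action matrix_action_zmod_morphism.
HB.instance Definition _ := GRing.isScalable.Build S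
  {ffun 'I_q -> N} {ffun 'I_p -> N} *:%R matrix_action matrix_action_scalable.

End MatrixAction.

Section PeriodicResolution.
Variables (P : comNzRingType) (c : nat) (f : 'I_c -> P).
Local Notation Qt := (generic_hypersurface f).

Definition poly_to_Qt : {mpoly P[c]} -> Qt := quot_map [set generic_f f].
HB.instance Definition _ := GRing.RMorphism.on poly_to_Qt.

(* Q~ / n Q~ *)
Definition residue_module (n : set P) : lmodType Qt :=
  @quot_mod Qt Qt^o [set q | exists2 x, n x & q = poly_to_Qt x%:MP].

(* G is a free resolution of Q~/nQ~ and, under isomorphisms
   theta_j : G_(d+j) -> Q~^N, the differential G_(d+j+1) -> G_(d+j) is
   multiplication by A for j even and by B for j odd.  The index is written
   j + d so that (j.+1 + d) is convertible to (j + d).+1. *)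
Definition periodic_free_resolution (n : set P) (d N : nat)
    (A B : 'M[Qt]_N) (G : nat -> lmodType Qt)
    (del : forall i, {linear G i.+1 -> G i})
    (eps : {linear G 0%N -> residue_module n}) : Prop :=
  [/\ resolution del eps,
      forall i, free_module (G i)
    & exists theta : forall j, {linear G (j + d)%N -> 'cV[Qt]_N},
        (forall j, bijective (theta j)) /\
        (forall j (x : G (j.+1 + d)%N),
           theta j (del (j + d)%N x) =
           (if odd j then B else A) *m theta j.+1 x)].

Variables (k : fieldType) (iota : {rmorphism k -> P}).

Definition coef_to_Qt : {mpoly k[c]} -> Qt := poly_to_Qt \o map_mpoly iota.
HB.instance Definition _ := GRing.RMorphism.on coef_to_Qt.

(* With N = 2^(d-1) and d > 0 this is the endomorphism of M[s]^(2^d), seen over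
   k[s].  The case d = 0 is vacuous for c > 0: a P-regular sequence cannot
   consist of zeros. *)
Definition C_endo (N : nat) (A B : 'M[Qt]_N) (M : lmodType (ci_ring f)) :
    {linear restrict coef_to_Qt {ffun 'I_(N + N) -> poly_module M} ->
            restrict coef_to_Qt {ffun 'I_(N + N) -> poly_module M}} :=
  @restrict_map _ _ coef_to_Qt _ _ (matrix_action (block_mx 0 A B 0)).

Definition k_to_ci_ring : k -> ci_ring f := quot_map (range f) \o iota.
HB.instance Definition _ := GRing.RMorphism.on k_to_ci_ring.

End PeriodicResolution.

(* Main.v *)
(** Write [Q] for [P[s] / (f~)].  For a lifting [a'] of [a] with [f' = sum_i a'_i f_i] not a
    zero divisor, the elements [s_i - a'_i] form a regular sequence on [Q], on the free
    modules [G_i] and on [Q / nQ], so the reduction of [G] resolves the residue field over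
    [S = P / (f')], and its tail is given by the specialized matrices [A], [B].

    If [A] and [B] are exact on [M], then comparing [G] with a minimal resolution of [M]
    over [S] shows that the latter stops after degree [d].  Conversely finite projective
    dimension of [M] over [S] makes the periodic tail exact on [M], by dimension shifting.

    If a minor of [C(M)] of size [r] does not vanish at [a], then over the fraction field
    the square-zero matrix [C(M)] has maximal rank, so the homology of [C(M)] on [M[s]] is
    killed by that minor; reducing by the regular sequence [s_i - a'_i] on [M[s]], where the
    minor becomes a unit, makes [A] and [B] exact on [M] for every lifting [a'].  For
    [a <> 0] the sequence can be permuted, [sum_i a_i f_i] is a nonzerodivisor, and finite
    projective dimension gives exactness on [M], hence a nonvanishing minor at [a].  For
    [a = 0] use the lifting [(f_0, 0, ..., 0)]: over [P / (f_0 ^ 2)] the complex with both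
    maps [f_0] is exact, but [f_0] kills [M]. *)

Require Import Defs.
From HB Require Import structures.
From mathcomp Require Import all_boot all_algebra.
From mathcomp Require Import boolp classical_sets.
From mathcomp Require Import freeg mpoly.

Set Implicit Arguments.
Unset Strict Implicit.
Unset Printing Implicit Defensive.

Import GRing.Theory.

Local Open Scope ring_scope.
Local Open Scope classical_set_scope.

(** * Regular sequences on modules *)

(** The number [r] is half the rank of [M[s]^(2^d)] over [k[s]]. A square-zero matrix of size [2r]
    over a field has rank at most [r], with equality exactly when its kernel is its image; this is
    how a condition on minors becomes exactness of the tail.

    The two inclusions treat liftings differently. A minor has coefficients in [k], so its value at
    any lifting [a'] agrees modulo [n] with its value at [a], and a nonzero value becomes a unit at
    every lifting. Conversely one lifting of infinite projective dimension suffices, and the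
    constant one [iota (a_i)] is taken because there the specialized [C(M)] has a matrix over [k],
    the value of a polynomial matrix at [a]. At the origin the constant lifting gives the element
    [0], a zero divisor, whence the separate argument.

    Neither Tor groups nor quotients of the [G_i] by the elements [x_i = s_i - a'_i] are formed: the
    predicate [inJ] expresses everything over [Q]. Matrices over [S] are lifted to [Q], where their
    relations hold only modulo [(x)]. *)

Section SequenceSubmodule.
Variable T : comPzRingType.
Implicit Types (x : nat -> T) (E : lmodType T).

(* Membership of [e] in the submodule [(x 0, ..., x (j - 1)) E]. *)
Fixpoint inJ x E (j : nat) (e : E) : Prop :=
  if j is j'.+1 then exists u, inJ x j' (e - x j' *: u) else e = 0.

Lemma inJ0 x E j : inJ x j (0 : E).
Proof. by elim: j => //= j IH; exists 0; rewrite scaler0 subr0. Qed.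

Lemma inJD x E j (e e' : E) : inJ x j e -> inJ x j e' -> inJ x j (e + e').
Proof.
elim: j e e' => [|j IH] e e' /=; first by move=> -> ->; rewrite addr0.
move=> [u Hu] [v Hv]; exists (u + v).
by rewrite scalerDr opprD addrACA; apply: IH.
Qed.

Lemma inJZ x E j a (e : E) : inJ x j e -> inJ x j (a *: e).
Proof.
elim: j e => [|j IH] e /=; first by move=> ->; rewrite scaler0.
move=> [u Hu]; exists (a *: u).
by rewrite scalerA [x j * a]mulrC -scalerA -scalerBr; apply: IH.
Qed.

Lemma inJN x E j (e : E) : inJ x j e -> inJ x j (- e).
Proof. by rewrite -scaleN1r; apply: inJZ. Qed.

Lemma inJB x E j (e e' : E) : inJ x j e -> inJ x j e' -> inJ x j (e - e').
Proof. by move=> He /inJN; apply: inJD. Qed.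

Lemma inJ_sum x E j (I : Type) (s : seq I) (Pr : pred I) (F : I -> E) :
  (forall i, Pr i -> inJ x j (F i)) -> inJ x j (\sum_(i <- s | Pr i) F i).
Proof.
move=> H; apply: (big_ind (inJ x j)) => //; first exact: inJ0.
exact: inJD.
Qed.

Lemma inJ_leq x E i j (e : E) : (i <= j)%N -> inJ x i e -> inJ x j e.
Proof.
move=> /subnK <-; elim: (j - i)%N => [|l IH] // He.
by rewrite addSn /=; exists 0; rewrite scaler0 subr0; apply: IH.
Qed.

Lemma inJ_gen x E i j (e : E) : (i < j)%N -> inJ x j (x i *: e).
Proof.
by move=> lij; apply: (inJ_leq lij) => /=; exists e; rewrite subrr; apply: inJ0.
Qed.

Lemma inJ_sigma x E j (e : E) : inJ x j e ->
  exists u : nat -> E, e = \sum_(l < j) x l *: u l.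
Proof.
elim: j e => [|j IH] e /=; first by move=> ->; exists (fun=> 0); rewrite big_ord0.
case=> v /IH[u Hu]; exists (fun l => if l == j then v else u l).
rewrite big_ord_recr /= eqxx -[LHS](subrK (x j *: v)) Hu; congr (_ + _).
by apply: eq_bigr => i _; rewrite ltn_eqF.
Qed.

Lemma inJ_ffun x E (I : finType) j (e : {ffun I -> E}) :
  inJ x j e <-> forall i, inJ x j (e i).
Proof.
elim: j e => [|j IH] e /=.
  by split=> [-> i|H]; [rewrite ffunE | apply/ffunP => i; rewrite H ffunE].
split=> [[u /IH Hu] i|H].
  by exists (u i); have := Hu i; rewrite !ffunE.
have [u Hu] := choice H.
by exists [ffun i => u i]; apply/IH => i; rewrite !ffunE.
Qed.

End SequenceSubmodule.

Section Semilinear.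
Variables (T T' : comPzRingType) (psi : T -> T').
Variables (E : lmodType T) (E' : lmodType T') (g : {additive E -> E'}).
Hypothesis gZ : forall t e, g (t *: e) = psi t *: g e.
Variables (x : nat -> T) (x' : nat -> T').

Lemma inJ_semilinear j (e : E) : (forall i, (i < j)%N -> x' i = psi (x i)) ->
  inJ x j e -> inJ x' j (g e).
Proof.
elim: j e => [|j IH] e Hx /=; first by move=> ->; rewrite raddf0.
move=> [u Hu]; exists (g u); rewrite Hx // -gZ -raddfB; apply: IH => // i ij.
by apply: Hx; apply: ltnW.
Qed.

(** Lifting the witnesses along the surjection moves the whole discrepancy into one element [r] of
    the kernel; this transfers regularity questions from [P[s]] to its quotients. *)
Lemma inJ_semilinear_lift j (e : E) : (forall i, (i < j)%N -> x' i = psi (x i)) ->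
  (forall y, exists e, g e = y) ->
  inJ x' j (g e) -> exists2 r, g r = 0 & inJ x j (e - r).
Proof.
move=> Hx gsurj; elim: j e Hx => [|j IH] e Hx /=.
  by move=> ge; exists e; rewrite ?subrr.
case=> y; have [u <-] := gsurj y; rewrite Hx // -gZ -raddfB => /IH[].
  by move=> i ij; apply: Hx; apply: ltnW.
by move=> r Hr Hu; exists r => //; exists u; rewrite addrAC.
Qed.

End Semilinear.

Lemma inJ_linear (T : comPzRingType) (x : nat -> T) (E E' : lmodType T)
  (g : {linear E -> E'}) j (e : E) : inJ x j e -> inJ x j (g e).
Proof. by apply: (@inJ_semilinear _ _ id) => // t u; apply: (linearZZ g). Qed.

(* The powers of [h] stand in for localization at [h]. *)
Section KoszulStep.
Variables (T : comPzRingType) (x : nat -> T) (h : T) (j : nat).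
Variables E3 E2 E1 E0 : lmodType T.
Variables (d3 : {linear E3 -> E2}) (d2 : {linear E2 -> E1}) (d1 : {linear E1 -> E0}).
Hypothesis d12 : forall z, d1 (d2 z) = 0.
Hypothesis reg : forall e : E0, inJ x j (x j *: e) -> inJ x j e.

Definition exact_mod (D3 D2 D1 : lmodType T) (g' : {linear D3 -> D2})
    (g : {linear D2 -> D1}) l :=
  forall z : D2, inJ x l (g z) -> exists K v, inJ x l (h ^+ K *: z - g' v).

(** If [d2 z = x_j u] modulo the first [j] elements, regularity on [E0] makes [u] a cycle, so
    [h^K u = d2 v] for some [K] and [v], and then [h^K z - x_j v] is a cycle modulo the first [j]
    elements. Exactness is used at [E1] and [E2], regularity on [E0]. *)
Lemma koszul_step :
  exact_mod d2 d1 j -> exact_mod d3 d2 j -> exact_mod d3 d2 j.+1.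
Proof.
move=> ex1 ex2 z [u Hu].
have: inJ x j (d1 u).
  apply: reg; rewrite -linearZ.
  have: inJ x j (d1 (d2 z - x j *: u)) by exact: inJ_linear.
  by rewrite linearB d12 sub0r => /inJN; rewrite opprK.
case/ex1 => K [v Hv].
have: inJ x j (d2 (h ^+ K *: z - x j *: v)).
  rewrite linearB !linearZ_LR /= scalerN.
  rewrite (_ : _ - _ = h ^+ K *: (d2 z - x j *: u) + x j *: (h ^+ K *: u - d2 v)).
    by apply: inJD; apply: inJZ.
  by rewrite !scalerBr !scalerA [h ^+ K * _]mulrC addrA subrK.
case/ex2 => K' [w Hw]; exists (K + K')%N, w => /=; exists (h ^+ K' *: v).
move: Hw; rewrite scalerBr !scalerA -exprD addnC [_ * x j]mulrC addrAC.
by rewrite -!scalerA.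
Qed.

End KoszulStep.

(* Membership in [(x 0, ..., x (j - 1)) E] is read off from coefficients with
   respect to the monomials in the [x i]. *)
Section Coefficients.
Variables (T : comPzRingType) (E : lmodType T) (c : nat) (x : nat -> T).
Variables (Z : zmodType) (C : 'X_{1..c} -> E -> Z).
Hypothesis CB : forall m u v, C m (u - v) = C m u - C m v.
Hypothesis CX : forall (i : 'I_c) m e, C (m + U_(i))%MM (x i *: e) = C m e.
Hypothesis CX0 : forall (i : 'I_c) (m : 'X_{1..c}) e,
  m i = 0%N -> C m (x i *: e) = 0.
Hypothesis Crec : forall e, exists (s : seq 'X_{1..c}) (g : 'X_{1..c} -> E),
  e = \sum_(m <- s) (\prod_(i < c) x i ^+ m i) *: g m /\
  forall m, C m e = 0 -> forall m', C m' (g m) = 0.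

Let C0 m : C m 0 = 0.
Proof. by rewrite -[X in C m X](subrr 0) CB subrr. Qed.

Let CD m u v : C m (u + v) = C m u + C m v.
Proof. by rewrite -[v in LHS]opprK CB -[- v]sub0r CB C0 sub0r opprK. Qed.

Definition coef_null (e : E) := forall m, C m e = 0.

Definition low_free j (m : 'X_{1..c}) := [forall i : 'I_c, (i < j)%N ==> (m i == 0%N)].

Let coef_null_mono m e : coef_null e ->
  coef_null ((\prod_(i < c) x i ^+ m i) *: e).
Proof.
move: e; apply: (big_ind (fun t => forall e, coef_null e -> coef_null (t *: e))).
- by move=> e; rewrite scale1r.
- by move=> t t' Ht Ht' e He; rewrite -scalerA; apply/Ht/Ht'.
move=> i _; elim: (m i) => [|n IH] e He; first by rewrite expr0 scale1r.
rewrite exprS -scalerA => m'; case: (posnP (m' i)) => [/CX0-> //|mi].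
have le1 : (U_(i) <= m')%MM by rewrite lep1mP -lt0n.
by rewrite -(submK le1) CX; apply: IH.
Qed.

(** Monomials involving some [x i] with [i < j] already lie in the submodule; the others have
    coefficient zero, so [Crec] makes their sum coefficient-null. *)
Lemma coef_inJ j e : (forall m, low_free j m -> C m e = 0) ->
  exists2 r, coef_null r & inJ x j (e - r).
Proof.
move=> He; have [s [g [eE Hg]]] := Crec e.
exists (\sum_(m <- s | low_free j m) (\prod_(i < c) x i ^+ m i) *: g m).
  move=> m; elim: s {eE} => [|m' s IH]; first by rewrite big_nil C0.
  rewrite big_cons; case: ifP => // lm; rewrite CD IH addr0.
  by apply: coef_null_mono; apply: Hg; apply: He.
rewrite {1}eE (bigID (low_free j)) /= addrAC subrr add0r.
apply: inJ_sum => m /forallPn[i]; rewrite negb_imply => /andP[ij mi].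
rewrite (bigD1 i) //= -scalerA -(prednK (n := m i)) ?lt0n // exprS -scalerA.
exact: inJ_gen.
Qed.

Lemma inJ_coef j e : (j <= c)%N -> inJ x j e ->
  forall m, low_free j m -> C m e = 0.
Proof.
elim: j e => [|j IH] e jc /=; first by move=> -> m _; rewrite C0.
case=> u Hu m lm.
rewrite -[e](subrK (x j *: u)) CD (IH _ (ltnW jc) Hu) ?add0r.
  apply: (CX0 (i := Ordinal jc)).
  by apply/eqP; have /forallP/(_ (Ordinal jc)) := lm; rewrite /= leqnn.
apply/forallP => i; apply/implyP => ij.
by have /forallP/(_ i)/implyP := lm; apply; apply: ltnW.
Qed.

(** Multiplication by [x j] shifts exponents by [U_(j)], which leaves the exponents below [j] alone.
    A null [r] is carried along because coefficients need not determine an element: with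
    coefficients in [P/n] the null elements form a kernel. *)
Lemma coef_inJ_regular (j : 'I_c) e r : coef_null r ->
  inJ x j (x j *: e - r) -> exists2 r', coef_null r' & inJ x j (e - r').
Proof.
move=> Hr H; apply: coef_inJ => m lm.
have lm' : low_free j (m + U_(j))%MM.
  apply/forallP => i; apply/implyP => ij; have /forallP/(_ i)/implyP/(_ ij) := lm.
  rewrite mnmDE mnmE => /eqP->; rewrite add0n eqb0.
  by apply: contraTneq ij => ->; rewrite ltnn.
have := inJ_coef (ltnW (ltn_ord j)) H lm'.
by rewrite CB Hr subr0 CX.
Qed.

End Coefficients.

(** * Taylor coefficients at a point of affine space over [P] *)

Section Translation.
Variables (P : comNzRingType) (c : nat) (a : 'I_c -> P).
Local Notation T := {mpoly P[c]}.

(** Indexed by [nat] because [inJ] is; only indices below [c] enter [inJ x c], so the default [0] is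
    harmless. *)
Definition shifted (i : nat) : T :=
  if insub i is Some j then 'X_j - (a j)%:MP else 0.

Lemma shiftedE (i : 'I_c) : shifted i = 'X_i - (a i)%:MP.
Proof. by rewrite /shifted valK. Qed.

(** The automorphism [s -> s + b]; for [b = a] it turns the elements [s_i - a_i] into the
    variables. *)
Definition translate (b : 'I_c -> P) : T -> T :=
  comp_mpoly [tuple 'X_i + (b i)%:MP | i < c].

HB.instance Definition _ b := GRing.RMorphism.on (translate b).
Arguments translate : simpl never.

Lemma translateX b (i : 'I_c) : translate b 'X_i = 'X_i + (b i)%:MP.
Proof. by rewrite /translate comp_mpolyXU -tnth_nth tnth_mktuple. Qed.

Lemma translateC b y : translate b y%:MP = y%:MP.
Proof. exact: comp_mpolyC. Qed.

Lemma translate_shifted i : translate a (shifted i) = if insub i is Some j then 'X_j else 0.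
Proof.
rewrite /shifted; case: insubP => [j _ _|_]; last by rewrite rmorph0.
by rewrite rmorphB /= translateX translateC addrK.
Qed.

(** Taylor expansion at [a]: expand the translated polynomial in monomials, then apply the inverse
    translation by [-a]. *)
Lemma translate_expand p :
  p = \sum_(m <- msupp (translate a p))
        (\prod_(i < c) shifted i ^+ m i) * ((translate a p)@_m)%:MP.
Proof.
have tK : cancel (translate a) (translate (fun i => - a i)).
  move=> q; rewrite {1}[q]mpolyE [RHS]mpolyE (rmorph_sum (translate a)) /=.
  rewrite (rmorph_sum (translate _)) /=; apply: eq_bigr => m _.
  rewrite -mul_mpolyC (rmorphM (translate a)) /= (rmorphM (translate _)) /= !translateC
    mpolyXE_id.
  rewrite (rmorph_prod (translate a)) /= (rmorph_prod (translate _)) /=.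
  congr (_ * _); apply: eq_bigr => i _; rewrite (rmorphXn (translate a)) /= translateX.
  by rewrite (rmorphXn (translate _)) /= rmorphD /= translateX translateC mpolyCN subrK.
rewrite -[LHS]tK {1}[translate a p]mpolyE rmorph_sum /=; apply: eq_bigr => m _.
rewrite -mul_mpolyC mulrC rmorphM /= translateC mpolyXE_id rmorph_prod.
congr (_ * _); apply: eq_bigr => i _; rewrite rmorphXn /= translateX shiftedE.
by rewrite mpolyCN.
Qed.

Lemma translate_meval p : (translate a p)@_0%MM = p.@[a].
Proof.
rewrite [RHS](_ : _ = (translate a p).@[fun=> 0]).
  rewrite mevalE [translate a p in LHS]mpolyE raddf_sum; apply: eq_bigr => m _ /=.
  rewrite mcoeffZ mcoeffX; congr (_ * _).
  case: eqP => [->|]; first by rewrite big1 // => i _; rewrite mnmE expr0.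
  have [/forallP H mn0|/forallPn[i mi] _] := boolP [forall i, m i == 0%N].
    by case: mn0; apply/mnmP => i; rewrite mnmE; apply/eqP.
  by rewrite (bigD1 i) //= expr0n (negPf mi) mul0r.
rewrite /translate comp_mpoly_meval; apply: meval_eq => i.
by rewrite tnth_mktuple mevalD mevalXU mevalC add0r.
Qed.

Lemma mcoeff_mulX (p : T) (i : 'I_c) m : ('X_i * p)@_(m + U_(i)) = p@_m.
Proof. by rewrite mulrC addmC mcoeffMX. Qed.

Lemma mcoeff_mulX0 (p : T) (i : 'I_c) (m : 'X_{1..c}) :
  m i = 0%N -> ('X_i * p)@_m = 0.
Proof.
move=> mi; apply/eqP; rewrite mulrC mcoeff_eq0 (perm_mem (msuppMX _ _)).
apply/mapP => -[m' _ E]; move: mi.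
by rewrite E mnmDE mnmE eqxx.
Qed.

End Translation.

Lemma ideal_gen_set1 (S : comPzRingType) (y z : S) :
  ideal_gen [set y] z -> exists u, z = u * y.
Proof.
case/spanP => p [b [g [Hg ->]]]; exists (\sum_i b i).
by rewrite mulr_suml; apply: eq_bigr => i _; rewrite (Hg i).
Qed.

Lemma ideal_genI (S : comPzRingType) (J : set S) z : J 0 ->
  (forall u v, J u -> J v -> J (u + v)) -> (forall u v, J v -> J (u * v)) ->
  ideal_gen J z -> J z.
Proof.
move=> J0 JD JM /spanP[p [b [g [Hg ->]]]].
by apply: (big_ind J) => // i _; apply: JM.
Qed.

Lemma quot_map_eq0P (S : comPzRingType) (X : set S) z :
  quot_map X z = 0 <-> ideal_gen X z.
Proof.
split; last exact: quot_map_eq0.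
by rewrite -(rmorph0 (quot_map X)) => /quot_map_eq; rewrite subr0.
Qed.

Section PolynomialRegularity.
Variables (P : comNzRingType) (c : nat) (a : 'I_c -> P).
Local Notation T := {mpoly P[c]}.
Local Notation x := (shifted a).

Section Coefs.
Variables (Z : zmodType) (pi : {additive P -> Z}).
(** [pi] is the identity of [P] for regularity on [P[s]], and reduction modulo [n] for regularity on
    [Q / nQ]. *)
Definition shift_coef m (p : T^o) : Z := pi ((translate a p)@_m).

Lemma shift_coefB m (u v : T^o) :
  shift_coef m (u - v) = shift_coef m u - shift_coef m v.
Proof. by rewrite /shift_coef rmorphB mcoeffB raddfB. Qed.

Lemma shift_coefX (i : 'I_c) m (e : T^o) :
  shift_coef (m + U_(i))%MM (x i *: e) = shift_coef m e.
Proof.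
rewrite /shift_coef [x i *: e]/(x i * e) rmorphM /= translate_shifted valK.
by rewrite mcoeff_mulX.
Qed.

Lemma shift_coefX0 (i : 'I_c) (m : 'X_{1..c}) (e : T^o) :
  m i = 0%N -> shift_coef m (x i *: e) = 0.
Proof.
move=> mi; rewrite /shift_coef [x i *: e]/(x i * e) rmorphM /= translate_shifted.
by rewrite valK mcoeff_mulX0 ?raddf0.
Qed.

Lemma shift_coef_expand (e : T^o) : exists (s : seq 'X_{1..c}) (g : 'X_{1..c} -> T^o),
  e = \sum_(m <- s) (\prod_(i < c) x i ^+ m i) *: g m /\
  forall m, shift_coef m e = 0 -> forall m', shift_coef m' (g m) = 0.
Proof.
exists (msupp (translate a e)), (fun m => ((translate a e)@_m)%:MP).
split=> [|m em m']; first exact: translate_expand.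
rewrite /shift_coef translateC mcoeffC; case: (m' == 0%MM).
  by rewrite mulr1.
by rewrite mulr0 raddf0.
Qed.

Lemma shift_coef_regular (j : 'I_c) (p r : T^o) : coef_null shift_coef r ->
  inJ x j (x j *: p - r) ->
  exists2 r', coef_null shift_coef r' & inJ x j (p - r').
Proof.
exact: (coef_inJ_regular shift_coefB shift_coefX shift_coefX0 shift_coef_expand).
Qed.

End Coefs.

Lemma shift_coef_id0 (p : T^o) : coef_null (shift_coef (@idfun P)) p -> p = 0.
Proof.
move=> Hp; rewrite [LHS](translate_expand a); apply: big1 => m _.
by rewrite [_@__](Hp m) mpolyC0 mulr0.
Qed.

Lemma mpoly_regular (j : 'I_c) (p : T^o) : inJ x j (x j *: p) -> inJ x j p.
Proof.
rewrite -[x j *: p]subr0 => /(shift_coef_regular (pi := @idfun P))[|r'].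
  by move=> m; rewrite /shift_coef rmorph0 mcoeff0 raddf0.
by move=> /shift_coef_id0->; rewrite subr0.
Qed.

Lemma mpoly_inJ_meval (p : T^o) : inJ x c (p - (p.@[a])%:MP : T^o).
Proof.
case: (coef_inJ (shift_coefB _) (shift_coefX _) (shift_coefX0 _) (shift_coef_expand _)
   (C := shift_coef (@idfun P)) (j := c) (e := p - (p.@[a])%:MP : T^o)).
  move=> m /forallP lm.
  have ->: m = 0%MM.
    apply/mnmP => i; rewrite mnmE; apply/eqP; have := lm i.
    by rewrite ltn_ord.
  rewrite shift_coefB /shift_coef translateC mcoeffC eqxx mulr1.
  by rewrite translate_meval subrr.
by move=> r /shift_coef_id0->; rewrite subr0.
Qed.

(** After translation the constant coefficient of [g] is [g(a)]. In the coefficient of [g p] at [m],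
    every term other than [g(a) p_m] involves a coefficient of [p] of smaller degree, which vanishes
    by induction on [mdeg m]. *)
Lemma nzd_mod_shifted (g : T) j (p : T^o) : non_zero_divisor g.@[a] ->
  (j <= c)%N -> inJ x j (g *: p) -> inJ x j p.
Proof.
move=> nzd jc H.
have := inJ_coef (shift_coefB _) (shift_coefX0 (@idfun P)) jc H.
rewrite /shift_coef [g *: p]/(g * p) rmorphM => {}H.
have Hp : forall m, low_free j m -> (translate a p)@_m = 0.
  move=> m; have [e] := ubnP (mdeg m); elim: e m => // e IH m me lm.
  have := H m lm; rewrite /= mcoeffM.
  (* [mcoeffM] sums over pairs of monomials of bounded degree, so the pair [(0, m)] to be isolated
     must carry its bounds. *)
  have k0 : (mdeg (0%MM : 'X_{1..c}) < (mdeg m).+1)%N by rewrite mdeg0.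
  have km : (mdeg m < (mdeg m).+1)%N by [].
  rewrite (bigD1 (BMultinom k0, BMultinom km)) /=; last by rewrite add0m.
  rewrite big1 ?addr0.
    by rewrite translate_meval => /nzd.
  move=> -[k1 k2] /= /andP[/eqP Em Ek]; rewrite [X in _ * X]IH ?mulr0 //.
    rewrite ltnS in me; apply: leq_trans me.
    suff: (0 + mdeg k2 < mdeg k1 + mdeg k2)%N by rewrite -mdegD -Em.
    rewrite ltn_add2r lt0n mdeg_eq0; apply: contra Ek => /eqP k10.
    have k2m : k2 = m :> 'X_{1..c} by rewrite [RHS]Em k10 add0m.
    by rewrite xpair_eqE; apply/andP; split; apply/eqP/val_inj.
  apply/forallP => i; apply/implyP => ij; have /forallP/(_ i)/implyP/(_ ij) := lm.
  by move/eqP: (congr1 (fun m' : 'X_{1..c} => m' i) Em) => /= /eqP->;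
    rewrite mnmDE addn_eq0 => /andP[].
case: (coef_inJ (shift_coefB _) (shift_coefX _) (shift_coefX0 _) (shift_coef_expand _)
   (C := shift_coef (@idfun P)) (j := j) (e := p)) => [|r]; first exact: Hp.
by move=> /shift_coef_id0->; rewrite subr0.
Qed.

End PolynomialRegularity.

(** * The generic hypersurface and its specializations *)

Section Hypersurface.
Variables (P : comNzRingType) (c : nat) (f : 'I_c -> P) (a : 'I_c -> P).
Local Notation T := {mpoly P[c]}.
Local Notation Qt := (generic_hypersurface f).
Local Notation S := (quot_ring [set \sum_i a i * f i]).
Local Notation x := (shifted a).

Definition shiftedQ (i : nat) : Qt := poly_to_Qt f (shifted a i).

Lemma poly_to_Qt_surj (q : Qt) : exists p, poly_to_Qt f p = q.
Proof. by exists (repr q); apply: quot_mapK. Qed.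

Lemma poly_to_Qt_eq0 p : poly_to_Qt f p = 0 -> exists v, p = v * generic_f f.
Proof. by move/quot_map_eq0P/ideal_gen_set1. Qed.

Lemma generic_f_meval : (generic_f f).@[a] = \sum_i a i * f i.
Proof.
rewrite /generic_f raddf_sum; apply: eq_bigr => i _.
by rewrite /= mevalM mevalXU mevalC.
Qed.

Let toQ : {additive T^o -> Qt^o} := poly_to_Qt f.

Let toQZ (t : T) (e : T^o) : toQ (t *: e) = poly_to_Qt f t *: toQ e.
Proof. exact: rmorphM. Qed.

Lemma inJ_toQ j (p : T^o) : inJ x j p -> inJ shiftedQ j (poly_to_Qt f p : Qt^o).
Proof. exact: (inJ_semilinear toQZ). Qed.

(** An exchange argument. A relation [x_j p = v f~] modulo the earlier elements puts [f~ v] into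
    [(x_0, ..., x_j)], hence also [v], because [f~] has a nonzerodivisor as value at [a]. With
    [v = x_j v'] modulo the earlier elements, [x_j (p - f~ v')] lies in their ideal, and regularity
    on [P[s]] applies. *)
Lemma Qt_regular (j : 'I_c) (q : Qt^o) : non_zero_divisor (\sum_i a i * f i) ->
  inJ shiftedQ j (shiftedQ j *: q) -> inJ shiftedQ j q.
Proof.
move=> nzd; have [p <-] := poly_to_Qt_surj q.
have -> : shiftedQ j *: (poly_to_Qt f p : Qt^o) = toQ (x j *: (p : T^o)).
  by rewrite toQZ.
case/(inJ_semilinear_lift toQZ (x := x)) => //.
  by move=> y; apply: poly_to_Qt_surj.
move=> r /poly_to_Qt_eq0[v ->] Hp.
have: inJ x j.+1 (v : T^o).
  apply: (@nzd_mod_shifted _ _ _ (generic_f f)) => //.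
    by rewrite generic_f_meval.
  rewrite -[_ *: _]/(generic_f f * v) mulrC -[_ * _](subKr (x j * p)).
  apply: inJB; first exact: (@inJ_gen _ _ T^o).
  exact: inJ_leq Hp.
case=> v' Hv.
have /mpoly_regular H : inJ x j (x j *: (p - generic_f f * v' : T^o)).
  rewrite (_ : _ *: _ = (x j *: (p : T^o) - v * generic_f f)
      + generic_f f *: (v - x j *: (v' : T^o) : T^o)).
    by apply: inJD => //; apply: inJZ.
  rewrite !scalerBr addrA [v * _]mulrC subrK; congr (_ - _).
  by rewrite !scalerA mulrC -scalerA.
have := inJ_toQ H; rewrite rmorphB rmorphM /= (_ : poly_to_Qt f (generic_f f) = 0).
  by rewrite mul0r subr0.
by apply: quot_map_eq0; apply: mem_span.
Qed.

Definition specialize (q : Qt) : S := quot_map _ (repr q).@[a].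

Lemma specializeE p : specialize (poly_to_Qt f p) = quot_map _ p.@[a].
Proof.
apply/eqP; rewrite -subr_eq0 -rmorphB; apply/eqP/quot_map_eq0.
have [v E] : exists v, repr (poly_to_Qt f p) - p = v * generic_f f.
  by apply: poly_to_Qt_eq0; rewrite rmorphB /= [X in X - _]quot_mapK subrr.
rewrite -raddfB /= E mevalM generic_f_meval; apply/spanP.
exists 1, (fun=> v.@[a]), (fun=> \sum_i a i * f i); split=> //.
by rewrite big_ord1.
Qed.

Fact specialize_zmod_morphism : zmod_morphism specialize.
Proof.
move=> p q; have [p' <-] := poly_to_Qt_surj p; have [q' <-] := poly_to_Qt_surj q.
by rewrite -rmorphB !specializeE mevalB rmorphB.
Qed.

HB.instance Definition _ :=
  GRing.isZmodMorphism.Build Qt S specialize specialize_zmod_morphism.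

Fact specialize_monoid_morphism : monoid_morphism specialize.
Proof.
split=> [|p q].
  by rewrite -(rmorph1 (poly_to_Qt f)) specializeE meval1 rmorph1.
have [p' <-] := poly_to_Qt_surj p; have [q' <-] := poly_to_Qt_surj q.
by rewrite -rmorphM !specializeE mevalM rmorphM.
Qed.

HB.instance Definition _ :=
  GRing.isMonoidMorphism.Build Qt S specialize specialize_monoid_morphism.

Definition unspecialize (s : S) : Qt := poly_to_Qt f (repr s)%:MP.

Lemma unspecializeK s : specialize (unspecialize s) = s.
Proof. by rewrite specializeE mevalC quot_mapK. Qed.

Lemma specialize_shiftedQ i : specialize (shiftedQ i) = 0.
Proof.
rewrite specializeE /shifted; case: insub => [j|]; last by rewrite meval0 rmorph0.
by rewrite mevalB mevalXU mevalC subrr rmorph0.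
Qed.

(** If [p(a) = u f'] then [p] equals [(p - p(a)) - u (f~ - f~(a))] modulo [f~], and both differences
    vanish at [a], hence lie in the ideal of the [x_i]. *)
Lemma specialize_eq0 (q : Qt) : specialize q = 0 <-> inJ shiftedQ c (q : Qt^o).
Proof.
split.
  have [p <-] := poly_to_Qt_surj q.
  rewrite specializeE => /quot_map_eq0P/ideal_gen_set1[u E].
  rewrite (_ : poly_to_Qt f p = poly_to_Qt f (p - (p.@[a])%:MP
      - u%:MP * (generic_f f - ((generic_f f).@[a])%:MP))).
    apply: inJ_toQ; apply: inJB; first exact: mpoly_inJ_meval.
    by apply: inJZ; apply: mpoly_inJ_meval.
  rewrite E generic_f_meval mpolyCM mulrBr opprB addrA subrK.
  rewrite rmorphB rmorphM /= (_ : poly_to_Qt f (generic_f f) = 0) ?mulr0 ?subr0 //.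
  by apply: quot_map_eq0; apply: mem_span.
move=> H; have {H} := @inJ_semilinear _ _ (specialize : Qt -> S) Qt^o S^o
  (specialize : {additive Qt^o -> S^o}) (fun t e => rmorphM _ t e)
  shiftedQ (fun=> 0) c q (fun i _ => esym (specialize_shiftedQ i)) H.
case/inJ_sigma => u ->; apply: big1 => i _; exact: (@scale0r _ S^o (u i)).
Qed.

Section Residue.
Variable n : set P.
Hypotheses (nI : is_ideal n) (fn : forall i, n (f i)).
Local Notation res := (residue_module f n).

Definition residue_class : Qt^o -> res := @quot_proj _ _ _.

HB.instance Definition _ := GRing.Linear.on residue_class.

Let toR (p : T^o) : res := residue_class (poly_to_Qt f p).
Fact toR_zmod_morphism : zmod_morphism toR.
Proof. by move=> p q; rewrite /toR rmorphB raddfB. Qed.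
HB.instance Definition _ := GRing.isZmodMorphism.Build T^o res toR toR_zmod_morphism.

Let toRZ (t : T) (e : T^o) : toR (t *: e) = poly_to_Qt f t *: toR e.
Proof.
by rewrite /toR [poly_to_Qt _ _](_ : _ = poly_to_Qt f t *: (poly_to_Qt f e : Qt^o))
  ?linearZ //; apply: rmorphM.
Qed.

Lemma residue_surj (y : res) : exists q : Qt^o, residue_class q = y.
Proof. by exists (repr y); apply: quot_projK. Qed.

Lemma residue_scale_n (v : P) (y : res) : n v -> poly_to_Qt f v%:MP *: y = 0.
Proof.
move=> nv; have [q <-] := residue_surj y.
rewrite -linearZ -(raddf0 residue_class); apply/quot_proj_eq; rewrite subr0.
rewrite [_ *: _](_ : _ = q *: (poly_to_Qt f v%:MP : Qt^o)); last exact: mulrC.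
by rewrite rpredZ //; apply: mem_span; exists v.
Qed.

Let pi_n0 y : quot_map n y = 0 <-> n y.
Proof.
rewrite quot_map_eq0P; split; last exact: mem_span.
by case: nI => n0 nD nM; apply: ideal_genI.
Qed.

(** Every [f_i] lies in [n], so the translated coefficients of any multiple of [f~] do too; dividing
    by [f~] therefore adds nothing to the kernel. *)
Let toR_ker (p : T^o) : toR p = 0 <-> coef_null (shift_coef a (quot_map n)) p.
Proof.
have [n0 nD nM] := nI.
split=> [|Hp].
  rewrite -(raddf0 toR) => /quot_proj_eq; rewrite !rmorph0 subr0.
  case/spanP => l [b [g [Hg E]]].
  have [b' Hb] := choice (fun i => poly_to_Qt_surj (b i)).
  have /choice[y Hy] : forall i, exists y, n y /\ g i = poly_to_Qt f y%:MP.
    by move=> i; have [y] := Hg i; exists y.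
  have [v Ev] : exists v, p - \sum_i b' i * (y i)%:MP = v * generic_f f.
    apply: poly_to_Qt_eq0; rewrite rmorphB /= E rmorph_sum /= -sumrB big1 // => i _.
    by rewrite rmorphM /= Hb; case: (Hy i) => _ ->; apply: subrr.
  move=> m; apply/pi_n0; rewrite -[p](subrK (\sum_i b' i * (y i)%:MP)) Ev /generic_f.
  rewrite mulr_sumr rmorphD mcoeffD; apply/nD.
    rewrite rmorph_sum raddf_sum /=; apply: (big_ind n); [exact: n0|exact: nD|move=> i _].
    rewrite mulrA rmorphM /= translateC mulrC mcoeffCM mulrC; apply/nM.
    exact: fn.
  rewrite rmorph_sum raddf_sum /=; apply: (big_ind n); [exact: n0|exact: nD|move=> i _].
  rewrite rmorphM /= translateC mulrC mcoeffCM mulrC; apply/nM.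
  by case: (Hy i).
rewrite /toR [p](translate_expand a) rmorph_sum raddf_sum big1 // => m _.
rewrite mulrC rmorphM /= -[_ * _]/(poly_to_Qt f _ *: (_ : Qt^o)) linearZ_LR.
rewrite residue_scale_n //.
by apply/pi_n0; apply: Hp.
Qed.

Lemma residue_regular (j : 'I_c) (y : res) :
  inJ shiftedQ j (shiftedQ j *: y) -> inJ shiftedQ j y.
Proof.
have toR_surj z : exists e, toR e = z.
  by have [q <-] := residue_surj z; have [p <-] := poly_to_Qt_surj q; exists p.
have [p <-] := toR_surj y; rewrite -toRZ.
case/(inJ_semilinear_lift toRZ (x := x)) => // r /toR_ker Hr.
case/(shift_coef_regular Hr) => r' /toR_ker Hr' H.
by rewrite -[toR p]subr0 -Hr' -raddfB; apply: (inJ_semilinear toRZ) H.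
Qed.

(** Modulo the [x_i], [Q / nQ] becomes the residue field: writing [1 = r] modulo the [x_i] with [r]
    in [nQ] and specializing would put [1] into [n], since [f'] is in [n]. *)
Lemma residue_one_notin : ~ n 1 -> ~ inJ shiftedQ c (residue_class 1).
Proof.
move=> n1 H; apply: n1; have [n0 nD nM] := nI.
have [||r Hr] := @inJ_semilinear_lift _ _ id Qt^o res residue_class
   (fun t e => linearZ_LR _ t e) shiftedQ shiftedQ c 1 _ _ H => //.
  exact: residue_surj.
move/specialize_eq0; rewrite rmorphB rmorph1 => /subr0_eq E.
move: Hr; rewrite -(raddf0 residue_class) => /quot_proj_eq; rewrite subr0.
case/spanP => l [b [g [Hg rE]]].
have /choice[y Hy] : forall i, exists y, n y /\ g i = poly_to_Qt f y%:MP.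
  by move=> i; have [y] := Hg i; exists y.
have [b' Hb] := choice (fun i => poly_to_Qt_surj (b i)).
have: quot_map [set \sum_i a i * f i] (1 - \sum_i (b' i).@[a] * y i) = 0.
  rewrite rmorphB rmorph1 [X in X - _]E rE !rmorph_sum /= -sumrB; apply: big1 => i _.
  rewrite (_ : specialize (b i *: g i) = specialize (b i) * specialize (g i)).
    by rewrite -Hb; case: (Hy i) => _ ->; rewrite !specializeE mevalC rmorphM subrr.
  exact: rmorphM.
case/quot_map_eq0P/ideal_gen_set1 => u /eqP; rewrite subr_eq => /eqP->.
apply/nD; first by apply/nM; apply: (big_ind n); [exact: n0|exact: nD|move=> i _]; apply/nM.
by apply: (big_ind n); [exact: n0|exact: nD|move=> i _]; apply/nM; case: (Hy i).
Qed.

End Residue.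
End Hypersurface.

(** * Polynomial modules *)

Lemma big_uniq_extend (V : nmodType) (I : eqType) (s s' : seq I) (F : I -> V) :
  uniq s -> uniq s' -> {subset s <= s'} -> (forall i, i \notin s -> F i = 0) ->
  \sum_(i <- s) F i = \sum_(i <- s') F i.
Proof.
move=> us us' ss' F0; rewrite [RHS](bigID (mem s)) /= [X in _ + X]big1 // addr0.
rewrite -[RHS]big_filter; apply: perm_big; apply: uniq_perm => //.
  exact: filter_uniq.
by move=> y; rewrite mem_filter /= andb_idr //; apply: ss'.
Qed.

Section BaseChangeLift.
Variables (A B : comNzRingType) (phi : {rmorphism A -> B}) (N : lmodType A).
Variables (Y : zmodType) (beta : B -> N -> Y).
Hypothesis betaBl : forall b b' y, beta (b - b') y = beta b y - beta b' y.
Hypothesis betaD : forall b y y', beta b (y + y') = beta b y + beta b y'.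
Hypothesis betaZ : forall b a y, beta b (a *: y) = beta (b * phi a) y.

Let beta0 y : beta 0 y = 0.
Proof. by rewrite -[X in beta X](subrr 0) betaBl subrr. Qed.

Let L (D : {freeg N / B}) : Y := \sum_(y <- dom D) beta (coeff y D) y.

Let LE D s : uniq s -> {subset dom D <= s} -> L D = \sum_(y <- s) beta (coeff y D) y.
Proof.
move=> us sD; apply: big_uniq_extend => //; first exact: uniq_dom.
by move=> y yD; rewrite coeff_outdom.
Qed.

Let LB D D' : L (D - D') = L D - L D'.
Proof.
pose s := undup (dom D ++ dom D').
rewrite !(@LE _ s) ?undup_uniq // -?sumrB.
- by apply: eq_bigr => y _; rewrite coeffB betaBl.
- by move=> y yD; rewrite mem_undup mem_cat yD orbT.
- by move=> y yD; rewrite mem_undup mem_cat yD.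
by move=> y /domB; rewrite mem_undup.
Qed.

Let L0 : L 0 = 0. Proof. by rewrite -[X in L X](subrr 0) LB subrr. Qed.

Let LD D D' : L (D + D') = L D + L D'.
Proof. by rewrite -[D' in LHS]opprK LB -[- D']sub0r LB L0 sub0r opprK. Qed.

Let LU b y : L (b *: << y >>) = beta b y.
Proof.
rewrite (@LE _ [:: y]) // ?big_seq1; first by rewrite coeffZ coeffU eqxx !mulr1.
move=> z; rewrite inE; apply: contraLR => zy.
by rewrite mem_dom negbK coeffZ coeffU (eq_sym y z) (negPf zy) !mulr0.
Qed.

Let L_span D : D \in Defs.span (tensor_relations phi (N := N)) -> L D = 0.
Proof.
case/spanP => p [b [g [Hg ->]]]; apply: (big_ind (fun D => L D = 0)) => //.
  by move=> u v Hu Hv; rewrite LD Hu Hv addr0.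
move=> i _; case: (Hg i) => [[y [z ->]]|[a [y ->]]].
  by rewrite !scalerBr !LB !LU betaD addrAC addrK subrr.
by rewrite scalerBr LB scalerA !LU betaZ subrr.
Qed.

(* Closed with [Qed] so that unification never unfolds the additive map. *)
Lemma bc_lift : {l : {additive base_change phi N -> Y} |
  forall b y, l (b *: tensor phi y) = beta b y}.
Proof.
pose l (v : base_change phi N) := L (repr v).
have lB : zmod_morphism l.
  move=> u v; rewrite /l -LB; apply/eqP; rewrite -subr_eq0 -LB; apply/eqP/L_span.
  by apply/quot_proj_eq; rewrite raddfB /= !quot_projK.
pose lA : {additive base_change phi N -> Y} :=
  HB.pack l (GRing.isZmodMorphism.Build _ _ l lB).
exists lA => b y; rewrite -[lA _]/(l _).
rewrite -LU /l; apply/eqP; rewrite -subr_eq0 -LB; apply/eqP/L_span.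
by apply/quot_proj_eq; rewrite quot_projK linearZ.
Qed.

End BaseChangeLift.

Section PolynomialModule.
Variables (P : comNzRingType) (c : nat) (a : 'I_c -> P) (N : lmodType P).
Local Notation T := {mpoly P[c]}.
Local Notation Ns := (base_change (@mpolyC c P) N).
Local Notation x := (shifted a).

(** The coefficient at the monomial [m] in the variables [s_i - a_i], as a balanced map to be
    extended to the tensor product. *)
Definition bcoef_fun m (b : T) (y : N) := (translate a b)@_m *: y.

Let bf1 m b b' y : bcoef_fun m (b - b') y = bcoef_fun m b y - bcoef_fun m b' y.
Proof. by rewrite /bcoef_fun rmorphB mcoeffB scalerBl. Qed.

Let bf2 m b y y' : bcoef_fun m b (y + y') = bcoef_fun m b y + bcoef_fun m b y'.
Proof. by rewrite /bcoef_fun scalerDr. Qed.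

Let bf3 m b a' y : bcoef_fun m b (a' *: y) = bcoef_fun m (b * a'%:MP) y.
Proof. by rewrite /bcoef_fun scalerA rmorphM /= translateC [in RHS]mulrC mcoeffCM mulrC. Qed.

Definition bcoef m : {additive Ns -> N} :=
  sval (bc_lift (bf1 m) (bf2 m) (bf3 m)).

Lemma bcoefE m b y : bcoef m (b *: tensor _ y) = (translate a b)@_m *: y.
Proof. exact: svalP (bc_lift (bf1 m) (bf2 m) (bf3 m)) b y. Qed.

Lemma bcoefB m u v : bcoef m (u - v) = bcoef m u - bcoef m v.
Proof. exact: raddfB. Qed.

Lemma bcoef_shifted (i : 'I_c) m (v : Ns) : bcoef (m + U_(i))%MM (x i *: v) = bcoef m v.
Proof.
have [s ->] := base_change_gen v; rewrite scaler_sumr !raddf_sum; apply: eq_bigr => z _.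
by rewrite /= scalerA !bcoefE rmorphM /= translate_shifted valK mcoeff_mulX.
Qed.

Lemma bcoef_shifted0 (i : 'I_c) (m : 'X_{1..c}) (v : Ns) :
  m i = 0%N -> bcoef m (x i *: v) = 0.
Proof.
move=> mi; have [s ->] := base_change_gen v; rewrite scaler_sumr raddf_sum big1 // => z _.
by rewrite /= scalerA bcoefE rmorphM /= translate_shifted valK mcoeff_mulX0 ?scale0r.
Qed.

Lemma bcoef0Z b (v : Ns) : bcoef 0%MM (b *: v) = b.@[a] *: bcoef 0%MM v.
Proof.
have [s ->] := base_change_gen v; rewrite [in RHS](raddf_sum (bcoef 0%MM)) scaler_sumr
  (raddf_sum (bcoef 0%MM)) scaler_sumr.
apply: eq_bigr => z _; rewrite scalerA.
rewrite [LHS]bcoefE [X in _ = _ *: X]bcoefE.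
rewrite !translate_meval.
rewrite mevalM.
by rewrite scalerA.
Qed.

Lemma bcoef0_tensor y : bcoef 0%MM (tensor _ y) = y.
Proof. by rewrite -[tensor _ y]scale1r bcoefE rmorph1 mcoeff1 eqxx scale1r. Qed.

(** On a pure tensor this is Taylor expansion of the polynomial factor; the union of the supports
    gives one list of exponents valid for all the summands. *)
Lemma bcoef_expand (v : Ns) : exists s : seq 'X_{1..c},
  v = \sum_(m <- s) (\prod_(i < c) x i ^+ m i) *: tensor _ (bcoef m v).
Proof.
have [r ->] := base_change_gen v.
exists (undup (flatten [seq msupp (translate a z.1) | z <- r])).
have E z s : uniq s -> {subset msupp (translate a z.1) <= s} -> z.1 *: tensor _ z.2 =
    \sum_(m <- s) (\prod_(i < c) x i ^+ m i) *: tensor _ (bcoef m (z.1 *: tensor _ z.2)) :>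
      Ns.
  move=> us Hs; transitivity
     ((\sum_(m <- s) (\prod_(i < c) x i ^+ m i) * ((translate a z.1)@_m)%:MP)
        *: tensor (@mpolyC c P) z.2).
    congr (_ *: _); rewrite {1}(translate_expand a z.1).
    apply: big_uniq_extend => //.
    by move=> m /memN_msupp_eq0->; rewrite mulr0.
  rewrite scaler_suml; apply: eq_bigr => m _.
  by rewrite bcoefE -scalerA -tensorZ.
transitivity (\sum_(z <- r) \sum_(m <- undup (flatten [seq msupp (translate a z.1) | z <- r]))
   (\prod_(i < c) x i ^+ m i) *: tensor _ (bcoef m (z.1 *: tensor _ z.2)) : Ns).
  rewrite big_seq [RHS]big_seq; apply: eq_bigr => z zr; apply: E; first exact: undup_uniq.
  move=> m mz; rewrite mem_undup; apply/flattenP.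
  by exists (msupp (translate a z.1)) => //; apply: map_f.
rewrite exchange_big /=; apply: eq_bigr => m _; rewrite -scaler_sumr; congr (_ *: _).
rewrite [bcoef m _]raddf_sum /=.
by elim/big_rec2: _ => [|z v1 v2 _ ->]; rewrite ?tensor0 ?tensorD.
Qed.

Lemma bcoef_eq0 (v : Ns) : coef_null bcoef v -> v = 0.
Proof.
move=> Hv; have [s ->] := bcoef_expand v; apply: big1 => m _.
by rewrite Hv tensor0 scaler0.
Qed.

Lemma bcoef_rec (v : Ns) : exists (s : seq 'X_{1..c}) (g : 'X_{1..c} -> Ns),
  v = \sum_(m <- s) (\prod_(i < c) x i ^+ m i) *: g m /\
  forall m, bcoef m v = 0 -> forall m', bcoef m' (g m) = 0.
Proof.
have [s E] := bcoef_expand v; exists s, (fun m => tensor _ (bcoef m v)).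
by split=> // m -> m'; rewrite tensor0 raddf0.
Qed.

Lemma base_change_regular (j : 'I_c) (v : Ns) : inJ x j (x j *: v) -> inJ x j v.
Proof.
rewrite -[x j *: v]subr0.
case/(coef_inJ_regular bcoefB bcoef_shifted bcoef_shifted0 bcoef_rec).
  by move=> m; rewrite raddf0.
by move=> r /bcoef_eq0->; rewrite subr0.
Qed.

Lemma bcoef0_eq0 (v : Ns) : bcoef 0%MM v = 0 -> inJ x c v.
Proof.
move=> v0; case: (coef_inJ bcoefB bcoef_shifted bcoef_shifted0 bcoef_rec (j := c) (e := v)).
  move=> m /forallP lm; rewrite (_ : m = 0%MM) //.
  by apply/mnmP => i; rewrite mnmE; apply/eqP; have := lm i; rewrite ltn_ord.
by move=> r /bcoef_eq0->; rewrite subr0.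
Qed.

End PolynomialModule.

Arguments bcoef {P c} a {N} m.

Section PolyModule.
Variables (P : comNzRingType) (c : nat) (f : 'I_c -> P) (a : 'I_c -> P).
Variable M : lmodType (ci_ring f).
Local Notation Ms := (poly_module M).
Local Notation xQ := (shiftedQ f a).

Lemma poly_moduleZ p (v : Ms) :
  (poly_to_Qt f p *: v : Ms) = (p *: (v : poly_module_P M) : poly_module_P M).
Proof. exact: (descend_scaleE (XN := generic_f_kills (M := M)) p v). Qed.

Let toMs : {additive poly_module_P M -> Ms} := (@idfun (poly_module_P M)).

Let toMsZ p (v : poly_module_P M) : toMs (p *: v) = poly_to_Qt f p *: toMs v.
Proof. by rewrite [RHS]poly_moduleZ. Qed.

Lemma poly_module_regular (j : 'I_c) (v : Ms) : inJ xQ j (xQ j *: v) -> inJ xQ j v.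
Proof.
rewrite -[_ *: v](toMsZ _ v) => /(inJ_semilinear_lift toMsZ (x := shifted a))[] //.
  by move=> y; exists y.
move=> r r0; rewrite (r0 : r = 0) subr0 => /base_change_regular.
exact: (inJ_semilinear toMsZ).
Qed.

(** Setting [s = a]: the constant coefficient in the variables [s_i - a_i]. *)
Definition eval_at (v : Ms) : hypersurface_module M a := bcoef a 0%MM v.

Fact eval_at_zmod_morphism : zmod_morphism eval_at.
Proof. exact: (raddfB (bcoef _ _)). Qed.

HB.instance Definition _ :=
  GRing.isZmodMorphism.Build Ms (hypersurface_module M a) eval_at eval_at_zmod_morphism.

Lemma eval_atZ q v : eval_at (q *: v) = specialize a q *: eval_at v.
Proof.
have [p <-] := poly_to_Qt_surj q; rewrite specializeE.
rewrite [RHS](descend_scaleE (XN := @combination_kills _ _ _ M a)).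
by rewrite /eval_at poly_moduleZ bcoef0Z.
Qed.

Definition const_poly (y : hypersurface_module M a) : Ms := tensor (@mpolyC c P) y.

Lemma eval_at_const y : eval_at (const_poly y) = y.
Proof. exact: bcoef0_tensor. Qed.

Lemma eval_at_eq0 v : eval_at v = 0 <-> inJ xQ c v.
Proof.
split; first by move/bcoef0_eq0/(inJ_semilinear toMsZ); apply.
move=> H; have {H} := @inJ_semilinear _ _ (specialize a) _ _ eval_at eval_atZ
  xQ (fun=> 0) c v (fun i _ => esym (specialize_shiftedQ f a i)) H.
by case/inJ_sigma => u ->; apply: big1 => i _; rewrite scale0r.
Qed.

End PolyModule.

(** * Free resolutions and regular sequences *)

Section FreeCoordinates.
Variables (S : comPzRingType) (F : lmodType S).

Let coords (J : eqType) (b : J -> F) e (y : J -> S) := exists s,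
  (forall l, l \notin s -> y l = 0) /\ e = \sum_(l <- undup s) y l *: b l.

(** Admitting every duplicate-free list that contains the support [s] lets several vectors be
    expanded over one common list. *)
Lemma free_coords_eq (J : eqType) (b : J -> F) : is_basis b ->
  exists kappa : J -> {linear F -> S^o},
    forall e, exists s : seq J, forall s', uniq s' -> {subset s <= s'} ->
      e = \sum_(l <- s') kappa l e *: b l.
Proof.
case=> bspan bfree.
have cext e y s s' : (forall l, l \notin s -> y l = 0) ->
    e = \sum_(l <- undup s) y l *: b l -> uniq s' -> {subset s <= s'} ->
    e = \sum_(l <- s') y l *: b l.
  move=> y0 eE us' ss'; rewrite eE; apply: big_uniq_extend => //.
  - exact: undup_uniq.
  - by move=> l; rewrite mem_undup; apply: ss'.
  by move=> l; rewrite mem_undup => /y0->; rewrite scale0r.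
have clin a e e' y y' : coords b e y -> coords b e' y' ->
    coords b (a *: e + e') (fun l => a * y l + y' l).
  move=> [s [y0 eE]] [s' [y0' eE']]; exists (s ++ s'); split.
    by move=> l; rewrite mem_cat negb_or => /andP[/y0-> /y0'->]; rewrite mulr0 addr0.
  rewrite (cext _ _ _ (undup (s ++ s')) y0 eE) ?undup_uniq //; last first.
    by move=> l ls; rewrite mem_undup mem_cat ls.
  rewrite (cext _ _ _ (undup (s ++ s')) y0' eE') ?undup_uniq //; last first.
    by move=> l ls; rewrite mem_undup mem_cat ls orbT.
  rewrite scaler_sumr -big_split; apply: eq_bigr => l _ /=.
  by rewrite scalerDl scalerA.
have c0 : coords b 0 (fun=> 0).
  by exists [::]; split=> //; rewrite big_nil.
have cb l : coords b (b l) (fun l' => (l' == l)%:R).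
  exists [:: l]; split=> [l'|]; first by rewrite inE => /negPf->.
  by rewrite /= big_seq1 eqxx scale1r.
have cuniq e y y' : coords b e y -> coords b e y' -> y = y'.
  move=> H H'; apply/funext => l; apply/eqP; rewrite -subr_eq0.
  have [s [y0]] := clin (-1) _ _ _ _ H' H.
  rewrite scaleN1r addNr => E; have [|ls] := boolP (l \notin s).
    by move/y0; rewrite mulN1r addrC => ->.
  have inj : injective (tnth (in_tuple (undup s))).
    apply/tuple_uniqP; exact: undup_uniq.
  have := bfree _ (tnth (in_tuple (undup s)))
     (fun i => -1 * y' (tnth (in_tuple (undup s)) i) + y (tnth (in_tuple (undup s)) i)) inj.
  rewrite -(big_tnth _ _ (undup s) xpredT (fun l => (-1 * y' l + y l) *: b l)) -E.
  have /tnthP[i ->] : l \in in_tuple (undup s).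
    by rewrite mem_undup; move: ls; rewrite negbK.
  by move=> /(_ erefl i); rewrite mulN1r addrC => ->.
have cex e : exists y, coords b e y.
  have /spanP[p [a [g [Hg ->]]]] := bspan e.
  apply: (big_ind (fun e => exists y, coords b e y)).
  - by exists (fun=> 0).
  - move=> u v [y Hy] [y' Hy']; exists (fun l => 1 * y l + y' l).
    by rewrite -[u]scale1r; apply: clin.
  move=> i _; have [l _ <-] := Hg i.
  by eexists; rewrite -[_ *: _]addr0; apply: clin (cb l) c0.
have [kap Hk] := choice cex.
have klin l : linear (fun e => kap e l : S^o).
  by move=> a u v; rewrite (cuniq _ _ _ (Hk _) (clin a _ _ _ _ (Hk u) (Hk v))).
pose kappa l : {linear F -> S^o} :=
  HB.pack (fun e => kap e l : S^o) (GRing.isLinear.Build S F S^o *:%R _ (klin l)).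
exists kappa => e; have [s [y0 eE]] := Hk e; exists s => s' us' ss'.
exact: cext eE us' ss'.
Qed.

Lemma free_coords (J : Type) (b : J -> F) : is_basis b ->
  exists kappa : J -> {linear F -> S^o},
    forall (I : finType) (e : I -> F), exists (L : seq J),
      forall i, e i = \sum_(l <- L) kappa l (e i) *: b l.
Proof.
move=> /(@free_coords_eq {classic J})[kappa Hk]; exists kappa => I e.
have [s Hs] := choice (fun i => Hk (e i)).
exists (undup (flatten [seq s i | i <- enum I])) => i; apply: Hs.
  exact: undup_uniq.
move=> l ls; rewrite mem_undup; apply/flattenP; exists (s i) => //.
by apply: map_f; rewrite mem_enum.
Qed.

Lemma inJ_scale (x : nat -> S) j (q : S^o) (e : F) : inJ x j q -> inJ x j (q *: e).
Proof.
have glin : linear (fun t : S^o => t *: e).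
  by move=> u t t'; rewrite scalerDl scalerA.
pose g : {linear S^o -> F} :=
  HB.pack (fun t : S^o => t *: e) (GRing.isLinear.Build S S^o F *:%R _ glin).
exact: (inJ_linear g).
Qed.

Lemma free_regular (x : nat -> S) j : free_module F ->
  (forall q : S^o, inJ x j (x j *: q) -> inJ x j q) ->
  forall e : F, inJ x j (x j *: e) -> inJ x j e.
Proof.
case=> J [b /free_coords[kappa Hk]] reg e He.
have H l : inJ x j (kappa l e) by apply: reg; rewrite -linearZ; apply: inJ_linear.
have [L /(_ tt)->] := Hk _ (fun _ : unit => e); apply: inJ_sum => l _.
exact: inJ_scale.
Qed.

End FreeCoordinates.

(** This is [koszul_step] with [h = 1], where exactness in one degree uses regularity two places to
    the right. Beyond [N] the complex is continued by the zero map, and surjectivity of [eps] gives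
    exactness at [N]. *)
Lemma koszul_resolution (T : comPzRingType) (x : nat -> T) (c : nat) (N : lmodType T)
    (G : nat -> lmodType T) (del : forall i, {linear G i.+1 -> G i})
    (eps : {linear G 0%N -> N}) :
  resolution del eps ->
  (forall (j : 'I_c) (y : N), inJ x j (x j *: y) -> inJ x j y) ->
  (forall i (j : 'I_c) (y : G i), inJ x j (x j *: y) -> inJ x j y) ->
  (forall z, inJ x c (eps z) -> exists v, inJ x c (z - del 0%N v)) /\
  (forall i z, inJ x c (del i z) -> exists v, inJ x c (z - del i.+1 v)).
Proof.
case=> [es e0 ei] regN regG.
have {}es y : exists v, eps v = y.
  by have [v _ <-] : range eps y by [rewrite es]; exists v.
have d0 z : eps (del 0%N z) = 0.
  have : range (del 0%N) (del 0%N z) by exists z.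
  by rewrite e0.
have d1 i z : del i (del i.+1 z) = 0.
  have : range (del i.+1) (del i.+1 z) by exists z.
  by rewrite ei.
suff H j : (j <= c)%N -> exact_mod x 1 (del 0%N) eps j /\
    forall i, exact_mod x 1 (del i.+1) (del i) j.
  have [H0 H1] := H c (leqnn c).
  split=> [z /H0|i z /H1] [K [v]]; rewrite expr1n scale1r; by exists v.
elim: j => [|j IH] jc.
  split=> [z|i z] /= Hz; exists 0%N.
    have [v _ <-] : range (del 0%N) z by rewrite e0.
    by exists v; rewrite scale1r subrr.
  have [v _ <-] : range (del i.+1) z by rewrite ei.
  by exists v; rewrite scale1r subrr.
have [IH0 IH1] := IH (ltnW jc).
split=> [|[|i]].
- apply: (@koszul_step _ _ _ _ _ _ _ _ _ _ (\0 : {linear N -> N})) => //.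
    exact: regN (Ordinal jc).
  move=> y _; have [v <-] := es y; exists 0%N, v.
  by rewrite scale1r subrr; apply: inJ0.
- by apply: koszul_step (IH1 0%N) => //; apply: regN (Ordinal jc).
by apply: koszul_step (IH1 i.+1) => //; apply: regG (Ordinal jc).
Qed.

(** All modules of [koszul_step] are equal to [E]. The homology is initially killed by [h], and each
    further [x_j] may raise the power of [h] required. *)
Lemma koszul_endo (T : comPzRingType) (x : nat -> T) (h : T) (c : nat)
    (E : lmodType T) (d : {linear E -> E}) :
  (forall z, d (d z) = 0) ->
  (forall (j : 'I_c) (y : E), inJ x j (x j *: y) -> inJ x j y) ->
  (forall z, d z = 0 -> exists v, h *: z = d v) ->
  forall z, inJ x c (d z) -> exists K v, inJ x c (h ^+ K *: z - d v).
Proof.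
move=> dd reg ex.
suff H j : (j <= c)%N -> exact_mod x h d d j by exact: H.
elim: j => [|j IH] jc.
  by move=> z /= /ex[v E1]; exists 1%N, v; rewrite expr1 E1 subrr.
by apply: koszul_step (IH (ltnW jc)) (IH (ltnW jc)) => //; apply: reg (Ordinal jc).
Qed.

(** * Minimal resolutions *)

Section MinimalResolution.
Variables (S : comPzRingType) (nS : S -> Prop).
Hypothesis nS_unit : forall s, ~ nS s -> exists t, t * s = 1.
Hypothesis nS1 : ~ nS 1.

Definition fg_sub (E : lmodType S) (K : E -> Prop) p (g : 'I_p -> E) :=
  (forall i, K (g i)) /\ forall v, K v -> exists a : 'I_p -> S, v = \sum_i a i *: g i.

Lemma min_gens (E : lmodType S) (K : E -> Prop) :
  (exists p (g : 'I_p -> E), fg_sub K g) ->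
  exists p (g : 'I_p -> E), fg_sub K g /\
    forall a : 'I_p -> S, \sum_i a i *: g i = 0 -> forall i, nS (a i).
Proof.
move=> H.
have exP : exists p, `[< exists g : 'I_p -> E, fg_sub K g >].
  by have [p Hp] := H; exists p; apply/asboolP.
case: (ex_minnP exP) => p /asboolP[g Kg] pmin; exists p, g; split=> // a a0 i0.
apply: contrapT => /nS_unit[t ta].
case: p g Kg pmin a a0 i0 ta => [|p] g [Kg gK] pmin a a0 i0 ta; first by case: i0 ta.
have := pmin p; rewrite ltnn => pmin'; apply: notF; apply: pmin'; apply/asboolP.
exists (fun j => g (fintype.lift i0 j)); split=> // v /gK[b ->].
have bigE (F : 'I_p.+1 -> E) : \sum_i F i = F i0 + \sum_(j < p) F (fintype.lift i0 j).
  by rewrite (bigD1_ord i0).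
have E0 : g i0 = - \sum_j (t * a (fintype.lift i0 j)) *: g (fintype.lift i0 j).
  apply/eqP; rewrite -addr_eq0 -[g i0]scale1r -ta -scalerA.
  under eq_bigr do rewrite -scalerA.
  by rewrite -scaler_sumr -scalerDr -(bigE (fun i => a i *: g i)) a0 scaler0.
exists (fun j => b (fintype.lift i0 j) - b i0 * (t * a (fintype.lift i0 j))).
rewrite bigE E0 scalerN scaler_sumr addrC -sumrB.
by apply: eq_bigr => j _; rewrite scalerBl scalerA.
Qed.

Hypothesis noeth : forall I : S -> Prop, I 0 -> (forall u v, I u -> I v -> I (u + v)) ->
  (forall u v, I v -> I (u * v)) -> exists p (g : 'I_p -> S^o), fg_sub (I : S^o -> Prop) g.

(** Induction on [q]: the first coordinates of vectors of [K] form a finitely generated ideal, and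
    the vectors of [K] with first coordinate [0] live in dimension one less. *)
Lemma noeth_cV q (K : 'cV[S]_q -> Prop) : K 0 -> (forall u v, K u -> K v -> K (u + v)) ->
  (forall a v, K v -> K (a *: v)) -> exists p (g : 'I_p -> 'cV[S]_q), fg_sub K g.
Proof.
elim: q K => [|q IH] K K0 KD KZ.
  exists 0%N, (fun=> 0); split=> [[]//|v _]; exists (fun=> 0).
  by rewrite big_ord0; apply/matrixP => -[].
have KN v : K v -> K (- v) by rewrite -scaleN1r; apply: KZ.
have Ksum (I : finType) (F : I -> 'cV[S]_q.+1) : (forall i, K (F i)) -> K (\sum_i F i).
  by move=> KF; apply: (big_ind K) => //.
have [p [g [Ig gI]]] : exists p (g : 'I_p -> S^o),
    fg_sub (fun s : S^o => exists2 v, K v & v 0 0 = s) g.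
  apply: (noeth (I := fun s => exists2 v, K v & v 0 0 = s)).
  - by exists 0 => //; rewrite mxE.
  - move=> _ _ [u Ku <-] [v Kv <-]; exists (u + v); first exact: KD.
    by rewrite mxE.
  by move=> a _ [v Kv <-]; exists (a *: v); [apply: KZ | rewrite mxE].
have /choice[w Hw] : forall i, exists v, K v /\ v 0 0 = g i.
  by move=> i; have [v Kv vg] := Ig i; exists v.
pose up (y : 'cV[S]_q) : 'cV[S]_q.+1 := col_mx (0 : 'cV_1) y.
have upD u v : up (u + v) = up u + up v by have := add_col_mx (0 : 'cV[S]_1) u 0 v;
  rewrite addr0 => /esym.
have upZ a v : up (a *: v) = a *: up v by have := scale_col_mx a (0 : 'cV[S]_1) v;
  rewrite scaler0 => /esym.
have up0 : up 0 = 0 by rewrite -[X in up X](scale0r 0) upZ scale0r.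
have [||| p' [g' [Kg' g'K]]] := IH (fun y => K (up y)).
- by rewrite up0.
- by move=> u v Ku Kv; rewrite upD; apply: KD.
- by move=> a v Kv; rewrite upZ; apply: KZ.
exists (p + p')%N, (fun i => match split i with inl j => w j | inr j => up (g' j) end).
split=> [i|v Kv]; first by case: (split i) => j //; case: (Hw j).
have [a Ea] := gI (v 0 0) (ex_intro2 _ _ v Kv erefl).
pose v' := v - \sum_i a i *: w i.
have Kv' : K v'.
  by apply: KD => //; apply: KN; apply: Ksum => i; apply: KZ; case: (Hw i).
have usub0 : usubmx (v' : 'cV_(1 + q)) = 0.
  apply/matrixP => i j; rewrite !ord1 mxE [lshift _ _](_ : _ = 0); last exact: val_inj.
  rewrite !mxE summxE Ea; apply/eqP; rewrite subr_eq0; apply/eqP; apply: eq_bigr => l _.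
  by rewrite mxE; case: (Hw l) => _ ->.
have Ev' : v' = up (dsubmx (v' : 'cV_(1 + q))).
  by have := vsubmxK (v' : 'cV_(1 + q)); rewrite usub0 => /esym.
have [b Eb] := g'K (dsubmx (v' : 'cV_(1 + q))) ltac:(by rewrite -Ev').
exists (fun i => match split i with inl j => a j | inr j => b j end).
rewrite -[LHS](subrK (\sum_i a i *: w i)) -/v' Ev' Eb big_split_ord /= addrC.
congr (_ + _); last by apply: eq_bigr => i _; rewrite (unsplitK (inl i)).
rewrite (big_morph up upD up0); apply: eq_bigr => i _.
by rewrite (unsplitK (inr i)) upZ.
Qed.

Lemma mulmx_cVE p q (D : 'M[S]_(p, q)) (g : 'I_q -> 'cV[S]_p) (u : 'cV_q) :
  (forall j, col j D = g j) -> D *m u = \sum_j u j 0 *: g j.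
Proof.
move=> Dg; apply/matrixP => i l; rewrite !mxE summxE; apply: eq_bigr => j _.
by rewrite -Dg !mxE ord1 mulrC.
Qed.

Definition minimal_cover p q r (D : 'M[S]_(p, q)) (D' : 'M[S]_(q, r)) :=
  (forall y : 'cV_q, D *m y = 0 <-> exists u, y = D' *m u) /\
  (forall u : 'cV_r, D' *m u = 0 -> forall i, nS (u i 0)).

Lemma min_kernel q (K : 'cV[S]_q -> Prop) : K 0 -> (forall u v, K u -> K v -> K (u + v)) ->
  (forall a v, K v -> K (a *: v)) -> exists r (D' : 'M[S]_(q, r)),
    (forall y : 'cV_q, K y <-> exists u, y = D' *m u) /\
    (forall u : 'cV_r, D' *m u = 0 -> forall i, nS (u i 0)).
Proof.
move=> K0 KD KZ; have [p [g [[Kg gK] gmin]]] := min_gens (noeth_cV K0 KD KZ).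
pose D' : 'M_(q, p) := \matrix_(i, j) g j i 0.
have D'g j : col j D' = g j by apply/matrixP => i l; rewrite !mxE ord1.
exists p, D'; split=> [y|u].
  split=> [/gK[a ->]|[u ->]].
    exists (\col_j a j); rewrite (mulmx_cVE _ D'g).
    by apply: eq_bigr => j _; rewrite mxE.
  rewrite (mulmx_cVE _ D'g); apply: (big_ind K) => // j _; exact/KZ.
by rewrite (mulmx_cVE _ D'g) => /gmin.
Qed.

(** Differentials are kept as matrices because their entries will be lifted to [Q] and transposed in
    the comparison with the tail. *)
Record minimal_resolution (M : lmodType S) := MinimalResolution {
  betti : nat -> nat;
  mr_diff : forall i, 'M[S]_(betti i, betti i.+1);
  mr_gen : 'I_(betti 0%N) -> M;
  mr_surj : forall v, exists y : 'cV_(betti 0%N), v = \sum_i y i 0 *: mr_gen i;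
  mr_ex0 : forall y : 'cV_(betti 0%N), \sum_i y i 0 *: mr_gen i = 0 <->
    exists u, y = mr_diff 0%N *m u;
  mr_ex : forall i (y : 'cV_(betti i.+1)), mr_diff i *m y = 0 <->
    exists u, y = mr_diff i.+1 *m u;
  mr_min : forall i j l, nS (mr_diff i j l);
  mr_stop : forall i, betti i = 0%N -> betti i.+1 = 0%N }.

Local Arguments mr_gen {M} m i.
Local Arguments mr_diff {M} m i.
Local Arguments mr_surj {M} m v.

Lemma minimal_resolution_exists (M : lmodType S) :
  (exists p (g : 'I_p -> M), fg_sub (fun=> True) g) -> inhabited (minimal_resolution M).
Proof.
case/min_gens => b0 [g [[_ gM] gmin]].
have colE q r (D : 'M[S]_(q, r)) l : col l D = D *m col l 1%:M.
  by rewrite -[in LHS](mulmx1 D) !colE mulmxA.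
have [|||b1 [D0 [ex0 min0]]] := @min_kernel b0 (fun y => \sum_i y i 0 *: g i = 0).
- by apply: big1 => i _; rewrite mxE scale0r.
- move=> u v u0 v0.
  transitivity (\sum_i u i 0 *: g i + \sum_i v i 0 *: g i); last by rewrite u0 v0 addr0.
  rewrite -big_split; by apply: eq_bigr => i _; rewrite mxE scalerDl.
- move=> a v v0; transitivity (a *: \sum_i v i 0 *: g i); last by rewrite v0 scaler0.
  rewrite scaler_sumr.
  by apply: eq_bigr => i _; rewrite mxE scalerA.
(* Differentials come from dependent choice; the state carries both sizes so that consecutive
   matrices compose by conversion. *)
pose St := {p : nat & {q : nat & 'M[S]_(p, q)}}.
have stepP (s : St) : exists t : {r : nat & 'M[S]_(projT1 (projT2 s), r)},
    minimal_cover (projT2 (projT2 s)) (projT2 t).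
  case: s => p [q D] /=.
  have [|||r [D' HD']] := @min_kernel q (fun y => D *m y = 0); last by exists (existT _ r D').
  - exact: mulmx0.
  - by move=> u v u0 v0; rewrite mulmxDr u0 v0 addr0.
  - by move=> a v v0; rewrite -scalemxAr v0 scaler0.
pose nxt s := sval (cid (stepP s)).
pose step (s : St) : St := existT _ (projT1 (projT2 s)) (nxt s).
pose st i := iter i step (existT _ b0 (existT _ b1 D0) : St).
pose b i := projT1 (st i).
pose D i : 'M[S]_(b i, b i.+1) := projT2 (projT2 (st i)).
have cov i : minimal_cover (D i) (D i.+1) := svalP (cid (stepP (st i))).
have minD i (u : 'cV_(b i.+1)) : D i *m u = 0 -> forall l, nS (u l 0).
  by case: i u => [|i] u; [apply: min0 | case: (cov i) => _; apply].
(* A matrix without rows kills the constant vector [1], whose entries are not in [nS]. *)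
have stop i : b i = 0%N -> b i.+1 = 0%N.
  move=> bi; case E: (b i.+1) => [//|r]; exfalso; apply: nS1.
  have l : 'I_(b i.+1) by rewrite E; apply: ord0.
  have := @minD i (const_mx 1) _ l; rewrite mxE; apply.
  by apply/matrixP => i' j; have := ltn_ord i'; rewrite {2}bi.
constructor; apply: (@MinimalResolution M b D g) => //.
- by move=> v; have [a ->] := gM v I; exists (\col_i a i); apply: eq_bigr => i _; rewrite mxE.
- by move=> i y; case: (cov i).
move=> i j l; have -> : D i j l = col l (D i) j 0 by rewrite mxE.
case: i j l => [|i] j l; last first.
  by apply: minD; case: (cov i) => H _; apply/H; exists (col l 1%:M); apply: colE.
by apply: (gmin (fun j => col l (D 0%N) j 0)); apply/ex0; exists (col l 1%:M); apply: colE.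
Qed.

Lemma cV_projective q : projective 'cV[S]_q.
Proof.
move=> U V g h gsurj.
have /choice[u Hu] : forall j : 'I_q, exists y, g y = h (delta_mx j 0).
  by move=> j; have [y _ <-] : range g (h (delta_mx j 0)) by [rewrite gsurj]; exists y.
have hl : linear (fun y : 'cV[S]_q => \sum_j y j 0 *: u j).
  move=> a y y'; rewrite scaler_sumr -big_split; apply: eq_bigr => j _.
  by rewrite !mxE scalerDl scalerA.
pose h' : {linear 'cV[S]_q -> U} :=
  HB.pack (fun y : 'cV[S]_q => \sum_j y j 0 *: u j)
    (GRing.isLinear.Build S 'cV[S]_q U *:%R _ hl).
exists h' => y; rewrite -[h' y]/(\sum_j y j 0 *: u j) linear_sum.
have -> : h y = \sum_j y j 0 *: h (delta_mx j 0).
  rewrite {1}[y]matrix_sum_delta linear_sum; apply: eq_bigr => j _.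
  by rewrite big_ord1 linearZ.
by apply: eq_bigr => j _; rewrite linearZ_LR Hu.
Qed.

Lemma minimal_resolution_pd (M : lmodType S) (F : minimal_resolution M) t :
  betti F t.+1 = 0%N -> proj_dim_le M t.
Proof.
move=> bt; pose eps0 (y : 'cV[S]_(betti F 0)) := \sum_i y i 0 *: mr_gen F i.
have el : linear eps0.
  move=> a y y'; rewrite /eps0 scaler_sumr -big_split; apply: eq_bigr => j _.
  by rewrite !mxE scalerDl scalerA.
pose eps : {linear 'cV[S]_(betti F 0) -> M} :=
  HB.pack eps0 (GRing.isLinear.Build S 'cV[S]_(betti F 0) M *:%R _ el).
exists (fun i => 'cV[S]_(betti F i)), (fun i => mulmx (mr_diff F i)), eps; split.
- split=> [||i].
  + apply/seteqP; split=> // v _; have [y ->] := mr_surj F v; by exists y.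
  + apply/seteqP; split=> [_ [u _ <-]|y /mr_ex0[u ->]]; last by exists u.
    by apply/mr_ex0; exists u.
  apply/seteqP; split=> [_ [u _ <-]|y /mr_ex[u ->]]; last by exists u.
  by apply/mr_ex; exists u.
- move=> i; exact: cV_projective.
have stop i : betti F (i + t.+1) = 0%N.
  by elim: i => // i; apply: mr_stop.
move=> i ti x; have bi : betti F i = 0%N by rewrite -(subnK ti).
by apply/matrixP => j; have := ltn_ord j; rewrite {2}bi.
Qed.

End MinimalResolution.

Arguments mr_gen {S nS M} m i.
Arguments mr_diff {S nS M} m i.
Arguments mr_surj {S nS M} m v.
Arguments mr_min {S nS M} m i j l.

(** * Comparison of resolutions *)

Section MatrixActions.
Variable S : comPzRingType.

Lemma matrix_actionM (N : lmodType S) p q r (A : 'M[S]_(p, q)) (B : 'M_(q,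
  r)) (z : {ffun 'I_r -> N}) :
  matrix_action A (matrix_action B z) = matrix_action (A *m B) z.
Proof.
apply/ffunP => i; rewrite !ffunE; under eq_bigr do rewrite ffunE scaler_sumr.
rewrite exchange_big; apply: eq_bigr => j _; rewrite mxE scaler_suml.
by apply: eq_bigr => l _; rewrite scalerA.
Qed.

Lemma matrix_action0 (N : lmodType S) p q (z : {ffun 'I_q -> N}) :
  matrix_action (0 : 'M[S]_(p, q)) z = 0.
Proof. by apply/ffunP => i; rewrite !ffunE big1 // => j _; rewrite mxE scale0r. Qed.

Definition fmap (N N' : lmodType S) (g : {linear N -> N'}) q
  (z : {ffun 'I_q -> N}) : {ffun 'I_q -> N'} := [ffun i => g (z i)].

Fact fmap_linear (N N' : lmodType S) (g : {linear N -> N'}) q : linear (@fmap N N' g q).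
Proof. by move=> a u v; apply/ffunP => i; rewrite !ffunE linearP. Qed.

HB.instance Definition _ (N N' : lmodType S) (g : {linear N -> N'}) q :=
  GRing.isLinear.Build S {ffun 'I_q -> N} {ffun 'I_q -> N'} *:%R (@fmap N N' g q)
    (@fmap_linear N N' g q).

Lemma fmap_action (N N' : lmodType S) (g : {linear N -> N'}) p q (A : 'M[S]_(p, q))
    (z : {ffun 'I_q -> N}) :
  fmap g (matrix_action A z) = matrix_action A (fmap g z).
Proof.
apply/ffunP => i; rewrite !ffunE linear_sum; apply: eq_bigr => j _.
by rewrite ffunE linearZ.
Qed.

Definition action_exact (N : lmodType S) p q r (A : 'M[S]_(p, q)) (B : 'M_(q, r)) :=
  forall z : {ffun 'I_q -> N}, matrix_action A z = 0 -> exists u, z = matrix_action B u.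

End MatrixActions.

(* Both complexes resolve, so a cycle over [X 0] in degree [i + d] can be pushed
   down [d] steps along [X] to a cycle in degree [i]. *)
Section TorChase.
Variables (Q : comPzRingType) (x : nat -> Q) (c : nat).
Variables (X : nat -> lmodType Q) (de : forall i, {linear X i.+1 -> X i}).
Variables (b : nat -> nat) (D : forall i, 'M[Q]_(b i, b i.+1)).
Hypothesis de2 : forall i z, de i (de i.+1 z) = 0.
Hypothesis deX : forall i z, inJ x c (de i z) -> exists v, inJ x c (z - de i.+1 v).
Hypothesis DD : forall p i (y : {ffun 'I_(b i.+2) -> X p}),
  inJ x c (matrix_action (D i) (matrix_action (D i.+1) y)).
Hypothesis DX : forall p i (y : {ffun 'I_(b i.+1) -> X p.+1}),
  inJ x c (matrix_action (D i) y) -> exists u, inJ x c (y - matrix_action (D i.+1) u).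

Let defX p q (z : {ffun 'I_q -> X p.+1}) : inJ x c (fmap (de p) z) ->
  exists v, inJ x c (z - fmap (de p.+1) v).
Proof.
move=> /inJ_ffun Hz.
have /choice[v Hv] : forall i, exists v, inJ x c (z i - de p.+1 v).
  by move=> i; apply: deX; have := Hz i; rewrite ffunE.
by exists (finfun v); apply/inJ_ffun => i; rewrite !ffunE.
Qed.

Let def2 p q (z : {ffun 'I_q -> X p.+2}) : fmap (de p) (fmap (de p.+1) z) = 0.
Proof. by apply/ffunP => i; rewrite !ffunE de2. Qed.

(** With [Z_p] the image of [de p], this says, modulo [(x)], that Tor in degree [i + 1] vanishes
    between [Z_p] and the module resolved by [D]. *)
Definition tor_vanish p i := forall y : {ffun 'I_(b i.+1) -> X p.+1},
  inJ x c (matrix_action (D i) (fmap (de p) y)) ->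
  exists t, inJ x c (fmap (de p) y - matrix_action (D i.+1) (fmap (de p) t)).

(** Dimension shifting along [0 -> Z_(p+1) -> X_(p+1) -> Z_p -> 0], where [DX] supplies the
    acyclicity of the middle term. *)
Lemma tor_vanishS p i : tor_vanish p.+1 i -> tor_vanish p i.+1.
Proof.
move=> H y; rewrite -fmap_action => /defX[w Hw].
have /H[t Ht] : inJ x c (matrix_action (D i) (fmap (de p.+1) w)).
  rewrite -[fmap _ w](subKr (matrix_action (D i.+1) y)) linearB.
  by apply: inJB; [apply: DD | apply: inJ_linear].
have /DX[u Hu] : inJ x c (matrix_action (D i.+1) (y - fmap (de p.+1) t)).
  rewrite linearB -[X in X - _](subrK (fmap (de p.+1) w)) -addrA.
  exact: inJD.
exists u; rewrite -fmap_action.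
have := inJ_linear (@fmap _ _ _ (de p) _) Hu; rewrite !linearB /=.
by rewrite def2 subr0.
Qed.

Lemma tor_vanish_shift p i : tor_vanish p i -> tor_vanish 0 (i + p).
Proof.
elim: p i => [|p IH] i; first by rewrite addn0.
by move/tor_vanishS/IH; rewrite addSnnS.
Qed.

(** Here [Z_p] is presented as the cokernel of [de p.+1]: [y] represents a cycle with values in
    [Z_p] when [D 0 y] is in the image of that map. *)
Lemma tor_vanish_tail p :
  (forall (y : {ffun 'I_(b 1) -> X p.+1}) (w : {ffun 'I_(b 0) -> X p.+2}),
      inJ x c (matrix_action (D 0) y - fmap (de p.+1) w) ->
      exists u t, inJ x c (y - fmap (de p.+1) u - matrix_action (D 1) t)) ->
  tor_vanish p 0.
Proof.
move=> H y; rewrite -fmap_action => /defX[w /H[u [t Ht]]]; exists t.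
have := inJ_linear (@fmap _ _ _ (de p) _) Ht; rewrite !linearB /= def2 subr0.
by rewrite fmap_action.
Qed.

Hypothesis D_null : forall i (y : {ffun 'I_(b i.+1) -> X 0%N}), matrix_action (D i) y = 0.
Hypothesis de0 : forall y : X 0%N, exists z, de 0%N z = y.

(** All differentials are zero on [X 0], so vanishing homology means a vanishing term; a constant
    family with value [y] would otherwise be a cycle that is not a boundary. *)
Lemma tor_vanish_betti (y : X 0%N) i : ~ inJ x c y -> tor_vanish 0 i -> b i.+1 = 0%N.
Proof.
move=> Hy H; case E: (b i.+1) => [//|r].
have l : 'I_(b i.+1) by rewrite E; apply: ord0.
have [z zy] := de0 y; have [|t] := H [ffun => z].
  by rewrite D_null; apply: inJ0.
by rewrite D_null subr0 => /inJ_ffun/(_ l); rewrite !ffunE zy.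
Qed.

End TorChase.

(* Balancing Tor at the last step: the cokernel of the tail is compared with [M] through
   the first two maps of a resolution of [M]. *)
Lemma tail_exact (S : comPzRingType) (nS : S -> Prop) (M : lmodType S)
    (F : minimal_resolution nS M) N (A B : 'M[S]_N)
    (Y : 'M_(N, betti F 1)) (W : 'M_(N, betti F 0)) :
  A *m B = 0 -> action_exact M A B ->
  Y *m (mr_diff F 0)^T = A *m W ->
  exists U T, Y = A *m U + T *m (mr_diff F 1)^T.
Proof.
move=> AB exM E; set D0 := mr_diff F 0; set D1 := mr_diff F 1.
(* Rows run over the tail and columns over the resolution of [M], hence the transposes; [ep] applies
   the augmentation onto [M] to each row. *)
pose ep (V : 'M[S]_(N, betti F 0)) : {ffun 'I_N -> M} :=
  [ffun i => \sum_j V i j *: mr_gen F j].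
have epA (A' : 'M_N) V : matrix_action A' (ep V) = ep (A' *m V).
  apply/ffunP => i; rewrite !ffunE; under eq_bigr do rewrite ffunE scaler_sumr.
  rewrite exchange_big; apply: eq_bigr => j _; rewrite mxE scaler_suml.
  by apply: eq_bigr => l _; rewrite scalerA.
have ep0 V : ep (V *m D0^T) = 0.
  apply/ffunP => i; rewrite !ffunE.
  have /mr_ex0 : exists u, D0 *m (row i V)^T = mr_diff F 0 *m u by eexists.
  move=> E0; rewrite -[RHS]E0; apply: eq_bigr => j _; congr (_ *: _); rewrite !mxE;
    apply: eq_bigr => l _.
  by rewrite !mxE mulrC.
have epI V : ep V = 0 -> exists V', V = V' *m D0^T.
  move=> V0; have /choice[u Hu] : forall i, exists u, (row i V)^T = D0 *m u.
    move=> i; apply/mr_ex0; have /ffunP/(_ i) := V0; rewrite !ffunE => E0; rewrite -[RHS]E0.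
    by apply: eq_bigr => j _; rewrite !mxE.
  exists (\matrix_(i, j) u i j 0); apply/matrixP => i j.
  have /matrixP/(_ j 0) := Hu i; rewrite !mxE => ->; apply: eq_bigr => l _.
  by rewrite !mxE mulrC.
(* [A W = Y D0^T] has zero augmentation, so [ep W] is a cycle for [A] on [M]; exactness writes it as
   [B v], and [v] lifts to a matrix [V]. *)
have [v Hv] := exM (ep W) ltac:(by rewrite epA -E ep0).
have [V HV] : exists V, v = ep V.
  have /choice[u Hu] := fun i => mr_surj F (v i).
  exists (\matrix_(i, j) u i j 0); apply/ffunP => i; rewrite ffunE Hu.
  by apply: eq_bigr => j _; rewrite mxE.
have [U HU] : exists U, W - B *m V = U *m D0^T.
  apply: epI; apply/ffunP => i; have /ffunP/(_ i) := Hv.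
  rewrite HV epA !ffunE => E1; rewrite -[RHS](subrr (\sum_j (B *m V) i j *: mr_gen F j)).
  rewrite -{1}E1 -sumrB; apply: eq_bigr => j _.
  by rewrite -scalerBl !mxE.
have [T HT] : exists T, Y - A *m U = T *m D1^T.
  have E0 : (Y - A *m U) *m D0^T = 0.
    by rewrite mulmxBl E -mulmxA -HU mulmxBr (mulmxA A B) AB mul0mx subr0 subrr.
  have /choice[u Hu] : forall i, exists u, (row i (Y - A *m U))^T = D1 *m u.
    move=> i; apply/mr_ex; apply: trmx_inj; rewrite trmx_mul trmxK -row_mul E0.
    by rewrite trmx0 row0.
  exists (\matrix_(i, j) u i j 0); apply/matrixP => i j.
  have /matrixP/(_ j 0) := Hu i; rewrite mxE [X in X = _ -> _]mxE => ->.
  by rewrite !mxE; apply: eq_bigr => l _; rewrite !mxE mulrC.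
by exists U, T; rewrite -HT addrC subrK.
Qed.

Lemma free_action_exact (S : comPzRingType) (F : lmodType S) p q r
    (A : 'M[S]_(p, q)) (B : 'M_(q, r)) : free_module F ->
  action_exact S^o A B -> action_exact F A B.
Proof.
case=> J [b /free_coords[kappa Hk]] ex z z0.
have [L HL] := Hk _ z.
have /choice[t Ht] : forall l, exists t : {ffun 'I_r -> S^o},
    [ffun i => kappa l (z i)] = matrix_action B t.
  move=> l; apply: ex; rewrite -[[ffun _ => _]]/(fmap (kappa l) z) -fmap_action z0.
  by rewrite linear0.
exists [ffun j => \sum_(l <- L) t l j *: b l]; apply/ffunP => i; rewrite HL ffunE.
under [RHS]eq_bigr do rewrite ffunE scaler_sumr.
rewrite exchange_big; apply: eq_bigr => l _; have /ffunP/(_ i) := Ht l.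
by rewrite !ffunE => ->; rewrite scaler_suml; apply: eq_bigr => j _; rewrite scalerA.
Qed.

Lemma freeg_free (S : comNzRingType) (F : choiceType) :
  free_module ({freeg F / S} : lmodType S).
Proof.
exists F, (fun x => << x >>); split=> [D|p u a inju E i].
  rewrite -[D]freeg_sumE; apply: rpred_sum => x _.
  have -> : << coeff x D *g x >> = coeff x D *: << x >> :> {freeg F / S}.
    by apply/eqP/freeg_eqP => y; rewrite coeffZ !coeffU mul1r.
  by apply: rpredZ; apply: mem_span; exists x.
have := congr1 (coeff (u i)) E; rewrite raddf_sum /= coeff0 (bigD1 i) //= big1 ?addr0.
  by rewrite coeffZ coeffU eqxx !mulr1.
by move=> j ji; rewrite coeffZ coeffU mul1r (inj_eq inju) (negPf ji) mulr0.
Qed.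

(** A projective module is a retract of the free module on its underlying set: the cycle is moved
    there by [h'], and [g] brings the solution back. *)
Lemma projective_action_exact (S : comNzRingType) (F : lmodType S) p q r
    (A : 'M[S]_(p, q)) (B : 'M_(q, r)) : projective F ->
  action_exact S^o A B -> action_exact F A B.
Proof.
move=> projF ex z z0.
pose g0 (D : {freeg F / S}) := fglift (@idfun F) D.
have gU c x : g0 << c *g x >> = c *: x by apply: liftU.
have gB : zmod_morphism g0 := lift_is_additive (@idfun F).
pose ga : {additive {freeg F / S} -> F} :=
  HB.pack g0 (GRing.isZmodMorphism.Build {freeg F / S} F g0 gB).
have gl : linear g0.
  move=> c D D'; rewrite -[LHS]/(ga _) raddfD; congr (_ + _).
  rewrite -[g0 D]/(ga D) -[D]freeg_sumE scaler_sumr [LHS](raddf_sum ga).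
  rewrite [X in _ = _ *: X](raddf_sum ga) scaler_sumr.
  apply: eq_bigr => x _; rewrite -[LHS]/(g0 _) -[X in _ = _ *: X]/(g0 _) gU.
  rewrite (_ : c *: _ = << c * coeff x D *g x >>) ?gU ?scalerA //.
  by apply/eqP/freeg_eqP => y; rewrite coeffZ !coeffU mulrA.
pose g : {linear {freeg F / S} -> F} :=
  HB.pack g0 (GRing.isLinear.Build S {freeg F / S} F *:%R _ gl).
have [h' Hh] := projF _ _ g idfun ltac:(by apply/seteqP; split=> // y _;
  exists << y >> => //; rewrite -[LHS]/(g0 _) gU scale1r).
have [u Hu] : exists u, fmap h' z = matrix_action B u.
  apply: (free_action_exact (freeg_free S F) ex).
  by rewrite -fmap_action z0 linear0.
exists (fmap g u); rewrite -fmap_action -Hu.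
by apply/ffunP => i; rewrite !ffunE Hh.
Qed.

(** Descending induction on the syzygies, which are eventually zero. Passing to the next syzygy
    exchanges [A] and [B], so both exactness statements are carried together. *)
Lemma pd_action_exact (S : comNzRingType) (M : lmodType S) N (A B : 'M[S]_N) t :
  A *m B = 0 -> B *m A = 0 -> action_exact S^o A B -> action_exact S^o B A ->
  proj_dim_le M t -> action_exact M A B.
Proof.
move=> AB BA exA exB [F [del [eps [[es e0 ei] projF F0]]]].
have eS y : exists v, eps v = y.
  by have [v _ <-] : range eps y by [rewrite es]; exists v.
have ed z : eps (del 0%N z) = 0.
  have : range (del 0%N) (del 0%N z) by exists z.
  by rewrite e0.
have dd i z : del i (del i.+1 z) = 0.
  have : range (del i.+1) (del i.+1 z) by exists z.
  by rewrite ei.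
have eker z : eps z = 0 -> exists v, z = del 0%N v.
  by move=> z0; have [v _ <-] : range (del 0%N) z by [rewrite e0]; exists v.
have dker i z : del i z = 0 -> exists v, z = del i.+1 v.
  by move=> z0; have [v _ <-] : range (del i.+1) z by [rewrite ei]; exists v.
pose Ex i (C D : 'M[S]_N) := forall z : {ffun 'I_N -> F i.+1},
  matrix_action C (fmap (del i) z) = 0 ->
  exists u, fmap (del i) z = matrix_action D (fmap (del i) u).
(* The connecting map: for a cycle [g z], the element [C z] is [g' v] for some [v] and a cycle for
   [D]; solving there corrects [z] to a cycle on [X]. *)
have step (X Y Z : lmodType S) (g : {linear X -> Y}) (g' : {linear Z -> X}) (C D : 'M[S]_N) :
    (forall z, g (g' z) = 0) -> (forall z, g z = 0 -> exists v, z = g' v) ->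
    C *m D = 0 -> D *m C = 0 -> action_exact X C D ->
    (forall z : {ffun 'I_N -> Z}, matrix_action D (fmap g' z) = 0 ->
       exists u, fmap g' z = matrix_action C (fmap g' u)) ->
    forall z : {ffun 'I_N -> X}, matrix_action C (fmap g z) = 0 ->
       exists u, fmap g z = matrix_action D (fmap g u).
  move=> gg' ker _ DC exX H z; rewrite -fmap_action => z0.
  have /choice[v Hv] : forall i, exists v, matrix_action C z i = g' v.
    by move=> i; apply: ker; have /ffunP/(_ i) := z0; rewrite !ffunE.
  have Ev : matrix_action C z = fmap g' (finfun v) by apply/ffunP => i; rewrite Hv !ffunE.
  have [|u Hu] := H (finfun v).
    by rewrite -Ev matrix_actionM DC matrix_action0.
  have [|w Hw] := exX (z - fmap g' u).
    by rewrite linearB /= Ev Hu subrr.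
  exists w; rewrite -fmap_action -Hw linearB /=.
  rewrite (_ : fmap g (fmap g' u) = 0) ?subr0 //.
  by apply/ffunP => i; rewrite !ffunE gg'.
have exall i : Ex i A B /\ Ex i B A.
  have [l] := ubnP (t.+1 - i)%N; elim: l i => // l IH i il.
  have [ti|ti] := ltnP t i.+1.
    by split=> z _; exists 0; rewrite (_ : z = 0) ?linear0 //; apply/ffunP => j;
      rewrite ffunE; apply: F0.
  have [IHA IHB] : Ex i.+1 A B /\ Ex i.+1 B A.
    by apply: IH; rewrite subSS; move: il; rewrite subSn // ltnW.
  split; apply: (step _ _ _ (del i) (del i.+1)) => //.
  - exact: dker.
  - exact: projective_action_exact.
  - exact: dker.
  exact: projective_action_exact.
have [_ exB0] := exall 0%N.
move=> z z0; have /choice[v Hv] := fun i => eS (z i).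
have Ez : z = fmap eps (finfun v) by apply/ffunP => i; rewrite !ffunE Hv.
have [||u Hu] := step _ _ _ eps (del 0%N) A B ed eker AB BA _ exB0 (finfun v).
- exact: projective_action_exact.
- by rewrite -Ez.
by exists (fmap eps u); rewrite Ez.
Qed.

(** * Minors and square-zero matrices *)

(** Choose a maximal independent set of rows, then independent columns of the full-rank matrix they
    form. *)
Lemma rank_minor (k : fieldType) p q (D : 'M[k]_(p, q)) :
  exists (u : 'I_(\rank D) -> 'I_p) (v : 'I_(\rank D) -> 'I_q),
    [/\ injective u, injective v & \det (mxsub u v D) != 0].
Proof.
pose E := rowsub (maxrankfun D) D.
have fE : row_full E^T by rewrite /row_full mxrank_tr; apply: maxrowsub_free.
exists (maxrankfun D), (fullrankfun fE); split.
- exact: maxrankfun_inj.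
- exact: fullrankfun_inj.
rewrite -unitfE -unitmxE -unitmx_tr -row_full_unit.
rewrite (_ : _^T = rowsub (fullrankfun fE) E^T); first exact: fullrowsub_full.
by apply/matrixP => i j; rewrite !mxE.
Qed.

(* Over the fraction field, [D] has rank [r] and its kernel is the column space of
   [V *m D]; Cramer's rule for the minor then clears the denominators. *)
Lemma minor_kernel (R : idomainType) p q r (D : 'M[R]_(p, q)) (V : 'M_(q, p))
    (U : 'M_(p, q)) (u : 'I_r -> 'I_p) (v : 'I_r -> 'I_q) (y : 'cV_q) :
  q = (r + r)%N -> V *m U = 1%:M -> U *m V = 1%:M -> D *m V *m D = 0 ->
  \det (mxsub u v D) != 0 -> D *m y = 0 ->
  exists x : 'cV_q, \det (mxsub u v D) *: y = V *m D *m x.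
Proof.
move=> q2 VU UV DVD h0 Dy0.
have qr : (q - r)%N = r by rewrite q2 addnK.
pose F := {fraction R}.
pose fr := map_mx (@tofrac R : R -> F).
have frM m1 m2 m3 (X : 'M[R]_(m1, m2)) (Y : 'M_(m2, m3)) : fr _ _ (X *m Y) =
  fr _ _ X *m fr _ _ Y.
  exact: map_mxM.
have frI m1 m2 (X Y : 'M[R]_(m1, m2)) : fr _ _ X = fr _ _ Y -> X = Y.
  move=> E; apply/matrixP => i j; have /matrixP/(_ i j) := E; rewrite !mxE => /eqP.
  by rewrite tofrac_eq => /eqP.
pose D1 := colsub v D; pose M0 := mxsub u v D; rewrite -/M0 in h0 *.
have uM0 : fr _ _ M0 \in unitmx.
  by rewrite unitmxE det_map_mx unitfE tofrac_eq0.
have rD1 : \rank (fr _ _ D1)^T = r.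
  rewrite mxrank_tr; apply/eqP; rewrite eqn_leq rank_leq_col /=.
  rewrite -{1}(mxrank_unit uM0) (_ : fr _ _ M0 = rowsub u (fr _ _ D1)).
    by rewrite rowsubE mxrankM_maxr.
  by apply/matrixP => i j; rewrite !mxE.
have sD1 : ((fr _ _ D1)^T <= (fr _ _ D)^T)%MS.
  rewrite (_ : (fr _ _ D1)^T = rowsub v (fr _ _ D)^T); last first.
    by apply/matrixP => i j; rewrite !mxE.
  by rewrite rowsubE submxMl.
(* Since [D = U V D], the product [V D] has at least the rank of [D]; with [D (V D) = 0] this bounds
   twice the rank of [D] by [q = 2r]. *)
have rVD : (\rank (fr _ _ D) <= \rank (fr _ _ (V *m D)))%N.
  by rewrite -[in X in (\rank X <= _)%N](mul1mx D) -UV -mulmxA frM mxrankM_maxr.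
have DVD' : fr _ _ D *m fr _ _ (V *m D) = 0.
  by rewrite -frM mulmxA DVD; apply: map_mx0.
have rD : \rank (fr _ _ D) = r.
  apply/eqP; rewrite eqn_leq -{2}rD1 -[X in _ && (_ <= X)%N]mxrank_tr mxrankS // andbT.
  have := leq_trans (leq_add (leqnn (\rank (fr _ _ D))) rVD) (mulmx0_rank_max DVD').
  by move=> H; rewrite -leq_double -!addnn -q2; apply: H.
have sub1 : ((fr _ _ D)^T <= (fr _ _ D1)^T)%MS.
  have := mxrank_leqif_sup sD1; rewrite rD1 mxrank_tr rD => /leqifP.
  by case: ifP => // _; rewrite ltnn.
have kerVD : (kermx (fr _ _ D)^T <= (fr _ _ (V *m D))^T)%MS.
  have s : ((fr _ _ (V *m D))^T <= kermx (fr _ _ D)^T)%MS.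
    by apply/sub_kermxP; rewrite -trmx_mul DVD' trmx0.
  have := mxrank_leqif_sup s; rewrite mxrank_ker !mxrank_tr rD qr.
  move/leqifP; case: ifP => // _; rewrite ltnNge => /negP[].
  by rewrite -[X in (X <= _)%N]rD.
have [x1 Hx1] : exists x1, fr _ _ (U *m y) = fr _ _ D1 *m x1.
  have : ((fr _ _ y)^T <= (fr _ _ (V *m D))^T)%MS.
    apply: submx_trans kerVD; apply/sub_kermxP.
    by rewrite -trmx_mul -frM Dy0 [fr _ _ 0]map_mx0 trmx0.
  case/submxP => x0 E0.
  have : ((fr _ _ (U *m y))^T <= (fr _ _ D1)^T)%MS.
    apply: submx_trans sub1; apply/submxP; exists x0.
    rewrite frM trmx_mul E0 -mulmxA -trmx_mul -frM mulmxA UV mul1mx.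
    by [].
  case/submxP => x1 E1; exists x1^T; apply: trmx_inj.
  by rewrite trmx_mul trmxK.
(* Over the fraction field [U y = D1 x1]; reading off the rows [u] gives [M0 x1], so the adjugate
   yields [det M0] times [x1] with entries in [R]. *)
pose w := \adj M0 *m rowsub u (U *m y).
have Hw : \det M0 *: (U *m y) = D1 *m w.
  apply: frI; rewrite [RHS]frM [fr _ _ w]frM.
  have -> : fr _ _ (rowsub u (U *m y)) = fr _ _ M0 *m x1.
    rewrite [LHS]map_mxsub -/(fr _ _ _) Hx1; apply/matrixP => i j.
    by rewrite !mxE; apply: eq_bigr => l _; rewrite !mxE.
  rewrite (mulmxA (fr _ _ (\adj M0))) -frM mul_adj_mx [fr _ _ _%:M]map_scalar_mx.
  rewrite mul_scalar_mx -scalemxAr -Hx1; apply/matrixP => i j; rewrite !mxE.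
  exact: tofracM.
exists (colsub v 1%:M *m w).
rewrite -[in LHS](mul1mx y) -VU -mulmxA scalemxAr Hw -mulmxA; congr (_ *m _).
by rewrite [RHS]mulmxA mulmx_colsub VU mulmx1.
Qed.

(** * Noetherian local rings *)

Lemma ideal_gen_is_ideal (P : comNzRingType) (X : set P) : is_ideal (ideal_gen X).
Proof.
have [s0 sP] := span_submod_closed (X : set P^o).
split=> [|x y Hx Hy|a x Hx]; first exact: s0.
  by have := sP 1 x y Hx Hy; rewrite scale1r.
by have := sP a x 0 Hx s0; rewrite addr0.
Qed.

Lemma is_ideal_gen (P : comNzRingType) (J : set P) z : is_ideal J -> ideal_gen J z -> J z.
Proof. by case=> J0 JD JM; apply: ideal_genI. Qed.

Lemma ideal_gen_sub (P : comNzRingType) (X J : set P) : is_ideal J -> X `<=` J ->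
  ideal_gen X `<=` J.
Proof.
move=> [J0 JD JM] XJ z /spanP[p [b [g [Hg ->]]]].
by apply: (big_ind J); [exact: J0 | exact: JD | move=> i _; apply/JM/XJ].
Qed.

(** A nonunit generates a proper ideal, which by Zorn lies in a maximal ideal, necessarily [n]. *)
Lemma local_ring_unit (P : comNzRingType) (n : set P) x : local_ring n -> ~ n x ->
  exists t, t * x = 1.
Proof.
move=> [_ nmax] nx; apply: contrapT => Hx; apply: nx.
pose good (J : set P) := [/\ is_ideal J, ~ J 1 & J x].
have good0 : good (ideal_gen [set x]).
  split; [exact: ideal_gen_is_ideal | | exact: mem_span].
  by case/ideal_gen_set1 => t /esym tx; apply: Hx; exists t.
have [F FP Ftot|M [MP Mmax]] := @Zorn_bigcup P (fun J => J = set0 \/ good J).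
  have [[I0 FI0 [y I0y]]|F0] := pselect (exists2 I, F I & exists y, I y); last first.
    by left; apply/seteqP; split=> // y [I FI Iy]; apply: F0; exists I => //; exists y.
  have gF I z : F I -> I z -> good I by move=> /FP[->|].
  right; split.
  - split.
    + by exists I0 => //; have [[]] := gF _ _ FI0 I0y.
    + move=> u v [I FI Iu] [J FJ Jv]; have [IJ|JI] := Ftot _ _ FI FJ.
        by exists J => //; have [[_ JD _] _ _] := gF _ _ FJ Jv; apply: JD => //; apply: IJ.
      by exists I => //; have [[_ ID _] _ _] := gF _ _ FI Iu; apply: ID => //; apply: JI.
    move=> a u [I FI Iu]; exists I => //.
    by have [[_ _ IM] _ _] := gF _ _ FI Iu; apply: IM.
  - by case=> I FI I1; have [_] := gF _ _ FI I1.
  by exists I0 => //; have [] := gF _ _ FI0 I0y.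
have [Mi M1 Mx] : good M.
  case: MP => // M0; case: (Mmax (ideal_gen [set x])); last by right.
  rewrite M0; split=> // /(_ x); apply; exact: mem_span.
have <- // : M = n.
apply: nmax; split=> // J Ji J1 MJ; apply: contrapT => JM.
case: (Mmax J); last by right; split=> //; apply: MJ.
by split=> // JM'; apply: JM; apply/seteqP.
Qed.

Lemma noetherian_fg (P : comNzRingType) (X : set P) (I : quot_ring X -> Prop) :
  noetherian P -> I 0 -> (forall u v, I u -> I v -> I (u + v)) ->
  (forall u v, I v -> I (u * v)) ->
  exists p (g : 'I_p -> (quot_ring X)^o), fg_sub (I : (quot_ring X)^o -> Prop) g.
Proof.
move=> noeth I0 ID IM; have [|p [g E]] := noeth (fun y => I (quot_map X y)).
  split=> [|x y Ix Iy|a x Ix]; first by rewrite rmorph0.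
    by rewrite rmorphD; apply: ID.
  by rewrite rmorphM; apply: IM.
exists p, (fun i => quot_map X (g i)); split=> [i|v Iv].
  have : ideal_gen (range g) (g i) by apply: mem_span; exists i.
  by rewrite -E.
have : I (quot_map X (repr v)) by rewrite quot_mapK.
rewrite -[I _]/((fun y => I (quot_map X y)) _) E => /spanP[q [b [h [Hh Ev]]]].
have /choice[s Hs] : forall i, exists j, h i = g j by move=> i; have [j _ <-] := Hh i;
  exists j.
exists (fun j => quot_map X (\sum_(i | s i == j) b i)).
rewrite -[LHS]quot_mapK Ev rmorph_sum (partition_big s xpredT) //=.
apply: eq_bigr => j _; rewrite rmorph_sum scaler_suml; apply: eq_bigr => i /eqP <-.
by rewrite Hs; apply: rmorphM.
Qed.

Section LocalNoetherian.
Variables (P : comNzRingType) (n : set P).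
Hypotheses (noeth : noetherian P) (loc : local_ring n).

Lemma local_is_ideal : is_ideal n. Proof. by case: loc => -[]. Qed.
Lemma local_proper : ~ n 1. Proof. by case: loc => -[]. Qed.

(** In [P/J] the image of [K] equals [y] times itself. For a minimal generating family, writing
    [g_0] as [y] times a combination is a relation with coefficient [1 - y a_0] at [g_0], which must
    lie in [n], so [1] would too. *)
Lemma nakayama_mul (J K : set P) y : is_ideal J -> is_ideal K -> n y ->
  (forall v, K v -> exists2 v', K v' & J (v - y * v')) -> K `<=` J.
Proof.
move=> Ji Ki ny H; have [n0 nD nM] := local_is_ideal.
pose E := @quot_mod P P^o J.
pose pr : {linear P^o -> E} := @quot_proj P P^o J.
have prE v : pr v = 0 -> J v.
  rewrite -(linear0 pr) => /quot_proj_eq; rewrite subr0.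
  exact: is_ideal_gen.
have pr0 v : J v -> pr v = 0.
  move=> Jv; rewrite -(linear0 pr); apply/quot_proj_eq; rewrite subr0.
  exact: mem_span.
have [p [g [[Kg gK] gmin]]] : exists p (g : 'I_p -> E),
    fg_sub (fun e => exists2 v, K v & e = pr v) g /\
    forall a : 'I_p -> P, \sum_i a i *: g i = 0 -> forall i, n (a i).
  apply: min_gens; first by move=> s; apply: local_ring_unit.
  have [p [g Eg]] := noeth Ki.
  exists p, (fun i => pr (g i)); split=> [i|_ [v Kv ->]].
    exists (g i) => //; rewrite Eg; apply: mem_span; by exists i.
  move: Kv; rewrite Eg => /spanP[q [b [h [Hh ->]]]].
  have /choice[s Hs] : forall i, exists j, h i = g j by move=> i; have [j _ <-] := Hh i;
    exists j.
  exists (fun j => \sum_(i | s i == j) b i).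
  rewrite linear_sum (partition_big s xpredT) //=.
  apply: eq_bigr => j _; rewrite scaler_suml; apply: eq_bigr => i /eqP <-.
  by rewrite linearZ_LR Hs.
case: p g Kg gK gmin => [|p] g Kg gK gmin v Kv.
  apply: prE; have [a ->] := gK (pr v) (ex_intro2 _ _ v Kv erefl).
  by rewrite big_ord0.
case: local_proper; have [w Kw Ew] := Kg ord0; have [w' Kw' Jw] := H w Kw.
have [a Ea] := gK (pr w') (ex_intro2 _ _ w' Kw' erefl).
have := gmin (fun i => (i == ord0)%:R - y * a i) _ ord0.
rewrite eqxx => H1; rewrite -(subrK (y * a ord0) 1); apply: nD.
  apply: H1; under eq_bigr do rewrite scalerBl -scalerA.
  rewrite sumrB -scaler_sumr -Ea (bigD1 ord0) //= big1 ?addr0.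
    rewrite scale1r Ew -linearZ_LR -raddfB; exact: pr0.
  by move=> i /negPf->; rewrite scale0r.
by rewrite mulrC; apply: nM.
Qed.

Variables (c : nat) (f : 'I_c -> P).
Hypotheses (fn : forall i, n (f i)) (freg : regular_sequence f).

(** With [J_l = (f_0, ..., f_(l-1))], the sum [g] is a unit times [f_(i0)] modulo [J_(i0)], hence a
    nonzerodivisor there. This property descends from [J_(l+1)] to [J_l] by Nakayama and ends at
    [J_0 = 0]; no actual permutation of the sequence is made. *)
Lemma regular_sequence_combination (u : 'I_c -> P) (i0 : 'I_c) :
  (exists t, t * u i0 = 1) -> (forall j : 'I_c, (i0 < j)%N -> u j = 0) ->
  non_zero_divisor (\sum_j u j * f j).
Proof.
move=> [t tu] u0; set g := \sum_j _.
pose J l := ideal_gen (f @` [set j : 'I_c | (j < l)%N]).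
have Ji l : is_ideal (J l) by apply: ideal_gen_is_ideal.
have Jf l (j : 'I_c) : (j < l)%N -> J l (f j) by move=> jl; apply: mem_span; exists j.
have JS (l : 'I_c) v : J l.+1 v -> exists v', J l (v - f l * v').
  have [J0 JD JM] := Ji l.
  case/spanP => p [b [h [Hh ->]]]; apply: (big_ind (fun v => exists v', J l (v - f l * v'))).
  - by exists 0; rewrite mulr0 subr0.
  - move=> x y [x' Hx] [y' Hy]; exists (x' + y').
    by rewrite mulrDr opprD addrACA; apply: JD.
  move=> i _; have [j /= jl <-] := Hh i; move: jl;
    rewrite ltnS leq_eqVlt => /orP[/eqP/val_inj ->|jl].
    by exists (b i); rewrite [b i *: _]/(b i * f l) mulrC subrr.
  by exists 0; rewrite mulr0 subr0; apply: JM; apply: Jf.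
suff H l : (l <= i0)%N -> forall v, J (i0 - l)%N (g * v) -> J (i0 - l)%N v.
  move=> v gv; have := H i0 (leqnn _) v; rewrite subnn gv => /(_ _)/spanP[|p [b [h [Hh ->]]]].
    by case: (Ji 0%N).
  by apply: big1 => i _; have [] := Hh i.
elim: l => [|l IH] li v.
  rewrite subn0; have [J0 JD JM] := Ji i0 => gv.
  rewrite -[v]mul1r -tu -mulrA; apply/JM; apply: freg.1.
  have JN x : J i0 x -> J i0 (- x) by rewrite -mulN1r; apply: JM.
  have -> : u i0 * v * f i0 = g * v - \sum_(j | j != i0) u j * f j * v.
    by rewrite /g (bigD1 i0) //= mulrDl mulr_suml addrK mulrAC.
  rewrite -/(J i0); apply/JD; first by [].
  apply/JN; apply: (big_ind (J i0)); [exact: J0 | exact: JD | move=> j ji].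
  case: (ltngtP j i0) => [jl|/u0->|/val_inj E].
  - by rewrite mulrAC; apply/JM; apply: Jf.
  - by rewrite !mul0r.
  by rewrite E eqxx in ji.
set L := (i0 - l.+1)%N; have LS : L.+1 = (i0 - l)%N by rewrite /L subnSK.
have Lc : (L < c)%N by apply: leq_ltn_trans (ltn_ord i0); apply: leq_subr.
have [J0 JD JM] := Ji L.
have sub : J L `<=` J L.+1.
  apply: ideal_gen_sub => // _ [j /= jL <-]; apply: Jf; exact: ltnW.
(* For [K] the ideal quotient of [J_L] by [g]: an element of [K] lies in [J_(L+1)], so it is
   [f_L w'] modulo [J_L], and cancelling [f_L] puts [w'] back into [K]. *)
apply: (@nakayama_mul (J L) (fun v => J L (g * v)) (f (Ordinal Lc))) => //.
  split=> [|x y Hx Hy|a x Hx]; first by rewrite mulr0.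
    by rewrite mulrDr; apply: JD.
  by rewrite mulrCA; apply: JM.
move=> w Jw.
have /(JS (Ordinal Lc))[w' Hw'] : J L.+1 w.
  by rewrite LS; apply: IH; [apply: ltnW | rewrite -LS; apply: sub].
exists w' => //; apply: (freg.1 (Ordinal Lc)); rewrite -/(J L) /=.
have JN x : J L x -> J L (- x) by rewrite -mulN1r; apply: JM.
have -> : g * w' * f (Ordinal Lc) = g * w - g * (w - f (Ordinal Lc) * w').
  by rewrite mulrBr subKr mulrAC mulrA.
by apply/JD => //; apply/JN/JM.
Qed.

End LocalNoetherian.

(** * Finite bases, matrices of endomorphisms, change of coordinates *)

Section OrdinalBases.
Variables (S : pzRingType) (F : lmodType S) (q : nat) (b : 'I_q -> F).

Lemma basis_ord : is_basis b ->
  (forall x, exists y : 'cV[S]_q, x = \sum_j y j 0 *: b j) /\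
  (forall y : 'cV[S]_q, \sum_j y j 0 *: b j = 0 -> y = 0).
Proof.
case=> bspan bfree; split=> [x|y y0].
  have /spanP[p [a [g [Hg ->]]]] := bspan x.
  have /choice[s Hs] : forall i, exists j, g i = b j by move=> i; have [j _ <-] := Hg i;
    exists j.
  exists (\col_j \sum_(i | s i == j) a i).
  rewrite (partition_big s xpredT) //=; apply: eq_bigr => j _.
  rewrite mxE scaler_suml; apply: eq_bigr => i /eqP <-.
  by rewrite Hs.
apply/matrixP => j i; rewrite ord1 mxE.
exact: (bfree q id (fun j => y j 0) (@inj_id _) y0 j).
Qed.

Lemma ord_basis : (forall x, exists y : 'cV[S]_q, x = \sum_j y j 0 *: b j) ->
  (forall y : 'cV[S]_q, \sum_j y j 0 *: b j = 0 -> y = 0) -> is_basis b.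
Proof.
move=> bspan bfree; split=> [x|p u a inju a0 i].
  have [y ->] := bspan x; apply/spanP; exists q, (fun j => y j 0), b.
  by split=> // j; exists j.
have /matrixP/(_ (u i) 0) : \col_j (\sum_(l | u l == j) a l) = 0.
  apply: bfree; rewrite -[RHS]a0 [RHS](partition_big u xpredT) //=.
  apply: eq_bigr => j _; rewrite mxE scaler_suml.
  by apply: eq_bigr => l /eqP <-.
rewrite !mxE (bigD1 i) //= big1 ?addr0 // => l /andP[/eqP/inju->].
by rewrite eqxx.
Qed.

End OrdinalBases.

Lemma sum_mulmx_basis (S : comPzRingType) (F F' : lmodType S) p q (e : 'I_q ->
  F) (e' : 'I_p -> F')
    (D : 'M[S]_(p, q)) (g : {linear F -> F'}) (y : 'cV_q) :
  represents g e e' D -> g (\sum_j y j 0 *: e j) = \sum_i (D *m y) i 0 *: e' i.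
Proof.
move=> HD; rewrite linear_sum; under eq_bigr do rewrite linearZ_LR HD scaler_sumr.
rewrite exchange_big; apply: eq_bigr => i _; rewrite mxE scaler_suml.
by apply: eq_bigr => j _; rewrite scalerA mulrC.
Qed.

Lemma endo_represented (S : pzRingType) (F : lmodType S) q (e : 'I_q ->
  F) (g : {linear F -> F}) :
  is_basis e -> exists D : 'M[S]_q, represents g e e D.
Proof.
move=> /basis_ord[es _]; have /choice[y Hy] := fun j => es (g (e j)).
exists (\matrix_(i, j) y j i 0) => j; rewrite Hy.
by apply: eq_bigr => i _; rewrite mxE.
Qed.

Lemma sum_basis_inj (S : pzRingType) (F : lmodType S) q (e : 'I_q -> F) (y y' : 'cV[S]_q) :
  is_basis e -> \sum_j y j 0 *: e j = \sum_j y' j 0 *: e j -> y = y'.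
Proof.
move=> /basis_ord[_ ef] E; apply/eqP; rewrite -subr_eq0; apply/eqP; apply: ef.
rewrite -[RHS](subrr (\sum_j y' j 0 *: e j)) -{1}E -sumrB.
by apply: eq_bigr => j _; rewrite !mxE scalerBl.
Qed.

Lemma represents_square0 (S : comPzRingType) (F : lmodType S) q (e : 'I_q -> F)
    (D : 'M[S]_q) (g : {linear F -> F}) :
  is_basis e -> represents g e e D -> (forall w, g (g w) = 0) -> D *m D = 0.
Proof.
move=> be HD gg; apply/matrixP => i j; have : D *m D *m (delta_mx j 0 : 'cV_q) = 0.
  apply: (sum_basis_inj be); rewrite -mulmxA -!(sum_mulmx_basis _ HD) gg.
  by apply/esym/big1 => l _; rewrite mxE scale0r.
by rewrite -colE => /matrixP/(_ i 0); rewrite !mxE.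
Qed.

Lemma change_of_basis (S : comPzRingType) (F : lmodType S) p q (e : 'I_q ->
  F) (e' : 'I_p -> F) :
  is_basis e -> is_basis e' -> exists (V : 'M[S]_(q, p)) (U : 'M[S]_(p, q)),
    [/\ V *m U = 1%:M, U *m V = 1%:M &
        forall y : 'cV_p, \sum_j y j 0 *: e' j = \sum_i (V *m y) i 0 *: e i].
Proof.
move=> be be'.
have ex q1 q2 (e1 : 'I_q1 -> F) (e2 : 'I_q2 -> F) : is_basis e1 ->
    exists V : 'M[S]_(q1, q2), represents idfun e2 e1 V.
  move=> /basis_ord[es _]; have /choice[v Hv] := fun j => es (e2 j).
  exists (\matrix_(i, j) v j i 0) => j; rewrite [LHS]/= [LHS]Hv.
  by apply: eq_bigr => i _; rewrite mxE.
have id1 q1 q2 (e1 : 'I_q1 -> F) (e2 : 'I_q2 -> F) V U : is_basis e1 ->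
    represents idfun e2 e1 V -> represents idfun e1 e2 U -> V *m U = 1%:M.
  move=> b1 HV HU; apply/matrixP => i j.
  have : V *m U *m (delta_mx j 0 : 'cV_q1) = delta_mx j 0.
    apply: (sum_basis_inj b1); rewrite -mulmxA -(sum_mulmx_basis _ HV).
    by rewrite -(sum_mulmx_basis _ HU).
  by rewrite -colE => /matrixP/(_ i 0); rewrite !mxE andbT.
have [V HV] := ex _ _ e e' be; have [U HU] := ex _ _ e' e be'.
exists V, U; split; [exact: id1 HV HU | exact: id1 HU HV|] => y.
by rewrite -(sum_mulmx_basis y HV).
Qed.

Lemma basis_size (S : comNzRingType) (F : lmodType S) p q (e : 'I_q -> F) (e' : 'I_p -> F) :
  is_basis e -> is_basis e' -> p = q.
Proof.
move=> be be'; have [V [U [VU UV _]]] := change_of_basis be be'.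
by apply/eqP; rewrite eqn_leq (mulmx1_min UV) (mulmx1_min VU).
Qed.

(** [det_ideal] allows different bases of source and target; [V] turns [D] into the square-zero
    matrix [V D] of the endomorphism in the single basis [e]. The basis [e0] fixes the rank as
    [2r]. *)
Lemma minor_exact (R : idomainType) (W : lmodType R) (C : {linear W -> W}) r q0
    (e0 : 'I_q0 -> W) p q (e : 'I_q -> W) (e' : 'I_p -> W) (D : 'M[R]_(p, q))
    (u : 'I_r -> 'I_p) (v : 'I_r -> 'I_q) :
  q0 = (r + r)%N -> is_basis e0 -> is_basis e -> is_basis e' -> represents C e e' D ->
  (forall w, C (C w) = 0) -> \det (mxsub u v D) != 0 ->
  forall w, C w = 0 -> exists w', \det (mxsub u v D) *: w = C w'.
Proof.
move=> q0r b0 be be' HD CC h0 w w0.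
have [V [U [VU UV HV]]] := change_of_basis be be'.
have [es _] := basis_ord be; have [y Ey] := es w.
have qr : q = (r + r)%N by rewrite -q0r; exact: (basis_size b0 be).
have CE (z : 'cV_q) : C (\sum_j z j 0 *: e j) = \sum_i (V *m D *m z) i 0 *: e i.
  by rewrite (sum_mulmx_basis _ HD) HV mulmxA.
have VDVD : V *m D *m (V *m D) = 0.
  apply/matrixP => i j; have : V *m D *m (V *m D) *m (delta_mx j 0 : 'cV_q) = 0.
    apply: (sum_basis_inj be); rewrite -mulmxA -!CE CC.
    by apply/esym/big1 => l _; rewrite mxE scale0r.
  by rewrite -colE => /matrixP/(_ i 0); rewrite !mxE.
have [||x Hx] := @minor_kernel R p q r D V U u v y qr VU UV _ h0.
- by rewrite -[LHS]mul1mx -UV -!mulmxA (mulmxA V D) VDVD mulmx0.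
- rewrite -[LHS]mul1mx -UV -!mulmxA (mulmxA V D) (_ : V *m D *m y = 0) ?mulmx0 //.
  apply: (sum_basis_inj be); rewrite -CE -Ey w0.
  by apply/esym/big1 => l _; rewrite mxE scale0r.
exists (\sum_j x j 0 *: e j); rewrite CE -Hx Ey scaler_sumr.
by apply: eq_bigr => j _; rewrite mxE scalerA.
Qed.

Lemma exact_rank (k : fieldType) (V : lmodType k) (g : {linear V -> V}) q (e : 'I_q -> V)
    (D : 'M[k]_q) :
  is_basis e -> represents g e e D -> D *m D = 0 ->
  (forall z, g z = 0 -> exists z', z = g z') -> (\rank D + \rank D)%N = q.
Proof.
move=> be HD DD ex; apply/eqP; rewrite eqn_leq (mulmx0_rank_max DD) /=.
have : (kermx D^T <= D^T)%MS.
  apply/row_subP => i; set y := (row i (kermx D^T))^T.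
  have Dy : D *m y = 0.
    by apply: trmx_inj; rewrite trmx_mul trmxK -row_mul mulmx_ker row0 trmx0.
  have [|z Hz] := ex (\sum_j y j 0 *: e j).
    by rewrite (sum_mulmx_basis _ HD) Dy big1 // => l _; rewrite mxE scale0r.
  have [es _] := basis_ord be; have [y' Ey'] := es z.
  have yE : y = D *m y'.
    by apply: (sum_basis_inj be); rewrite Hz Ey' (sum_mulmx_basis _ HD).
  by rewrite -[row i _]trmxK -/y yE trmx_mul submxMl.
by move/mxrankS; rewrite mxrank_ker mxrank_tr leq_subLR.
Qed.

(** * Evaluation of polynomials, and bases over [k[s]] *)

Lemma meval_map_mpoly (A : comNzRingType) (B : comNzRingType) (phi : {rmorphism A -> B})
    (Y : comPzRingType) (psi : {rmorphism B -> Y}) c (b : 'I_c -> B) (p : {mpoly A[c]}) :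
  psi (map_mpoly phi p).@[b] =
  \sum_(m <- msupp p) psi (phi p@_m) * \prod_(i < c) psi (b i) ^+ m i.
Proof.
rewrite {1}[p]mpolyE (raddf_sum (map_mpoly phi)) (raddf_sum (meval b)) (rmorph_sum psi);
  apply: eq_bigr => m _ /=.
rewrite map_mpolyZ map_mpolyX mevalZ mevalX rmorphM rmorph_prod; congr (_ * _).
by apply: eq_bigr => i _; rewrite rmorphXn.
Qed.

Lemma meval_map_morph (A B : comNzRingType) (phi : {rmorphism A -> B}) c (b : 'I_c -> A)
    (p : {mpoly A[c]}) :
  (map_mpoly phi p).@[fun i => phi (b i)] = phi p.@[b].
Proof.
rewrite -[LHS]/(idfun _) (meval_map_mpoly _ (@idfun B)) [in RHS]mevalE (rmorph_sum phi).
apply: eq_bigr => m _; rewrite rmorphM rmorph_prod; congr (_ * _).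
by apply: eq_bigr => i _; rewrite rmorphXn.
Qed.

Lemma meval_map_cong (A B : comNzRingType) (phi : {rmorphism A -> B}) (n : set B) c
    (a : 'I_c -> A) (b : 'I_c -> B) (p : {mpoly A[c]}) : is_ideal n ->
  (forall i, n (b i - phi (a i))) -> n ((map_mpoly phi p).@[b] - phi p.@[a]).
Proof.
move=> nI Hb; apply: (is_ideal_gen nI); apply/quot_map_eq0P.
rewrite rmorphB -meval_map_morph.
rewrite (meval_map_mpoly phi (quot_map n)) (meval_map_mpoly phi (quot_map n)).
apply/eqP; rewrite subr_eq0; apply/eqP; apply: eq_bigr => m _; congr (_ * _).
apply: eq_bigr => i _; congr (_ ^+ _); apply/eqP; rewrite -subr_eq0 -rmorphB.
by apply/eqP/quot_map_eq0; apply: mem_span.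
Qed.

Definition ffun_basis (A B : pzRingType) (phi : {rmorphism A -> B}) (X : lmodType B)
    m (b : 'I_m -> X) r (t : 'I_#|{: 'I_r * 'I_m}|) : restrict phi {ffun 'I_r -> X} :=
  [ffun i => if i == (enum_val t).1 then b (enum_val t).2 else 0].

Lemma ffun_basisP (A B : pzRingType) (phi : {rmorphism A -> B}) (X : lmodType B)
    m (b : 'I_m -> X) r : is_basis (b : 'I_m -> restrict phi X) ->
  is_basis (ffun_basis phi b (r := r)).
Proof.
move=> bb; have [bs bf] := basis_ord bb.
set e := ffun_basis _ _ (r := r).
have sumE (y : 'cV[A]_#|{: 'I_r * 'I_m}|) i :
    (\sum_t y t 0 *: e t : restrict phi {ffun 'I_r -> X}) i =
    \sum_l phi (y (enum_rank (i, l)) 0) *: b l.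
  transitivity (\sum_t (if i == (enum_val t).1 then
      phi (y t 0) *: b (enum_val t).2 else 0)).
    rewrite (_ : (\sum_t y t 0 *: e t : restrict phi {ffun 'I_r -> X}) =
        \sum_t phi (y t 0) *: (e t : {ffun 'I_r -> X})) //.
    rewrite sum_ffunE; apply: eq_bigr => t _; rewrite !ffunE.
    by case: ifP => //; rewrite scaler0.
  rewrite -big_mkcond (reindex (fun l => enum_rank (i, l))) /=.
    by apply: eq_big => l; rewrite enum_rankK //= eqxx.
  exists (fun t => (enum_val t).2) => [l _|t]; first by rewrite enum_rankK.
  by rewrite inE => /eqP->; rewrite -surjective_pairing enum_valK.
apply: ord_basis => [w|y y0].
  have /choice[y Hy] : forall i, exists y : 'cV[A]_m, (w i : X) = \sum_l phi (y l 0) *: b l.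
    by move=> i; have [y Ey] := bs (w i); exists y.
  exists (\col_t y (enum_val t).1 (enum_val t).2 0); apply/ffunP => i.
  rewrite sumE Hy; apply: eq_bigr => l _; by rewrite mxE enum_rankK.
apply/matrixP => t z; rewrite ord1 mxE -[t]enum_valK; case: (enum_val t) => i l.
have : \col_l y (enum_rank (i, l)) 0 = 0.
  apply: bf; have /ffunP/(_ i) := y0; rewrite sumE ffunE => E; rewrite -[RHS]E.
  by apply: eq_bigr => l' _; rewrite mxE.
by move/matrixP/(_ l 0); rewrite !mxE.
Qed.

Lemma translate_id (P : comNzRingType) c (p : {mpoly P[c]}) : translate (fun=> 0) p = p.
Proof.
rewrite -[RHS]comp_mpoly_id /translate; congr (comp_mpoly _ _).
by apply: eq_from_tnth => i; rewrite !tnth_mktuple mpolyC0 addr0.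
Qed.

Section Specialization.
Variables (P : comNzRingType) (k : fieldType) (iota : {rmorphism k -> P}).
Variables (c : nat) (f : 'I_c -> P) (M : lmodType (ci_ring f)) (m : nat).
Variable e : 'I_m -> restrict (k_to_ci_ring f iota) M.
Hypothesis be : is_basis e.
Local Notation Ms := (poly_module M).
Local Notation coefQ := (coef_to_Qt f iota).

Lemma scalar_span (v : as_P_module M) : exists y : 'I_m -> k,
  v = \sum_l iota (y l) *: (e l : as_P_module M).
Proof. by have [es _] := basis_ord be; have [y ->] := es v; exists (fun l => y l 0). Qed.

Definition tensor_basis (l : 'I_m) : Ms := tensor (@mpolyC c P) (e l : as_P_module M).

(** Independence is read off from ordinary coefficients, the case [a = 0] of [bcoef]: each exponent
    gives a [k]-linear relation among the [e l]. *)
Lemma poly_module_basis : is_basis (tensor_basis : 'I_m -> restrict coefQ Ms).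
Proof.
apply: ord_basis => [v|y y0].
  pose Q (v : Ms) := exists y : 'I_m -> {mpoly k[c]}, v =
    \sum_l coefQ (y l) *: tensor_basis l.
  suff [y ->] : Q v by exists (\col_l y l); apply: eq_bigr => l _; rewrite mxE.
  have Q0 : Q 0 by exists (fun=> 0); rewrite big1 // => l _; rewrite rmorph0 scale0r.
  have QD u w : Q u -> Q w -> Q (u + w).
    move=> [y ->] [y' ->]; exists (fun l => y l + y' l); rewrite -big_split.
    by apply: eq_bigr => l _; rewrite rmorphD scalerDl.
  have [s ->] := base_change_gen (v : poly_module_P M).
  apply: (big_ind Q) => // z _; rewrite {1}[z.1]mpolyE scaler_suml.
  apply: (big_ind Q) => // mm _; rewrite -mul_mpolyC mulrC -scalerA -tensorZ.
  have [y ->] := scalar_span (z.1@_mm *: z.2).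
  exists (fun l => y l *: 'X_[mm]).
  rewrite (big_morph _ (tensorD (@mpolyC c P) (N :=
    as_P_module M)) (tensor0 _ _)) scaler_sumr.
  apply: eq_bigr => l _; rewrite tensorZ scalerA.
  rewrite [RHS]poly_moduleZ /= map_mpolyZ map_mpolyX -mul_mpolyC.
  by rewrite [X in _ = X *: _]mulrC.
have H mm : \col_l (y l 0)@_mm = 0.
  have [_ ef] := basis_ord be; apply: ef.
  have := congr1 (bcoef (fun=> 0) mm) (y0 : \sum_l coefQ (y l 0) *: tensor_basis l =
    0 :> poly_module_P M).
  rewrite raddf0 => E; rewrite -[RHS]E [RHS]raddf_sum; apply: eq_bigr => l _.
  rewrite mxE poly_moduleZ bcoefE translate_id mcoeff_map_mpoly.
  by [].
apply/matrixP => l i; rewrite ord1 [RHS]mxE; apply/mpolyP => mm.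
by have /matrixP/(_ l 0) := H mm; rewrite !mxE mcoeff0.
Qed.

End Specialization.

(** * The periodic tail and projective dimension *)

Lemma inJ_cV (T : comPzRingType) (x : nat -> T) j q (y : 'cV[T]_q) :
  inJ x j y <-> forall i, inJ x j (y i 0 : T^o).
Proof.
elim: j y => [|j IH] y /=.
  split=> [-> i|H]; first by rewrite mxE.
  by apply/matrixP => i l; rewrite ord1 mxE; apply: H.
split=> [[u /IH Hu] i|H].
  by exists (u i 0); have := Hu i; rewrite !mxE.
have [u Hu] := choice H.
exists (\col_i u i); apply/IH => i; rewrite !mxE; exact: Hu.
Qed.

Lemma ffunBE (I : finType) (E : zmodType) (u v : {ffun I -> E}) i : (u - v) i = u i - v i.
Proof. by rewrite !ffunE. Qed.

Lemma cV_action_exact (S : comPzRingType) p q r (A : 'M[S]_(p, q)) (B : 'M_(q, r)) :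
  (forall y : 'cV_q, A *m y = 0 -> exists u, y = B *m u) -> action_exact S^o A B.
Proof.
move=> ex z z0; have [|u Hu] := ex (\col_i z i).
  apply/matrixP => i j; have /ffunP/(_ i) := z0; rewrite !ffunE !mxE => E.
  by rewrite -[RHS]E; apply: eq_bigr => l _; rewrite mxE.
exists [ffun i => u i 0]; apply/ffunP => i; have /matrixP/(_ i 0) := Hu.
by rewrite !mxE ffunE => ->; apply: eq_bigr => l _; rewrite ffunE.
Qed.

(** Quotient rings carry no built-in [1 <> 0], which the free modules covering projectives
    require. *)
Lemma pd_action_exact_pz (S : comPzRingType) (M : lmodType S) N (A B : 'M[S]_N) t :
  (1 : S) != 0 ->
  A *m B = 0 -> B *m A = 0 -> action_exact S^o A B -> action_exact S^o B A ->
  proj_dim_le M t -> action_exact M A B.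
Proof.
move=> S1; pose S' : comNzRingType :=
  HB.pack (GRing.ComPzRing.sort S) (GRing.PzSemiRing_isNonZero.Build S S1).
exact: (@pd_action_exact S' M).
Qed.

Section PeriodicTail.
Variables (P : comNzRingType) (n : set P) (d c N : nat) (f : 'I_c -> P).
Hypotheses (noeth : noetherian P) (loc : local_ring n) (fn : forall i, n (f i)).
Variables (A B : 'M[generic_hypersurface f]_N).
Variables (G : nat -> lmodType (generic_hypersurface f))
  (del : forall i, {linear G i.+1 -> G i}) (eps : {linear G 0%N -> residue_module f n}).
Hypothesis HG : periodic_free_resolution d A B del eps.
Local Notation Qt := (generic_hypersurface f).

Let nI : is_ideal n := local_is_ideal loc.

Lemma periodic_complex : A *m B = 0 /\ B *m A = 0.
Proof.
case: HG => [[_ _ ei] _ [th [bth thE]]].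
have dd i z : del i (del i.+1 z) = 0.
  have : range (del i.+1) (del i.+1 z) by exists z.
  by rewrite ei.
have H j : (if odd j then B else A) *m (if odd j.+1 then B else A) = 0.
  apply/matrixP => i l; have [inv _ thK] := bth j.+2.
  have := thE j (del (j.+1 + d)%N (inv (delta_mx l 0))).
  rewrite dd linear0 thE thK mulmxA -colE => /matrixP/(_ i 0).
  by rewrite !mxE => <-.
by split; [apply: (H 0%N) | apply: (H 1%N)].
Qed.

Variable a : 'I_c -> P.
Hypothesis nzd : non_zero_divisor (\sum_i a i * f i).
Local Notation S := (quot_ring [set \sum_i a i * f i]).
Local Notation sp := (specialize (f := f) a).
Local Notation xQ := (shiftedQ f a).
Local Notation AS := (map_mx sp A).
Local Notation BS := (map_mx sp B).

Let f'n : n (\sum_i a i * f i).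
Proof.
case: nI => n0 nD nM.
by apply: (big_ind n); [exact: n0 | exact: nD | move=> i _; apply/nM].
Qed.

Lemma quot_nonzero : (1 : S) != 0.
Proof.
apply/eqP; rewrite -(rmorph1 (quot_map _)) => /quot_map_eq0P/ideal_gen_set1[u E].
by case: nI => _ _ nM; apply: (local_proper loc); rewrite E; apply: nM.
Qed.

Lemma reduced_exact :
  (forall z, inJ xQ c (eps z) -> exists v, inJ xQ c (z - del 0%N v)) /\
  (forall i z, inJ xQ c (del i z) -> exists v, inJ xQ c (z - del i.+1 v)).
Proof.
case: HG => res free _; apply: (koszul_resolution res) => [j y|i j y].
  exact: residue_regular.
by apply: free_regular (free i) _ y => q; apply: Qt_regular.
Qed.

Lemma map_specialize_inJ q (y : 'cV[Qt]_q) : map_mx sp y = 0 <-> inJ xQ c y.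
Proof.
rewrite inJ_cV; split=> [/matrixP y0 i|H].
  by apply/specialize_eq0; have := y0 i 0; rewrite !mxE.
by apply/matrixP => i j; rewrite !mxE ord1; apply/specialize_eq0.
Qed.

(** The maps [ev j] identify [G_(j+d)] modulo [(x)] with [S^N], and the differentials with the
    specialized matrices, without forming the quotient. *)
Lemma tail_coordinates : exists ev : forall j, G (j + d)%N -> 'cV[S]_N,
  [/\ forall j, additive (ev j),
      forall j q g, ev j (q *: g) = sp q *: ev j g,
      forall j y, exists g, ev j g = y,
      forall j g, ev j g = 0 -> inJ xQ c g
    & forall j g, ev j (del (j + d)%N g) = (if odd j then BS else AS) *m ev j.+1 g].
Proof.
case: HG => _ _ [th [bth thE]].
exists (fun j g => map_mx sp (th j g)); split.
- by move=> j u v; rewrite linearB map_mxB.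
- by move=> j q g; rewrite linearZ map_mxZ.
- move=> j y; have [inv _ thK] := bth j.
  exists (inv (map_mx (@unspecialize _ _ f a) y)); rewrite thK.
  by apply/matrixP => i l; rewrite !mxE unspecializeK.
- move=> j g /map_specialize_inJ H.
  have [inv thI thK] := bth j.
  have [||r r0 Hr] := @inJ_semilinear_lift _ _ id _ _ (th j)
     (fun t u => linearZ_LR (th j) t u) xQ xQ c g _ _ H => //.
    by move=> y; exists (inv y); apply: thK.
  by rewrite -[g]subr0 -(can_inj thI (etrans r0 (esym (linear0 (th j))))).
by move=> j g; rewrite thE; case: (odd j); rewrite map_mxM.
Qed.

Lemma reduced_tail_exact : action_exact S^o AS BS /\ action_exact S^o BS AS.
Proof.
have [ev [evB evZ evS evK evD]] := tail_coordinates.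
have H j : action_exact S^o (if odd j then BS else AS) (if odd j.+1 then BS else AS).
  apply: cV_action_exact => y y0; have [g gy] := evS j.+1 y.
  have /evK : ev j (del (j + d)%N g) = 0 by rewrite evD gy.
  case/(reduced_exact.2 (j + d)%N) => v Hv; exists (ev j.+2 v).
  apply/eqP; rewrite -subr_eq0 -gy -[_ *m _](evD j.+1) -evB; apply/eqP.
  pose evA : {additive G (j.+1 + d)%N -> 'cV[S]_N} :=
    HB.pack (ev j.+1) (GRing.isZmodMorphism.Build _ _ (ev j.+1) (evB j.+1)).
  have := @inJ_semilinear _ _ sp _ _ evA (evZ j.+1)
    xQ (fun=> 0) c _ (fun i _ => esym (specialize_shiftedQ f a i)) Hv.
  by case/inJ_sigma => u Eu; rewrite [LHS]Eu; apply: big1 => i _; rewrite scale0r.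
by split; [apply: (H 0%N) | apply: (H 1%N)].
Qed.

Lemma pd_tail_exact (M : lmodType S) t :
  proj_dim_le M t -> action_exact M AS BS /\ action_exact M BS AS.
Proof.
have [AB BA] := periodic_complex; have [exA exB] := reduced_tail_exact.
have AB' : AS *m BS = 0 by rewrite -map_mxM AB map_mx0.
have BA' : BS *m AS = 0 by rewrite -map_mxM BA map_mx0.
move=> pd; split; first exact: (pd_action_exact_pz quot_nonzero AB' BA' exA exB pd).
exact: (pd_action_exact_pz quot_nonzero BA' AB' exB exA pd).
Qed.

Let nS (s : S) := exists2 y, n y & quot_map _ y = s.

Let nS_unit s : ~ nS s -> exists t, t * s = 1.
Proof.
move=> H; have /(local_ring_unit loc)[t ts] : ~ n (repr s).
  by move=> ns; apply: H; exists (repr s) => //; apply: quot_mapK.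
by exists (quot_map _ t); rewrite -[s]quot_mapK -rmorphM ts rmorph1.
Qed.

Let nS1 : ~ nS 1.
Proof.
have [n0 nD nM] := nI; case=> y ny /eqP.
rewrite -subr_eq0 -(rmorph1 (quot_map _)) -rmorphB => /eqP/quot_map_eq0P/ideal_gen_set1[u E].
apply: (local_proper loc); rewrite -[1](subKr y) E.
by apply: nD => //; rewrite -mulNr; apply: nM.
Qed.

(** The cokernel of [A] is a [d]-th syzygy of the residue field, and exactness says that its Tor
    with [M] in degree [1] vanishes. Shifting yields degree [d + 1] against the residue field, so
    that Betti number of [M] is zero. *)
Lemma tail_exact_pd (M : lmodType S) :
  (exists p (g : 'I_p -> M), fg_sub (fun=> True) g) ->
  action_exact M AS BS -> proj_dim_le M d.
Proof.
move=> fgM exM.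
have [F] := minimal_resolution_exists nS_unit nS1 (fun I => @noetherian_fg P _ I noeth) fgM.
apply: (minimal_resolution_pd (F := F)).
(* The resolved module is put in degree [0], so that the augmented complex is uniform and [G_i] sits
   in degree [i + 1]. *)
pose X i : lmodType Qt := if i is i'.+1 then G i' else residue_module f n.
pose de i : {linear X i.+1 -> X i} :=
  match i return {linear X i.+1 -> X i} with 0%N => eps | i'.+1 => del i' end.
pose b i := betti F i.
(* Entries are lifted arbitrarily, so [D] is a complex only modulo [(x)]. *)
pose D i : 'M[Qt]_(b i, b i.+1) := map_mx (@unspecialize _ _ f a) (mr_diff F i).
have DE i : map_mx sp (D i) = mr_diff F i.
  by apply/matrixP => u v; rewrite !mxE unspecializeK.
have [AB BA] := periodic_complex.
have [[es e0 ei] free _] := HG.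
have de2 i z : de i (de i.+1 z) = 0.
  case: i z => [|i] z.
    have : range (del 0%N) (del 0%N z) by exists z.
    by rewrite e0.
  have : range (del i.+1) (del i.+1 z) by exists z.
  by rewrite ei.
have deX i z : inJ xQ c (de i z) -> exists v, inJ xQ c (z - de i.+1 v).
  by case: i z => [|i] z; [apply: reduced_exact.1 | apply: reduced_exact.2].
have DD p i (y : {ffun 'I_(b i.+2) -> X p}) :
    inJ xQ c (matrix_action (D i) (matrix_action (D i.+1) y)).
  rewrite matrix_actionM; apply/inJ_ffun => u; rewrite ffunE; apply: inJ_sum => v _.
  apply: inJ_scale; apply/specialize_eq0.
  have : map_mx sp (D i *m D i.+1) u v = 0; last by rewrite mxE.
  rewrite map_mxM !DE; have /matrixP/(_ u 0) : mr_diff F i *m col v (mr_diff F i.+1) = 0.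
    by apply/mr_ex; exists (delta_mx v 0); rewrite colE.
  by rewrite !mxE => E; rewrite -[RHS]E; apply: eq_bigr => l _; rewrite !mxE.
have DX p i (y : {ffun 'I_(b i.+1) -> X p.+1}) :
    inJ xQ c (matrix_action (D i) y) -> exists u, inJ xQ c (y - matrix_action (D i.+1) u).
  move=> Hy; have [J [bb /free_coords[kappa Hk]]] := free p.
  have [L HL] := Hk _ (fun j => y j).
  have /choice[t Ht] : forall l, exists t, map_mx sp (\col_j kappa l (y j)) =
    mr_diff F i.+1 *m t.
    move=> l; apply/mr_ex; rewrite -DE -map_mxM; apply/map_specialize_inJ/inJ_cV => u.
    have -> : (D i *m \col_j kappa l (y j)) u 0 = kappa l (matrix_action (D i) y u).
      rewrite ffunE linear_sum mxE; apply: eq_bigr => j _.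
      by rewrite linearZ_LR [(\col_j _) j 0]mxE.
    by move/inJ_ffun/(_ u): Hy => /(inJ_linear (kappa l)).
  exists [ffun u => \sum_(l <- L) (unspecialize (t l u 0) : Qt) *: bb l].
  apply/inJ_ffun => j; rewrite !ffunE HL.
  under [X in _ - X]eq_bigr do rewrite ?ffunE scaler_sumr.
  rewrite exchange_big -sumrB; apply: inJ_sum => l _.
  under eq_bigr do rewrite scalerA.
  rewrite -scaler_suml -scalerBl; apply: inJ_scale; apply/specialize_eq0.
  rewrite rmorphB; apply/eqP; rewrite subr_eq0; apply/eqP.
  have /matrixP/(_ j 0) := Ht l; rewrite !mxE => E; rewrite [LHS]E rmorph_sum.
  by apply: eq_bigr => u _; rewrite rmorphM mxE /= !unspecializeK.
apply: (@tor_vanish_betti _ xQ c X de b D _ _ (residue_class n (1 : Qt^o)) d).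
(* Lifts to [P] of entries of a minimal differential differ from elements of [n] by multiples of
   [f'], which is itself in [n]. *)
- move=> i y; apply/ffunP => u; rewrite !ffunE; apply: big1 => j _.
  rewrite mxE /unspecialize residue_scale_n //.
  have [z nz zE] := mr_min F i u j.
  have : quot_map [set \sum_i a i * f i] (repr (mr_diff F i u j) - z) = 0.
    by rewrite rmorphB [X in X - _]quot_mapK [X in _ - X]zE subrr.
  case/quot_map_eq0P/ideal_gen_set1 => w E; have [n0 nD nM] := nI.
  by rewrite -(subrK z (repr _)) E; apply: nD => //; apply: nM.
- by move=> y; have [v _ <-] : range eps y by [rewrite es]; exists v.
- exact: residue_one_notin (local_proper loc).
(* At the far end of the shift, [X d.+1] is [G_d] and [de d.+1] is [del d], given by [A]. *)
rewrite -[X in tor_vanish _ _ _ _ _ X]add0n.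
apply: (tor_vanish_shift de2 deX DD DX); apply: (tor_vanish_tail de2 deX) => y w Hyw.
have [ev [evB evZ evS evK evD]] := tail_coordinates.
pose evA j : {additive G (j + d)%N -> 'cV[S]_N} :=
  HB.pack (ev j) (GRing.isZmodMorphism.Build _ _ (ev j) (evB j)).
have ev0 j g : inJ xQ c g -> ev j g = 0.
  move=> Hg; have := @inJ_semilinear _ _ sp _ _ (evA j) (evZ j)
    xQ (fun=> 0) c _ (fun i _ => esym (specialize_shiftedQ f a i)) Hg.
  by case/inJ_sigma => u Eu; rewrite [LHS]Eu; apply: big1 => i _; rewrite scale0r.
have evDact j q r (C : 'M[S]_(q, r)) (z : {ffun 'I_r -> G (j + d)%N}) u :
    ev j (matrix_action (map_mx (@unspecialize _ _ f a) C) z u) = \sum_l C u l *: ev j (z l).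
  rewrite ffunE -[LHS]/(evA j _) raddf_sum; apply: eq_bigr => l _.
  by rewrite -[LHS]/(ev j _) evZ mxE unspecializeK.
pose Y : 'M[S]_(N, b 1%N) := \matrix_(i, l) ev 0%N (y l) i 0.
pose W : 'M[S]_(N, b 0%N) := \matrix_(i, l) ev 1%N (w l) i 0.
have YW : Y *m (mr_diff F 0%N)^T = AS *m W.
  apply/matrixP => i u; have := ev0 0%N _ ((inJ_ffun _ _ _).1 Hyw u).
  rewrite ffunBE evB => /eqP; rewrite subr_eq0 => /eqP/matrixP/(_ i 0).
  rewrite evDact [X in ev 0%N X]ffunE evD summxE !mxE => E.
  transitivity (\sum_l mr_diff F 0%N u l * ev 0%N (y l) i 0).
    by apply: eq_bigr => l _; rewrite !mxE mulrC.
  transitivity (\sum_j AS i j * ev 1%N (w u) j 0); last first.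
    by apply: eq_bigr => l _; rewrite !mxE.
  by rewrite -E; apply: eq_bigr => l _; rewrite mxE.
have AB' : AS *m BS = 0 by rewrite -map_mxM AB map_mx0.
have [U [T E]] := tail_exact AB' exM YW.
have /choice[u Hu] := fun l => evS 1%N (col l U).
have /choice[t Ht] := fun l => evS 0%N (col l T).
exists (finfun u), (finfun t); apply/inJ_ffun => l; apply: (evK 0%N).
rewrite !ffunBE !evB evDact ffunE evD ffunE Hu.
have -> : \sum_v mr_diff F 1%N l v *: ev 0%N (finfun t v) = col l (T *m (mr_diff F 1%N)^T).
  apply/matrixP => i j; rewrite summxE !mxE; apply: eq_bigr => v _.
  by rewrite ffunE Ht !mxE mulrC.
have -> : ev 0%N (y l) = col l Y by apply/matrixP => i j; rewrite ord1 !mxE.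
rewrite E; apply/matrixP => i j; rewrite !mxE addrAC addrK.
by apply/eqP; rewrite subr_eq0; apply/eqP; apply: eq_bigr => v _; rewrite !mxE.
Qed.

End PeriodicTail.

(** * Minors and exactness on M *)

Section BlockAction.
Variables (S : comPzRingType) (X : lmodType S) (N : nat) (A B : 'M[S]_N).

Lemma block_action_l (w : {ffun 'I_(N + N) -> X}) i :
  matrix_action (block_mx 0 A B 0) w (lshift N i) =
  matrix_action A [ffun l => w (rshift N l)] i.
Proof.
rewrite !ffunE big_split_ord /= big1 ?add0r => [|j _];
  last by rewrite block_mxEul mxE scale0r.
by apply: eq_bigr => j _; rewrite block_mxEur ffunE.
Qed.

Lemma block_action_r (w : {ffun 'I_(N + N) -> X}) i :
  matrix_action (block_mx 0 A B 0) w (rshift N i) =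
  matrix_action B [ffun l => w (lshift N l)] i.
Proof.
rewrite !ffunE big_split_ord /= addrC big1 ?add0r => [|j _];
  last by rewrite block_mxEdr mxE scale0r.
by apply: eq_bigr => j _; rewrite block_mxEdl ffunE.
Qed.

Lemma block_action_exact : action_exact X A B -> action_exact X B A ->
  action_exact X (block_mx 0 A B 0) (block_mx 0 A B 0).
Proof.
move=> exA exB z z0.
have [|u Hu] := exA [ffun l => z (rshift N l)].
  by apply/ffunP => i; rewrite -block_action_l z0 !ffunE.
have [|v Hv] := exB [ffun l => z (lshift N l)].
  by apply/ffunP => i; rewrite -block_action_r z0 !ffunE.
exists [ffun i => match split i with inl j => u j | inr j => v j end].
apply/ffunP => i; rewrite -[i]splitK; case: (split i) => j /=.
  rewrite block_action_l; have /ffunP/(_ j) := Hv; rewrite ffunE => ->.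
  by congr (matrix_action A _ j); apply/ffunP => l; rewrite !ffunE (unsplitK (inr l)).
rewrite block_action_r; have /ffunP/(_ j) := Hu; rewrite ffunE => ->.
by congr (matrix_action B _ j); apply/ffunP => l; rewrite !ffunE (unsplitK (inl l)).
Qed.

Lemma block_actionK : A *m B = 0 -> B *m A = 0 -> forall w : {ffun 'I_(N + N) -> X},
  matrix_action (block_mx 0 A B 0) (matrix_action (block_mx 0 A B 0) w) = 0.
Proof.
move=> AB BA w; rewrite matrix_actionM mulmx_block !mul0mx !mulmx0 !addr0 !add0r AB BA.
by rewrite block_mx_const; apply: matrix_action0.
Qed.

End BlockAction.

Section Minors.
Variables (P : comNzRingType) (n : set P) (k : fieldType) (iota : {rmorphism k -> P}).
Variables (d c N : nat) (f : 'I_c -> P).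
Hypotheses (noeth : noetherian P) (loc : local_ring n) (fn : forall i, n (f i)).
Variables (A B : 'M[generic_hypersurface f]_N).
Variables (G : nat -> lmodType (generic_hypersurface f))
  (del : forall i, {linear G i.+1 -> G i}) (eps : {linear G 0%N -> residue_module f n}).
Hypothesis HG : periodic_free_resolution d A B del eps.
Variables (M : lmodType (ci_ring f)) (m : nat) (e : 'I_m -> restrict (k_to_ci_ring f iota) M).
Hypothesis be : is_basis e.
Local Notation Qt := (generic_hypersurface f).
Local Notation Ms := (poly_module M).
Local Notation blk := (block_mx 0 A B 0).
Local Notation coefQ := (coef_to_Qt f iota).

Section At.
Variable a : 'I_c -> P.
Local Notation S := (quot_ring [set \sum_i a i * f i]).
Local Notation Hm := (hypersurface_module M a).
Local Notation sp := (specialize (f := f) a).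

Definition k_to_hypersurface : k -> S := quot_map [set \sum_i a i * f i] \o iota.
HB.instance Definition _ := GRing.RMorphism.on k_to_hypersurface.

Lemma hypersurfaceZ (y : P) (v : Hm) :
  quot_map [set \sum_i a i * f i] y *: v = (y *: (v : as_P_module M) : as_P_module M).
Proof. exact: (descend_scaleE (XN := @combination_kills _ _ _ M a)). Qed.

Lemma hypersurface_fg : exists p (g : 'I_p -> Hm), fg_sub (fun=> True) g.
Proof.
exists m, (fun l => e l : Hm); split=> // v _.
have [y ->] := scalar_span be (v : as_P_module M).
exists (fun l => quot_map _ (iota (y l))).
by apply: eq_bigr => l _; rewrite hypersurfaceZ.
Qed.

Lemma hypersurface_basis : is_basis (e : 'I_m -> restrict k_to_hypersurface Hm).
Proof.
have [es ef] := basis_ord be.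
have E (y : 'cV[k]_m) : \sum_l y l 0 *: (e l : restrict k_to_hypersurface Hm) =
    (\sum_l y l 0 *: e l : restrict (k_to_ci_ring f iota) M).
  by apply: eq_bigr => l _; apply: hypersurfaceZ.
apply: ord_basis => [v|y].
  by have [y Ey] := es v; exists y; rewrite E.
by rewrite E; apply: ef.
Qed.

Definition eval_ffun r (w : {ffun 'I_r -> Ms}) : {ffun 'I_r -> Hm} :=
  [ffun i => eval_at a (w i)].

Lemma eval_ffunB r (u v : {ffun 'I_r -> Ms}) : eval_ffun (u - v) = eval_ffun u - eval_ffun v.
Proof. by apply/ffunP => i; rewrite !ffunE raddfB. Qed.

Lemma eval_ffunZ r q (u : {ffun 'I_r -> Ms}) : eval_ffun (q *: u) = sp q *: eval_ffun u.
Proof. by apply/ffunP => i; rewrite !ffunE eval_atZ. Qed.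

Lemma eval_ffun_action p q (C : 'M[Qt]_(p, q)) (w : {ffun 'I_q -> Ms}) :
  eval_ffun (matrix_action C w) = matrix_action (map_mx sp C) (eval_ffun w).
Proof.
apply/ffunP => i; rewrite !ffunE raddf_sum; apply: eq_bigr => j _.
by rewrite mxE ffunE; apply: eval_atZ.
Qed.

Lemma eval_ffun_eq0 r (w : {ffun 'I_r -> Ms}) : eval_ffun w = 0 <-> inJ (shiftedQ f a) c w.
Proof.
rewrite inJ_ffun; split=> [w0 i|H].
  by apply/eval_at_eq0; have /ffunP/(_ i) := w0; rewrite !ffunE.
by apply/ffunP => i; rewrite !ffunE; apply/eval_at_eq0.
Qed.

Lemma map_block : map_mx sp blk = block_mx 0 (map_mx sp A) (map_mx sp B) 0.
Proof. by rewrite map_block_mx !map_mx0. Qed.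

End At.

Let r := (m * N)%N.

Let basis_card : #|{: 'I_(N + N) * 'I_m}| = (r + r)%N.
Proof. by rewrite card_prod !card_ord mulnDl /r mulnC. Qed.

Lemma C_endoK (w : restrict coefQ {ffun 'I_(N + N) -> Ms}) :
  C_endo iota A B M (C_endo iota A B M w) = 0.
Proof. by have [AB BA] := periodic_complex HG; apply: (block_actionK AB BA). Qed.

Lemma minor_nonzero_pd (a : 'I_c -> k) (a' : 'I_c -> P) h : lifting f n iota a a' ->
  det_ideal r (C_endo iota A B M) h -> h.@[a] != 0 ->
  proj_dim_le (hypersurface_module M a') d.
Proof.
move=> [cong nzd] [p [q [e1 [e1' [D [b1 b1' HD Hh]]]]]] ha.
have nI := local_is_ideal loc.
(* An element of the ideal that is nonzero at [a] involves a minor that is nonzero at [a]. *)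
have [g [[u [v [_ [_ gE]]]] ga]] : exists g, minors r D g /\ g.@[a] != 0.
  apply: contrapT => H; case/eqP: ha; case/spanP: Hh => l [b [g [Hg ->]]].
  rewrite raddf_sum big1 // => i _ /=; rewrite mevalM.
  have [->|ga] := eqVneq (g i).@[a] 0; first by rewrite mulr0.
  by case: H; exists (g i).
have g0 : g != 0 by apply: contraNneq ga => ->; rewrite meval0.
have b0 := ffun_basisP (N + N) (poly_module_basis be).
have Cex w : C_endo iota A B M w = 0 -> exists w', g *: w = C_endo iota A B M w'.
  rewrite gE; apply: (minor_exact basis_card b0 b1 b1' HD C_endoK).
  by rewrite -gE.
have [AB BA] := periodic_complex HG.
have Cred := @koszul_endo Qt (shiftedQ f a') (coefQ g) c {ffun 'I_(N + N) -> Ms}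
   (matrix_action blk) (block_actionK AB BA) _ Cex.
apply: (tail_exact_pd noeth loc fn HG nzd (hypersurface_fg a')) => z z0.
(* Filling only the second half makes the image of [w] equal to [(A z, 0)] at [a'], and the second
   half of the resulting relation exhibits a multiple of [z] as an image under [B]. *)
pose w : {ffun 'I_(N + N) -> Ms} :=
  [ffun i => match split i with inl _ => 0 | inr j => const_poly (z j) end].
have wr : [ffun l => eval_ffun a' w (rshift N l)] = z.
  by apply/ffunP => l; rewrite !ffunE (unsplitK (inr l)) eval_at_const.
have [||K [w' Hw']] := Cred _ w.
- move=> j y /inJ_ffun Hy; apply/inJ_ffun => i; apply: poly_module_regular.
  by have := Hy i; rewrite ffunE.
- apply/eval_ffun_eq0; rewrite eval_ffun_action map_block; apply/ffunP => i.
  rewrite -[i]splitK; case: (split i) => j /=.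
    rewrite [LHS](block_action_l (map_mx (specialize a') A) (map_mx (specialize a') B)).
    by rewrite wr z0 !ffunE.
  rewrite [LHS](block_action_r (map_mx (specialize a') A) (map_mx (specialize a') B))
    [RHS]ffunE ffunE; apply: big1 => l _.
  by rewrite !ffunE (unsplitK (inl l)) raddf0 scaler0.
(* [g(a')] is congruent to [iota (g(a))] modulo [n], and [g(a)] is invertible in [k]. *)
have /(local_ring_unit loc)[t tg] : ~ n (map_mpoly iota g).@[a'].
  move=> ng; have [n0 nD nM] := nI; apply: (local_proper loc).
  rewrite -(rmorph1 iota) -(mulVf ga) rmorphM; apply/nM.
  rewrite -[iota g.@[a]](subKr (map_mpoly iota g).@[a']); apply/nD => //.
  by rewrite -mulN1r; apply/nM; apply: meval_map_cong nI cong.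
pose s := specialize (f := f) a' (coefQ g).
have [s' ss] : exists s', s' * s = 1.
  by exists (quot_map _ t); rewrite /s specializeE -rmorphM tg rmorph1.
have E : s ^+ K *: eval_ffun a' w = matrix_action (map_mx (specialize a') blk) (eval_ffun
  a' w').
  move/eval_ffun_eq0: Hw'; rewrite eval_ffunB eval_ffunZ eval_ffun_action rmorphXn.
  by move/eqP; rewrite subr_eq0 => /eqP.
exists (s' ^+ K *: [ffun l => eval_ffun a' w' (lshift N l)]); rewrite linearZ /=.
apply/ffunP => i; rewrite ffunE -(block_action_r (map_mx (specialize a') A)).
rewrite -map_block -E !ffunE (unsplitK (inr i)) eval_at_const scalerA -exprMn ss.
by rewrite expr1n scale1r.
Qed.

(** At the constant lifting, the matrix [D] of [C(M)] evaluated at [a] is the matrix over [k] of the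
    specialized endomorphism. Exactness forces its rank to be [r], and a nonzero minor of that size
    is the value of a minor of [D]. *)
Lemma pd_minor_nonzero (a : 'I_c -> k) t :
  non_zero_divisor (\sum_i iota (a i) * f i) ->
  proj_dim_le (hypersurface_module M (fun i => iota (a i))) t ->
  exists2 h, det_ideal r (C_endo iota A B M) h & h.@[a] != 0.
Proof.
move=> nzd pd; pose a' i := iota (a i).
have [exA exB] := pd_tail_exact loc fn HG nzd pd.
have exC := block_action_exact exA exB.
have [AB BA] := periodic_complex HG.
set q := #|{: 'I_(N + N) * 'I_m}|.
pose eW : 'I_q -> restrict coefQ {ffun 'I_(N + N) -> Ms} :=
  ffun_basis coefQ (tensor_basis e) (r := N + N).
have bW : is_basis eW := ffun_basisP (N + N) (poly_module_basis be).
pose eV : 'I_q -> restrict (k_to_hypersurface a') {ffun 'I_(N + N) ->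
  hypersurface_module M a'} :=
  ffun_basis (k_to_hypersurface a') (e : 'I_m -> hypersurface_module M a') (r := N + N).
have bV : is_basis eV := ffun_basisP (N + N) (hypersurface_basis a').
have [D HD] := endo_represented (C_endo iota A B M) bW.
have DD := represents_square0 bW HD C_endoK.
pose De := map_mx (meval a) D.
pose V : lmodType k :=
  restrict (k_to_hypersurface a') {ffun 'I_(N + N) -> hypersurface_module M a'}.
pose gV : {linear V -> V} := restrict_map (matrix_action
  (block_mx 0 (map_mx (specialize a') A) (map_mx (specialize a') B) 0)).
have evE j : eval_ffun a' (eW j) = eV j.
  apply/ffunP => i; rewrite !ffunE; case: ifP => _; last exact: raddf0.
  exact: eval_at_const.
have HV : represents gV (eV : 'I_q -> V) (eV : 'I_q -> V) De.
  move=> j; rewrite -evE.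
  transitivity (eval_ffun a' (C_endo iota A B M (eW j))).
    by rewrite [RHS]eval_ffun_action map_block.
  rewrite HD.
  have evS (F : 'I_q -> {ffun 'I_(N + N) -> Ms}) :
      eval_ffun a' (\sum_i F i) = \sum_i eval_ffun a' (F i).
    by apply/ffunP => i; rewrite ffunE !sum_ffunE raddf_sum; apply: eq_bigr => l _;
      rewrite ffunE.
  rewrite [LHS]evS; apply: eq_bigr => i _; rewrite [LHS]eval_ffunZ evE mxE.
  by rewrite specializeE meval_map_morph.
have rD : \rank De = r.
  have := exact_rank bV HV _ exC; rewrite -map_mxM DD map_mx0 => /(_ erefl) E.
  by apply: double_inj; rewrite -!addnn; apply: etrans E basis_card.
have [u [v [iu iv duv]]] := rank_minor De.
move: u v iu iv duv; rewrite rD => u v iu iv duv.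
exists (\det (mxsub u v D)); last first.
  rewrite -[_.@[a]]/(meval a _) -det_map_mx.
  by rewrite map_mxsub.
exists q, q, eW, eW, D; split=> //.
by apply: mem_span; exists u, v.
Qed.

End Minors.

(** * The origin, and the equality of the two sets *)

Lemma ideal_square_sub (P : comNzRingType) (n : set P) : is_ideal n -> ideal_square n `<=` n.
Proof.
move=> nI; apply: ideal_gen_sub => // _ [x [y [_ ny ->]]].
by case: nI => _ _; apply.
Qed.

(* [y ^ 2] comes from the lifting [(y, 0, ..., 0)] of the origin when [y = f_0].  Over
   [P / (y ^ 2)] the complex with both maps [y] is exact, whereas [y] kills [M]. *)
Lemma square_hypersurface_pd (P : comNzRingType) (c : nat) (f : 'I_c -> P)
    (M : lmodType (ci_ring f)) (a : 'I_c -> P) (y : P) t :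
  (1 : quot_ring [set \sum_i a i * f i]) != 0 ->
  \sum_i a i * f i = y * y -> non_zero_divisor y ->
  (forall v : as_P_module M, y *: v = 0) ->
  proj_dim_le (hypersurface_module M a) t -> forall v : M, v = 0.
Proof.
set X := [set _] => S1 fE nzd y0 pd v.
pose Y : 'M[quot_ring X]_1 := (quot_map X y)%:M.
have Y2 : Y *m Y = 0.
  rewrite mul_scalar_mx scale_scalar_mx -rmorphM /= quot_map_eq0 ?raddf0 //.
  by rewrite -fE; apply: mem_span.
have exY : action_exact (quot_ring X)^o Y Y.
  apply: cV_action_exact => z; rewrite mul_scalar_mx => /matrixP/(_ 0 0).
  rewrite !mxE -[z 0 0]quot_mapK -rmorphM => /quot_map_eq0P/ideal_gen_set1[w].
  rewrite fE mulrA [y * _]mulrC => /eqP; rewrite -subr_eq0 -mulrBl mulrC => /eqP/nzd/eqP.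
  rewrite subr_eq0 => /eqP E; exists (\col_i quot_map X w); apply/matrixP => i j.
  rewrite !ord1 mul_scalar_mx !mxE -[LHS]quot_mapK E rmorphM; exact: mulrC.
have exM := pd_action_exact_pz S1 Y2 Y2 exY exY pd.
have act0 (z : {ffun 'I_1 -> hypersurface_module M a}) : matrix_action Y z = 0.
  apply/ffunP => i; rewrite !ffunE big_ord1 mxE ord1 eqxx mulr1n.
  by rewrite hypersurfaceZ; apply: y0.
have [u] := exM [ffun=> (v : hypersurface_module M a)] (act0 _).
by rewrite act0 => /ffunP/(_ 0); rewrite !ffunE.
Qed.

Theorem theorem4p4 (P : comNzRingType) (n : set P) (k : fieldType)
    (iota : {rmorphism k -> P}) (d c : nat) (f : 'I_c -> P)
    (A B : 'M[generic_hypersurface f]_(2 ^ d.-1))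
    (G : nat -> lmodType (generic_hypersurface f))
    (del : forall i, {linear G i.+1 -> G i})
    (eps : {linear G 0%N -> residue_module f n})
    (M : lmodType (ci_ring f)) (m : nat) :
  regular_local_ring n d ->
  contains_residue_field n iota ->
  (0 < c)%N ->
  regular_sequence f ->
  (forall i, ideal_square n (f i)) ->
  periodic_free_resolution d A B del eps ->
  free_of_rank (restrict (k_to_ci_ring f iota) M) m ->
  support_set M n iota =
    [set a | forall h, det_ideal (m * 2 ^ d.-1) (C_endo iota A B M) h ->
                       h.@[a] = 0].
Proof.
move=> [noeth loc _ _] _ c0 freg fsq HG [e be].
have nI := local_is_ideal loc.
have fn i : n (f i) by apply: ideal_square_sub (fsq i).
apply/seteqP; split=> a /=.
  move=> [a' [lift_a pdinf]] h Hh; apply/eqP; apply: contraT => ha; exfalso.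
  exact: pdinf (minor_nonzero_pd noeth loc fn HG be lift_a Hh ha).
move=> Ha; have [n0 nD nM] := nI.
have [[i ai]|a0] := pselect (exists i, a i != 0).
  (* The last nonzero coordinate, because [regular_sequence_combination] requires all later
     coefficients to be zero. *)
  have [i0 ai0 i0max] := @arg_maxnP _ i (fun j => a j != 0) (@nat_of_ord c) ai.
  have nzd : non_zero_divisor (\sum_j iota (a j) * f j).
    apply: (regular_sequence_combination noeth loc fn freg (i0 := i0)).
      by exists (iota (a i0)^-1); rewrite -rmorphM mulVf // rmorph1.
    move=> j ij; have [->|aj] := eqVneq (a j) 0; first by rewrite rmorph0.
    by have := i0max j aj; rewrite /= leqNgt ij.
  exists (fun i => iota (a i)); split; first by split=> // j; rewrite subrr.
  move=> t pd; have [h Hh] := pd_minor_nonzero loc fn HG be nzd pd.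
  by rewrite Ha ?eqxx.
have {}a0 i : a i = 0 by apply/eqP/negPn/negP => ai; apply: a0; exists i.
pose i0 := Ordinal c0; pose a' i := if i == i0 then f i0 else 0.
have fE : \sum_i a' i * f i = f i0 * f i0.
  by rewrite (bigD1 i0) //= /a' eqxx big1 ?addr0 // => i /negPf->; rewrite mul0r.
have nzd0 : non_zero_divisor (f i0).
  (* The ideal generated by no elements is zero, so the first regularity condition is cancellation
     of [f_0]. *)
  move=> y fy; have : ideal_gen (f @` [set j : 'I_c | (j < i0)%N]) y.
    by apply: freg.1; rewrite mulrC fy; case: (ideal_gen_is_ideal (f @` [set j : 'I_c | (j
      < i0)%N])).
  by case/spanP => p [b [g [Hg ->]]]; apply: big1 => l _; have [] := Hg l.
have nzd : non_zero_divisor (\sum_i a' i * f i).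
  by rewrite fE => y; rewrite -mulrA => /nzd0/nzd0.
exists a'; split.
  split=> // i; rewrite a0 rmorph0 subr0 /a'; by case: ifP.
move=> t pd.
have M0 : forall v : M, v = 0.
  apply: (square_hypersurface_pd (quot_nonzero loc fn a') fE nzd0 _ pd) => v.
  exact: scale_f0.
(* For [M = 0] the size [r] is [0] and the empty minor is [1], so no point satisfies the vanishing
   condition, contradicting [Ha]. *)
have m0 : m = 0%N.
  case: m e be Ha => // m e be _; have [_ /(_ (const_mx 1))] := basis_ord be.
  rewrite big1 => [/(_ erefl)/matrixP/(_ ord0 0)/eqP|l _].
    by rewrite !mxE oner_eq0.
  by rewrite (M0 (e l)) scaler0.
have bW := ffun_basisP (2 ^ d.-1 + 2 ^ d.-1) (poly_module_basis be).
have [D HD] := endo_represented (C_endo iota A B M) bW.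
suff /Ha/eqP : det_ideal (m * 2 ^ d.-1) (C_endo iota A B M) 1.
  by rewrite meval1 oner_eq0.
eexists _, _, _, _, D; split; [exact: bW | exact: bW | exact: HD |].
have r0 : (m * 2 ^ d.-1)%N = 0%N by rewrite m0.
apply: mem_span; rewrite r0; have f0 q : 'I_0 -> 'I_q by case.
have inj0 q : injective (f0 q) by case.
by exists (f0 _), (f0 _); split; [exact: inj0 | split; [exact: inj0 | rewrite det_mx00]].
Qed.
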